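(* For every fixed integer $m\geq1$, \[ \overline{\chi}(\mathbb{R}^{n};m)\geq\left(\Gamma_{\chi}\sqrt{m+1}+o(1)\right)^{n}, \] where $o(1)$ denotes a quantity tending to $0$ as $n\to\infty$ (with $m$ fixed), and \[ \Gamma_{\chi}=\sqrt{\tfrac{\pi}{2}}\max_{x>0}\frac{1-e^{-x}}{\sqrt{x}}=0.7998308498\dots. \]
   Context: For a finite set $A\subset\mathbb{R}_{>0}$ of distances, $G_{A}(\mathbb{R}^{n})$ is the graph with vertex set $\mathbb{R}^{n}$ in which $x,y$ are adjacent iff $\|x-y\|_{2}\in A$, and $\chi(\mathbb{R}^{n},A)$ denotes its chromatic number. The $m$-distance chromatic number is $\overline{\chi}(\mathbb{R}^{n};m)=\max_{A\subset\mathbb{R}_{>0},\,|A|=m}\chi(\mathbb{R}^{n},A)$. *)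

(* Defs.v *)
From mathcomp Require Import all_boot all_order all_algebra.
From mathcomp Require Import all_classical all_reals all_analysis.
From mathcomp Require Import lra.

Set Implicit Arguments.
Unset Strict Implicit.
Unset Printing Implicit Defensive.

Import Order.TTheory GRing.Theory Num.Theory.
Import numFieldNormedType.Exports.

Local Open Scope classical_set_scope.
Local Open Scope ring_scope.

Definition proper_coloring (V : Type) (adj : V -> V -> Prop) (k : nat)
    (c : V -> 'I_k) : Prop :=
  forall x y : V, adj x y -> c x <> c y.

Definition colorable (V : Type) (adj : V -> V -> Prop) (k : nat) : Prop :=
  exists c : V -> 'I_k, proper_coloring adj c.

(* The value is +oo when the graph has no finite proper coloring. *)
Definition chromatic_number (R : realType) (V : Type) (adj : V -> V -> Prop) :
    \bar R :=
  ereal_inf [set k%:R%:E | k in [set k | colorable adj k]].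

(* The library's norm on 'rV[R]_n is the sup norm, hence this definition. *)
Definition euclidean_norm (R : realType) (n : nat) (x : 'rV[R]_n) : R :=
  Num.sqrt (\sum_(i < n) x ord0 i ^+ 2).

Definition distance_graph (R : realType) (n : nat) (A : set R) :
    'rV[R]_n -> 'rV[R]_n -> Prop :=
  fun x y => A (euclidean_norm (x - y)).

Definition chi (R : realType) (n : nat) (A : set R) : \bar R :=
  chromatic_number R (@distance_graph R n A).

Definition distance_sets (R : realType) (m : nat) : set (set R) :=
  [set A | A `<=` [set d | 0 < d] /\ (A #= `I_m)%card].
Arguments distance_sets : clear implicits.

(* A maximum: see m_distance_chromatic_number_max. *)
Definition m_distance_chromatic_number (R : realType) (n m : nat) : \bar R :=
  ereal_sup [set chi n A | A in distance_sets R m].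

Definition Gamma_profile (R : realType) (x : R) : R :=
  (1 - expR (- x)) / Num.sqrt x.

(* The supremum is a maximum: see Gamma_profile_max. *)
Definition Gamma_chi (R : realType) : R :=
  Num.sqrt (pi / 2) * sup [set Gamma_profile x | x in [set x : R | 0 < x]].

(* 0.7998308498 in blocks of three digits: MathComp numerals are unary. *)
Definition Gamma_chi_truncated (R : realType) : R :=
  799 / 10 ^+ 3 + 830 / 10 ^+ 6 + 849 / 10 ^+ 9 + 8 / 10 ^+ 10.

Lemma chromatic_numberE (R : realType) (V : Type) (adj : V -> V -> Prop) K :
  colorable adj K ->
  exists k, [/\ (k <= K)%N, colorable adj k &
                chromatic_number R adj = k%:R%:E].
Proof.
move=> cK.
have exK : exists k, `[< colorable adj k >] by exists K; apply/asboolP.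
exists (ex_minn exK); case: ex_minnP => k /asboolP ck kmin.
split => //; first by apply: kmin; apply/asboolP.
apply/eqP; rewrite eq_le; apply/andP; split.
  by apply: ereal_inf_lbound; exists k.
apply: le_ereal_inf_tmp => _ [j /= cj <-].
by rewrite lee_fin ler_nat; apply: kmin; apply/asboolP.
Qed.

Lemma colorable_fin (V : Type) (adj : V -> V -> Prop) (C : finType)
    (c : V -> C) :
  (forall x y, adj x y -> c x <> c y) -> colorable adj #|C|.
Proof.
by move=> cP; exists (fun x => enum_rank (c x)) => x y /cP ne /enum_rank_inj.
Qed.

(* The cell of x in a grid of cubes of side d / (n + 1), coordinates taken
   modulo n + 2. *)
Definition cube_color (R : realType) (n : nat) (d : R) (x : 'rV[R]_n) :
    {ffun 'I_n -> 'I_n.+2} :=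
  [ffun i => inord
    `|(Num.floor (x ord0 i / (d / n.+1%:R)) %% n.+2%:Z)%Z|%N].

Lemma cube_color_proper (R : realType) (n : nat) (d : R) (x y : 'rV[R]_n) :
  0 < d -> euclidean_norm (x - y) = d -> cube_color d x <> cube_color d y.
Proof.
move=> d0 xyd /ffunP ceq.
pose s := d / n.+1%:R.
have s0 : 0 < s by rewrite divr_gt0 // ltr0n.
have dE : d = s * n.+1%:R by rewrite /s divfK // pnatr_eq0.
have sqE : \sum_(i < n) (x - y) ord0 i ^+ 2 = d ^+ 2.
  by rewrite -xyd sqr_sqrtr // sumr_ge0 // => i _; rewrite sqr_ge0.
have coord i : `|(x - y) ord0 i| <= d.
  rewrite -xyd -sqrtr_sqr ler_wsqrtr // (bigD1 i) //= lerDl.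
  by rewrite sumr_ge0 // => j _; rewrite sqr_ge0.
have small i : (x - y) ord0 i ^+ 2 <= s ^+ 2.
  have := ceq i; rewrite !ffunE -/s => /(congr1 val) /=.
  have bnd z : (`|(z %% n.+2%:Z)%Z| < n.+2)%N.
    by rewrite -ltz_nat gez0_abs ?modz_ge0 // ltz_pmod.
  rewrite !inordK // => /(congr1 Posz); rewrite !gez0_abs ?modz_ge0 //.
  set p := Num.floor _; set q := Num.floor _ => /eqP.
  rewrite eqz_mod_dvd => /dvdzP[k pq].
  have xs : x ord0 i = x ord0 i / s * s by rewrite divfK // gt_eqF.
  have ys : y ord0 i = y ord0 i / s * s by rewrite divfK // gt_eqF.
  have /andP[p1 p2] := floor_itv (x ord0 i / s).
  have /andP[q1 q2] := floor_itv (y ord0 i / s).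
  rewrite -/p -/q !intrD in p1 p2 q1 q2.
  set a := x ord0 i / s in xs p1 p2; set b := y ord0 i / s in ys q1 q2.
  have xyE : (x - y) ord0 i = (a - b) * s by rewrite !mxE xs ys mulrBl.
  have pqR : p%:~R - q%:~R = k%:~R * n.+2%:R :> R.
    by rewrite -intrB pq intrM.
  have abn : `|a - b| <= n.+1%:R.
    by have := coord i; rewrite xyE normrM (gtr0_norm s0) dE mulrC ler_pM2l.
  have k0 : k = 0.
    apply/eqP/negP => /negP kn0.
    have : n.+2%:R <= `|p%:~R - q%:~R| :> R.
      rewrite pqR normrM normr_nat -{1}[n.+2%:R]mul1r ler_wpM2r //.
      by rewrite -intr_norm ler1z -gtz0_ge1 normr_gt0.
    rewrite leNgt => /negP; apply.
    rewrite -natr1; move: abn; rewrite ler_norml => /andP[l1 l2].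
    by rewrite ltr_norml; apply/andP; split; lra.
  move: pqR; rewrite k0 mul0r => pqR.
  rewrite -[leLHS]real_normK ?num_real // lerXn2r ?nnegrE // ?(ltW s0) //.
  rewrite xyE normrM (gtr0_norm s0) ler_piMl ?(ltW s0) //.
  by rewrite ler_norml; apply/andP; split; lra.
have : d ^+ 2 <= n%:R * s ^+ 2.
  rewrite -sqE; apply: (le_trans (ler_sum _ (fun i _ => small i))).
  by rewrite sumr_const card_ord mulr_natl.
rewrite leNgt => /negP; apply.
rewrite dE [ltRHS]exprMn [ltLHS]mulrC ltr_pM2l ?exprn_gt0 // -natrX ltr_nat.
by rewrite expnS expn1 mulnS addSn ltnS -[leqLHS]addn0 leq_add.
Qed.

Lemma distance_graph_colorable (R : realType) (n m : nat) (A : set R) :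
  distance_sets R m A ->
  colorable (@distance_graph R n A)
    #|{ffun 'I_m -> {ffun 'I_n -> 'I_n.+2}}|.
Proof.
move=> [Apos]; rewrite card_eq_sym => /card_set_bijP[f [fA _ fsurj]].
apply: (colorable_fin (c := fun x => [ffun j : 'I_m => cube_color (f j) x])).
move=> x y Axy /ffunP ceq.
have [j /= jm fj] := fsurj _ Axy.
have := ceq (Ordinal jm); rewrite !ffunE /=.
by apply: cube_color_proper => //; rewrite fj; apply: Apos.
Qed.

Lemma distance_sets_nonempty (R : realType) (m : nat) :
  distance_sets R m !=set0.
Proof.
exists [set k.+1%:R | k in `I_m]; split; first by move=> _ [k _ <-] /=.
apply: inj_card_eq => i j _ _ /eqP.
by rewrite eqr_nat => /eqP [].
Qed.

Lemma m_distance_chromatic_number_max (R : realType) (n m : nat) :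
  exists2 A, distance_sets R m A &
    m_distance_chromatic_number R n m = chi n A /\ chi n A \is a fin_num.
Proof.
set K := #|{ffun 'I_m -> {ffun 'I_n -> 'I_n.+2}}|.
have chiE A : distance_sets R m A ->
    exists2 k, (k <= K)%N & chi n A = k%:R%:E.
  move=> /(@distance_graph_colorable R n)/(chromatic_numberE R)[k [kK _ kE]].
  by exists k.
pose P k := `[< exists2 A, distance_sets R m A & chi n A = k%:R%:E >].
have exP : exists k, P k.
  have [A mA] := distance_sets_nonempty R m; have [k _ kE] := chiE A mA.
  by exists k; apply/asboolP; exists A.
have ubP k : P k -> (k <= K)%N.
  move=> /asboolP[A mA kE]; have [j jK] := chiE A mA.
  by rewrite kE => -[] /eqP; rewrite eqr_nat => /eqP ->.
case: (ex_maxnP exP ubP) => k /asboolP[A mA kE] kmax.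
exists A => //; split; last by rewrite kE.
apply/eqP; rewrite eq_le; apply/andP; split; last first.
  by apply: ereal_sup_ubound; exists A.
apply: ge_ereal_sup => _ [B mB <-]; have [j _ jE] := chiE B mB.
rewrite kE jE lee_fin ler_nat; apply: kmax.
by apply/asboolP; exists B.
Qed.

Lemma Gamma_profile_max (R : realType) :
  exists2 x0 : R, 0 < x0 &
    Gamma_profile x0 = sup [set Gamma_profile x | x in [set x : R | 0 < x]].
Proof.
have half : 1 / 2 <= Gamma_profile (1 : R).
  rewrite /Gamma_profile sqrtr1 divr1 expRN.
  have := @expR_ge1Dx R 1 => e2.
  suff : (expR 1)^-1 <= 2^-1 :> R by lra.
  by rewrite lef_pV2 ?posrE ?expR_gt0 //; lra.
have cont : {within `[4^-1, 4], continuous (@Gamma_profile R)}.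
  apply: continuous_in_subspaceT => x; rewrite inE /= in_itv /= => /andP[x1 _].
  have x0 : 0 < x by apply: lt_le_trans x1; rewrite invr_gt0.
  apply: cvgM.
    apply: cvgB; first exact: cvg_cst.
    by apply: (continuous_comp (@oppr_continuous _ _ x)); exact: continuous_expR.
  by apply: cvgV; [rewrite gt_eqF // sqrtr_gt0 | exact: sqrt_continuous].
have le44 : 4^-1 <= 4 :> R by lra.
have [c] := EVT_max le44 cont.
rewrite in_itv /= => /andP[c1 c2] cmax.
have c0 : 0 < c by apply: lt_le_trans c1; rewrite invr_gt0.
have half_c : 1 / 2 <= Gamma_profile c.
  by apply: (le_trans half); apply: cmax; rewrite in_itv /=; lra.
have gmax x : 0 < x -> Gamma_profile x <= Gamma_profile c.
  move=> x0.
  have sx0 : 0 < Num.sqrt x by rewrite sqrtr_gt0.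
  have xE : x = Num.sqrt x * Num.sqrt x by rewrite -expr2 sqr_sqrtr ?ltW.
  have [xlt|xge] := ltP x 4^-1.
    apply: le_trans half_c; rewrite /Gamma_profile ler_pdivrMr //.
    have e1 := @expR_ge1Dx R (- x).
    have : Num.sqrt x <= 1 / 2.
      by rewrite leNgt; apply/negP => s12; nra.
    by move=> s12; nra.
  have [xle|xgt] := leP x 4; first by apply: cmax; rewrite in_itv /= xge.
  apply: le_trans half_c; rewrite /Gamma_profile ler_pdivrMr //.
  have e0 := expR_gt0 (- x).
  have : 2 <= Num.sqrt x.
    by rewrite leNgt; apply/negP => s2; nra.
  by lra.
exists c => //; apply/eqP; rewrite eq_le; apply/andP; split.
  apply: ub_le_sup; last by exists c.
  by exists (Gamma_profile c) => _ [x /= x0 <-]; exact: gmax.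
apply: ge_sup; first by exists (Gamma_profile c); exists c.
by move=> _ [x /= x0 <-]; exact: gmax.
Qed.

(* Main.v *)
(* Take the integer points of a ball whose squared norms are congruent to one c
   modulo 2p, p prime, with 4 r^2 < 2p(m+1) for the radius r.  As
   |x-y|^2 = |x|^2 + |y|^2 - 2 x.y, two of them are at one of the m distances
   sqrt(2pj), 1 <= j <= m, as soon as p divides x.y - c; so a set avoiding these
   distances has, as in Frankl and Wilson, at most about as many points as there
   are monomials of degree p-1 in n+1 variables, hence at most about
   e^(x(p-1)) (1 - e^(-x))^(-n-1) for every x > 0.  The ball is counted by
   exponential tilting of Gaussian sums.  For p ~ n/(2x), which exists because
   p_(k+1) ~ p_k (Selberg's formula and Erdos' argument), the quotient of the two
   counts is (sqrt(pi/2) (1 - e^(-x)) / sqrt x * sqrt(m+1) + o(1))^n.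
   At the optimum e^x = 1 + 2x, so the square of the constant is 2 pi x / (1+2x)^2,
   evaluated from alternating Taylor polynomials of cos and exp. *)

Require Import Defs.
From mathcomp Require Import all_boot all_order all_algebra.
From mathcomp Require Import all_classical all_reals all_analysis.
From mathcomp Require Import ring lra zify.
From mathcomp Require finfield.

Set Implicit Arguments.
Unset Strict Implicit.
Unset Printing Implicit Defensive.

Import Order.TTheory GRing.Theory Num.Theory.
Import numFieldNormedType.Exports.

Local Open Scope classical_set_scope.
Local Open Scope ring_scope.

(** * Primes in short intervals *)

(** A prime exceeding n/(2x) by a fixed factor, as Bertrand's postulate would give, lowers the base
    of the exponential; hence the need for primes in (N, N + N/s] for every fixed s. Selberg's
    formula is used by contradiction. It bounds the growth of [psi] on short intervals by rate 2 +
    o(1). If (N, N + h] has no prime, the formula forces [psi] to grow at this maximal rate on (N/k,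
    (N + h)/k] for nearly all k in the weight [L k / k]. Such intervals are chained over a long
    logarithmic range, where Mertens' estimate allows only average rate 1.

    The radius of the ball is of order sqrt n, so unit cells are not small and the integer points
    cannot be counted by volume. A finer grid Z/M is counted instead, by Riemann sums, and
    pigeonholing its residues modulo M leaves a translate of the integer lattice. Only differences
    of points matter, so the translation is harmless.

    The modulus is 2p because |x-y|^2 is congruent to 2(c - x.y) modulo 2p: the forbidden squared
    distances are then multiples of 2p, twice as sparse as multiples of p. *)

Section DivisorSums.
Variable V : nmodType.

Lemma sum_multiples (a N : nat) (f : nat -> V) : (0 < a)%N ->
  \sum_(1 <= n < N.+1 | (a %| n)%N) f n = \sum_(1 <= b < (N %/ a).+1) f (a * b)%N.
Proof.
move=> a0; elim: N => [|N IH]; first by rewrite div0n !big_geq.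
rewrite big_mkcond big_nat_recr //= -big_mkcond IH divnS //.
case: ifPn => [aN|_]; last by rewrite addr0.
rewrite [RHS]big_nat_recr //= -[X in f X](divnK aN) divnS // aN.
by rewrite mulnC.
Qed.

(** Both sides run over the pairs with a * b <= N; on the right they are grouped by their
    product. *)
Lemma sum_hyperbola (N : nat) (f : nat -> nat -> V) :
  \sum_(1 <= a < N.+1) \sum_(1 <= b < (N %/ a).+1) f a (a * b)%N =
  \sum_(1 <= n < N.+1) \sum_(1 <= a < N.+1 | (a %| n)%N) f a n.
Proof.
rewrite [RHS](exchange_big_dep_nat xpredT) //=.
by apply: eq_big_nat => a /andP[a0 _]; rewrite sum_multiples.
Qed.

Lemma sum_hyperbola_sym (N : nat) (f : nat -> nat -> V) :
  \sum_(1 <= a < N.+1) \sum_(1 <= b < (N %/ a).+1) f a b =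
  \sum_(1 <= b < N.+1) \sum_(1 <= a < (N %/ b).+1) f a b.
Proof.
have E (g : nat -> nat -> V) :
    \sum_(1 <= a < N.+1) \sum_(1 <= b < (N %/ a).+1) g a b =
    \sum_(1 <= a < N.+1) \sum_(1 <= b < N.+1 | (a * b <= N)%N) g a b.
  apply: eq_big_nat => a /andP[a0 _].
  rewrite [LHS](big_nat_widen _ _ N.+1); last by rewrite ltnS leq_div.
  by apply: eq_bigl => b; rewrite /= ltnS leq_divRL // mulnC.
rewrite !E (exchange_big_dep_nat xpredT) //=.
by apply: eq_bigr => b _; apply: eq_bigl => a; rewrite mulnC.
Qed.

End DivisorSums.

(** The Möbius function, computed by stripping the least prime factor, with [k] as fuel; the value
    at 0 is a default 1. *)
Fixpoint moebius_rec (k n : nat) : int :=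
  if k is k'.+1 then
    let p := pdiv n in
    if (n <= 1)%N then 1 else if (p %| n %/ p)%N then 0
    else - moebius_rec k' (n %/ p)
  else 1.

Definition moebius (n : nat) : int := moebius_rec n n.

Lemma moebius_rec_fuel (k n : nat) : (n <= k)%N -> moebius_rec k n = moebius n.
Proof.
rewrite /moebius; elim/ltn_ind: n k => n IH [|k]; first by case: n {IH}.
case: n IH => [|[|n]] IH //= nk.
have lt1 : (n.+2 %/ pdiv n.+2 < n.+2)%N by rewrite ltn_Pdiv // prime_gt1 // pdiv_prime.
case: ifP => // _; congr (- _); rewrite IH //; last by rewrite -ltnS (leq_trans lt1).
exact: esym (IH _ lt1 n.+1 _).
Qed.

Lemma moebiusE (n : nat) : (1 < n)%N ->
  moebius n = if (pdiv n %| n %/ pdiv n)%N then 0 else - moebius (n %/ pdiv n).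
Proof.
case: n => [|[|n]] // _; rewrite {1}/moebius /=.
case: ifP => // _; rewrite -(moebius_rec_fuel (k := n.+1)) //.
by rewrite -ltnS ltn_Pdiv // prime_gt1 // pdiv_prime.
Qed.

Lemma moebius1 : moebius 1 = 1. Proof. by []. Qed.

Lemma moebius_norm (n : nat) : `|moebius n| <= 1.
Proof.
elim/ltn_ind: n => n IH; case: (leqP n 1) => [|n1]; first by case: n {IH} => [|[]].
rewrite moebiusE //; case: ifP => // _; rewrite normrN IH //.
by rewrite ltn_Pdiv ?(ltnW n1) // prime_gt1 // pdiv_prime.
Qed.

(** A prime not larger than any prime factor of n is the least prime factor of every divisor p * b
    of n, so the recursion strips exactly p. *)
Lemma moebius_pdivM (p b n : nat) : prime p -> (forall q, prime q -> q %| n -> p <= q)%N ->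
  (0 < n)%N -> (p * b %| n)%N ->
  moebius (p * b) = if (p %| b)%N then 0 else - moebius b.
Proof.
move=> pp pmin n0 pbn.
have p0 := prime_gt0 pp.
have pb0 : (0 < p * b)%N by apply: dvdn_gt0 pbn.
have b0 : (0 < b)%N by move: pb0; rewrite muln_gt0 => /andP[].
have pb1 : (1 < p * b)%N by rewrite (leq_trans (prime_gt1 pp)) // leq_pmulr.
have E : pdiv (p * b) = p.
  apply/eqP; rewrite eqn_leq pdiv_min_dvd ?prime_gt1 ?dvdn_mulr //=.
  by rewrite pmin ?pdiv_prime // (dvdn_trans (pdiv_dvd _)).
by rewrite moebiusE // E mulKn.
Qed.

(** With p the least prime factor of n > 1, the divisors prime to p cancel against their multiples
    by p; multiples of p^2 contribute 0. *)
Lemma sum_moebius (n N : nat) : (0 < n <= N)%N ->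
  \sum_(1 <= d < N.+1 | (d %| n)%N) moebius d = (n == 1%N)%:R.
Proof.
move=> /andP[n0 nN]; case: (ltngtP n 1%N) => [|n1|n1]; first by case: n n0 nN.
  set p := pdiv n.
  have pp : prime p by rewrite pdiv_prime.
  have p0 := prime_gt0 pp.
  have pn : (p %| n)%N by rewrite pdiv_dvd.
  rewrite (bigID (fun d => (p %| d)%N)) /=.
  rewrite (eq_bigl (fun d => (p %| d) && (d %| n))%N); last by move=> d; rewrite andbC.
  rewrite big_mkcondr /= sum_multiples //.
  rewrite (eq_big_nat _ _ (F2 := fun b => if (b %| n %/ p)%N && ~~ (p %| b)%N
             then - moebius b else 0)); last first.
    move=> b /andP[b0 _]; rewrite mulnC -dvdn_divRL // mulnC.
    case: ifP => //= h; rewrite (moebius_pdivM (n := n)) //; first by case: ifP.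
      by move=> q pq qn; rewrite pdiv_min_dvd // prime_gt1.
    by rewrite mulnC -dvdn_divRL.
  rewrite -big_mkcond sumrN.
  rewrite [X in - X](big_nat_widen _ _ N.+1); last by rewrite ltnS leq_div.
  apply/eqP; rewrite addrC subr_eq0; apply/eqP; apply: eq_bigl => d.
  case: (boolP (p %| d)%N) => pd; rewrite ?andbF //= ?andbT.
  have cop : coprime d p by rewrite coprime_sym prime_coprime.
  rewrite -[in LHS](divnK pn) Gauss_dvdl //.
  case dn: (d %| n %/ p)%N => //=; rewrite ltnS; symmetry.
  rewrite (leq_trans (dvdn_leq _ dn)) ?divn_gt0 ?(dvdn_leq n0) //.
  by rewrite leq_div2r.
rewrite n1 big_mkcond big_ltn; last by rewrite ltnS -n1; exact: leq_trans nN.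
rewrite dvdnn moebius1 big1_seq ?addr0 // => d /andP[_].
rewrite mem_index_iota dvdn1 => /andP[d1 _].
by rewrite gtn_eqF.
Qed.

(** * The von Mangoldt function and its divisor sum *)

Section VonMangoldt.
Variable R : realType.

Definition mangoldt (n : nat) : R :=
  if (1 < n)%N && (n == pdiv n ^ logn (pdiv n) n)%N then ln (pdiv n)%:R else 0.

Lemma mangoldt_ge0 n : 0 <= mangoldt n.
Proof.
by rewrite /mangoldt; case: ifP => // _; rewrite ln_ge0 // ler1n pdiv_gt0.
Qed.

Lemma mangoldt_le n : (0 < n)%N -> mangoldt n <= ln n%:R.
Proof.
move=> n0; rewrite /mangoldt; case: ifP => [_|_].
  by rewrite ler_ln ?posrE ?ltr0n ?pdiv_gt0 // ler_nat dvdn_leq ?pdiv_dvd.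
by rewrite ln_ge0 // ler1n.
Qed.

Lemma mangoldt_primeX p k : prime p -> (0 < k)%N -> mangoldt (p ^ k) = ln p%:R.
Proof.
move=> pp k0; case: k k0 => // k _; rewrite /mangoldt pdiv_pfactor // pfactorK // eqxx andbT.
by rewrite (leq_trans (prime_gt1 pp)) // expnS leq_pmulr // expn_gt0 prime_gt0.
Qed.

Lemma mangoldt_neq0 n : mangoldt n != 0 ->
  exists p k, [/\ prime p, (0 < k)%N & n = (p ^ k)%N].
Proof.
rewrite /mangoldt; case: ifP => [/andP[n1 /eqP nE] _|_]; last by rewrite eqxx.
exists (pdiv n), (logn (pdiv n) n); split => //; first exact: pdiv_prime.
by rewrite logn_gt0 mem_primes pdiv_prime // pdiv_dvd ltnW.
Qed.

(** Induction from n / p to n, p the least prime factor: among the divisors of n that do not divide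
    n / p, the only prime power is the full power of p in n, and it contributes ln p. *)
Lemma sum_mangoldt (n N : nat) : (0 < n <= N)%N ->
  \sum_(1 <= d < N.+1 | (d %| n)%N) mangoldt d = ln n%:R.
Proof.
elim/ltn_ind: n => n IH /andP[n0 nN]; case: (leqP n 1) => [n1|n1].
  have {n1 n0} -> : n = 1%N by apply/eqP; rewrite eqn_leq n1.
  rewrite ln1 big1_seq // => d /andP[]; rewrite dvdn1 => /eqP -> _.
  by rewrite /mangoldt.
set p := pdiv n; have pp : prime p by exact: pdiv_prime.
have pn : (p %| n)%N by exact: pdiv_dvd.
have p0 := prime_gt0 pp.
have m0 : (0 < n %/ p)%N by rewrite divn_gt0 // dvdn_leq.
have mn : (n %/ p < n)%N by rewrite ltn_Pdiv // prime_gt1.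
have nE : n = (n %/ p * p)%N by rewrite divnK.
have logE : logn p n = (logn p (n %/ p)).+1.
  by rewrite [in LHS]nE lognM // (logn_prime _ pp) eqxx addn1.
rewrite (bigID (fun d => (d %| n %/ p)%N)) /=.
rewrite (eq_bigl (fun d => (d %| n %/ p)%N)); last first.
  by move=> d; rewrite andb_idl // => h; rewrite nE dvdn_mulr.
rewrite IH //; last by rewrite m0 (leq_trans (ltnW mn)).
have pk : (p ^ logn p n %| n)%N by exact: pfactor_dvdnn.
have pNm : ~~ (p ^ logn p n %| n %/ p)%N by rewrite pfactor_dvdn // logE ltnn.
rewrite big_mkcond (bigD1_seq (p ^ logn p n)%N) ?iota_uniq //=; last first.
  by rewrite mem_index_iota expn_gt0 p0 ltnS (leq_trans _ nN) // dvdn_leq.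
rewrite pk pNm /= mangoldt_primeX // ?logE // big1_seq ?addr0.
  by rewrite -lnM ?posrE ?ltr0n // -natrM -nE.
move=> d /andP[dne _]; case: ifP => // /andP[dn dm]; rewrite -logE in dne.
apply/eqP/negP => /negP.
move=> /mangoldt_neq0[q [k [pq k0 dE]]].
have [qp|qp] := eqVneq q p; last first.
  move/negP: dm; apply; move: dn; rewrite {1}nE dE mulnC Gauss_dvdr //.
  by rewrite coprimeXl // prime_coprime // dvdn_prime2.
rewrite dE qp pfactor_dvdn // in dn; rewrite dE qp pfactor_dvdn // -ltnNge in dm.
move/eqP: dne; apply; rewrite dE qp; congr (_ ^ _)%N.
by apply/eqP; rewrite eqn_leq dn logE.
Qed.

End VonMangoldt.

(** * Chebyshev's and Mertens' estimates *)

Section ChebyshevMertens.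
Variable R : realType.
Local Notation L := (@mangoldt R).
Local Notation lnn n := (ln (n%:R : R)).

Definition psi (N : nat) : R := \sum_(1 <= k < N.+1) L k.

Lemma psi0 : psi 0 = 0. Proof. by rewrite /psi big_geq. Qed.

Lemma psiS N : psi N.+1 = psi N + L N.+1.
Proof. by rewrite /psi big_nat_recr. Qed.

Lemma psi_ge0 N : 0 <= psi N.
Proof. by apply: sumr_ge0 => k _; exact: mangoldt_ge0. Qed.

Lemma psiB (a b : nat) : (a <= b)%N -> psi b - psi a = \sum_(a.+1 <= k < b.+1) L k.
Proof. move=> ab; rewrite /psi (@big_cat_nat _ _ _ a.+1 1 b.+1) //=.
by rewrite addrAC subrr add0r. Qed.

Lemma le_psi (a b : nat) : (a <= b)%N -> psi a <= psi b.
Proof.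
by move=> ab; rewrite -subr_ge0 psiB // sumr_ge0 // => k _; exact: mangoldt_ge0.
Qed.

Lemma lnn_ge0 n : 0 <= lnn n.
Proof.
case: n => [|n]; first by rewrite ln0.
by rewrite ln_ge0 // ler1n.
Qed.

Lemma lnnM a b : (0 < a)%N -> (0 < b)%N -> lnn (a * b) = lnn a + lnn b.
Proof. by move=> a0 b0; rewrite natrM lnM // posrE ltr0n. Qed.

Lemma ler_lnn a b : (0 < a)%N -> (a <= b)%N -> lnn a <= lnn b.
Proof. by move=> a0 ab; rewrite ler_ln ?posrE ?ltr0n ?ler_nat // (leq_trans a0). Qed.

Lemma ln_le_subr1 (x : R) : 0 < x -> ln x <= x - 1.
Proof. by move=> x0; rewrite -[in ln _](subrKC 1 x) le_ln1Dx //; lra. Qed.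

Lemma lnn_fact N : lnn N`! = \sum_(1 <= n < N.+1) lnn n.
Proof.
elim: N => [|N IH]; first by rewrite big_geq // ln1.
by rewrite factS mulnC lnnM ?fact_gt0 // IH [RHS]big_nat_recr.
Qed.

Lemma lnn_fact_mangoldt N :
  lnn N`! = \sum_(1 <= k < N.+1) L k * (N %/ k)%:R.
Proof.
rewrite lnn_fact.
rewrite (eq_big_nat _ _ (F2 := fun n => \sum_(1 <= d < N.+1 | (d %| n)%N) L d)); last first.
  by move=> n /andP[n0 nN]; rewrite sum_mangoldt // n0.
rewrite -(sum_hyperbola _ (fun d n => L d)); apply: eq_bigr => d _.
by rewrite sumr_const_nat subSS subn0 mulr_natr.
Qed.

Lemma lnn_fact_psi N : lnn N`! = \sum_(1 <= m < N.+1) psi (N %/ m).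
Proof.
rewrite lnn_fact_mangoldt /psi.
rewrite -(sum_hyperbola_sym _ (fun d m => L d)); apply: eq_bigr => d _.
by rewrite sumr_const_nat subSS subn0 mulr_natr.
Qed.

Lemma ln_succ_le n : (0 < n)%N -> lnn n.+1 - lnn n <= n%:R^-1.
Proof.
move=> n0; rewrite -ln_div ?posrE ?ltr0n //.
apply: le_trans (ln_le_subr1 _) _; first by rewrite divr_gt0 ?ltr0n.
have nR : (0 : R) < n%:R by rewrite ltr0n.
by rewrite -natr1 mulrDl divff ?gt_eqF // mul1r addrAC subrr add0r.
Qed.

Lemma ln_succ_ge n : (0 < n)%N -> n.+1%:R^-1 <= lnn n.+1 - lnn n.
Proof.
move=> n0; have nR : (0 : R) < n%:R by rewrite ltr0n.
have n1R : (0 : R) < n.+1%:R by rewrite ltr0n.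
suff : lnn n - lnn n.+1 <= - n.+1%:R^-1 by rewrite lerNr opprB.
rewrite -ln_div ?posrE //.
apply: le_trans (ln_le_subr1 _) _; first by rewrite divr_gt0.
have -> : n%:R = n.+1%:R - 1 :> R by rewrite -natr1 addrK.
by rewrite mulrBl divff ?gt_eqF // div1r addrAC subrr add0r.
Qed.

Lemma lnn_fact_ge N : N%:R * lnn N - N%:R <= lnn N`!.
Proof.
elim: N => [|[|n] IH]; first by rewrite mul0r subr0 ln1.
  by rewrite ln1 mulr0; lra.
have h := ln_succ_le (ltn0Sn n).
rewrite factS lnnM ?fact_gt0 //.
have n1 : (0 : R) < n.+1%:R by rewrite ltr0n.
have : n.+1%:R * (lnn n.+2 - lnn n.+1) <= 1.
  by rewrite -(ler_pM2l n1) divff ?gt_eqF // in h.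
by rewrite -[n.+2%:R]natr1 in IH *; nra.
Qed.

Lemma lnn_fact_le N : (0 < N)%N ->
  lnn N`! <= N%:R * lnn N - N%:R + 1 + lnn N.
Proof.
elim: N => [//|[|n] IH _]; first by rewrite !ln1; lra.
have h := ln_succ_ge (ltn0Sn n).
rewrite factS lnnM ?fact_gt0 //; have {}IH := IH isT.
have n2 : (0 : R) < n.+2%:R by rewrite ltr0n.
have : 1 <= n.+2%:R * (lnn n.+2 - lnn n.+1).
  by rewrite -(ler_pM2l n2) divff ?gt_eqF // in h.
by rewrite -[n.+2%:R]natr1 in IH *; nra.
Qed.

(** The increment is at most the logarithm of the central binomial coefficient: floor(2n/k) - 2
    floor(n/k) is never negative and is at least 1 for n < k <= 2n. *)
Lemma chebyshev_double n : psi n.*2 - psi n <= 5 * n%:R.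
Proof.
case: n => [|n]; first by rewrite double0 subrr mulr0.
set m := n.+1; have m0 : (0 < m)%N by [].
have mR : (0 : R) < m%:R by rewrite ltr0n.
have E : \sum_(1 <= k < m.*2.+1) L k * (m %/ k)%:R = lnn m`!.
  rewrite lnn_fact_mangoldt [LHS](@big_cat_nat _ _ _ m.+1) //=; last first.
    by rewrite ltnS -addnn leq_addr.
  rewrite [X in _ + X]big1_seq ?addr0 // => k /andP[_]; rewrite mem_index_iota => /andP[mk _].
  by rewrite divn_small ?mulr0.
have F : psi m.*2 - psi m <= lnn (m.*2)`! - 2 * lnn m`!.
  rewrite -E lnn_fact_mangoldt mulr_sumr -sumrB psiB; last by rewrite -addnn leq_addr.
  rewrite [leRHS](@big_cat_nat _ _ _ m.+1) //=; last first.
    by rewrite ltnS -addnn leq_addr.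
  rewrite -[leLHS]add0r; apply: lerD.
    apply: sumr_ge0 => k _; rewrite mulrCA -mulrBr mulr_ge0 ?mangoldt_ge0 //.
    rewrite subr_ge0 -natrM ler_nat; case: k => [|k]; first by rewrite !divn0.
    by rewrite leq_divRL // -mulnA -mul2n leq_mul2l leq_divM orbT.
  apply: ler_sum_nat => k /andP[mk km]; rewrite mulrCA -mulrBr.
  rewrite ler_peMr ?mangoldt_ge0 // [(m %/ k)%N]divn_small // mulr0 subr0 ler1n.
  by rewrite divn_gt0 // (leq_trans _ mk).
apply: le_trans F _.
have h1 := lnn_fact_ge m; have h2 := lnn_fact_le (N := m.*2) isT.
have h3 : lnn m.*2 <= lnn m + 1.
  rewrite -mul2n lnnM // addrC lerD2l.
  by apply: le_trans (ln_le_subr1 _) _; lra.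
have h4 : lnn m <= m%:R - 1 by apply: ln_le_subr1.
have m2 : m.*2%:R = 2 * m%:R :> R by rewrite -mul2n natrM.
rewrite m2 in h2 h3 *; have m1 : (1 : R) <= m%:R by rewrite ler1n.
have h5 : m%:R * ln (2 * m%:R) <= m%:R * (lnn m + 1) by rewrite ler_wpM2l // ltW.
by clear E; nra.
Qed.

(** Induction by halving; the constant comes from 7h + 5h + ln(2h + 1) <= 14h. *)
Lemma psi_le N : psi N <= 7 * N%:R.
Proof.
elim/ltn_ind: N => N IH; case: N IH => [|N] IH; first by rewrite psi0 mulr0.
have := odd_double_half N.+1; set h := (N.+1)./2; case: odd => E.
  have hN : h = N./2 by rewrite /h /= uphalf_half; move: E; rewrite /h /= => E; lia.
  have EN : N = h.*2 by move: E; rewrite add1n => -[].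
  have := IH h; rewrite ltnS EN -addnn leq_addr => /(_ isT) h1.
  have h2 := chebyshev_double h; rewrite addnn psiS.
  have := @mangoldt_le R h.*2.+1 isT.
  have : lnn h.*2.+1 <= h.*2.+1%:R - 1 by apply: ln_le_subr1.
  have -> : h.*2.+1%:R = 2 * h%:R + 1 :> R by rewrite -natr1 -mul2n natrM.
  by lra.
have h0 : (h < N.+1)%N by rewrite -E add0n -addnn -{1}[h]addn0 ltn_add2l; case: h E.
have h1 := IH h h0; have h2 := chebyshev_double h.
have -> : psi N.+1 = psi h.*2 by rewrite -E.
have -> : N.+1%:R = 2 * h%:R :> R by rewrite -E add0n -mul2n natrM.
by have := ler0n R h; lra.
Qed.

Definition mangoldt_sum (N : nat) : R := \sum_(1 <= k < N.+1) L k / k%:R.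

(** Replacing N/k by its floor turns N * [mangoldt_sum N] into ln N!, at a cost of at most [psi N],
    which is O(N). *)
Lemma mertens N : (0 < N)%N -> lnn N - 1 <= mangoldt_sum N <= lnn N + 7.
Proof.
move=> N0; have NR : (0 : R) < N%:R by rewrite ltr0n.
have E : N%:R * mangoldt_sum N = \sum_(1 <= k < N.+1) L k * (N%:R / k%:R).
  by rewrite mulr_sumr; apply: eq_bigr => k _; rewrite mulrCA mulrA.
have fl k : (0 < k)%N -> (N %/ k)%:R <= (N%:R / k%:R : R) <= (N %/ k)%:R + 1.
  move=> k0; have kR : (0 : R) < k%:R by rewrite ltr0n.
  rewrite ler_pdivlMr // ler_pdivrMr // natr1 -!natrM !ler_nat leq_divM /=.
  by rewrite ltnW // ltn_ceil.
have h1 : lnn N`! <= N%:R * mangoldt_sum N.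
  rewrite E lnn_fact_mangoldt; apply: ler_sum_nat => k /andP[k0 _].
  by rewrite ler_wpM2l ?mangoldt_ge0 //; have /andP[] := fl k k0.
have h2 : N%:R * mangoldt_sum N <= lnn N`! + psi N.
  rewrite E lnn_fact_mangoldt /psi -big_split /=; apply: ler_sum_nat => k /andP[k0 _].
  rewrite -[X in _ + X]mulr1 -mulrDr ler_wpM2l ?mangoldt_ge0 //.
  by have /andP[] := fl k k0.
have h3 := lnn_fact_ge N; have h4 := lnn_fact_le N0; have h5 := psi_le N.
have h6 : lnn N <= N%:R - 1 by apply: ln_le_subr1.
by apply/andP; split; rewrite -(ler_pM2l NR); nra.
Qed.

End ChebyshevMertens.

(** * Selberg's symmetry formula *)

Section Selberg.
Variable R : realType.
Local Notation L := (@mangoldt R).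
Local Notation lnn n := (ln (n%:R : R)).
Local Notation psi := (psi R).

Definition harmonic_sum (N : nat) : R := \sum_(1 <= k < N.+1) k%:R^-1.

(** Euler's constant, obtained as the supremum of the increasing sequence [l], which the decreasing
    sequence [u] bounds from above. *)
Lemma harmonic_gamma : exists2 g : R, 0 <= g <= 1 &
  forall n, (0 < n)%N -> 0 <= harmonic_sum n - lnn n - g <= n%:R^-1.
Proof.
pose l n := harmonic_sum n - lnn n.+1; pose u n := harmonic_sum n - lnn n.
have HS n : harmonic_sum n.+1 = harmonic_sum n + n.+1%:R^-1.
  by rewrite /harmonic_sum big_nat_recr.
have lS : {homo l : m n / (m <= n)%N >-> m <= n}.
  apply: (homo_leq (r := <=%R)) => [x|y x z|n] //; first exact: le_trans.
  have h := ln_succ_le R (ltn0Sn n); rewrite /l HS.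
  by move: (lnn n.+2) (lnn n.+1) (n.+1%:R^-1) h => *; lra.
have uS : {homo (u \o succn) : m n / (m <= n)%N >-> n <= m}.
  apply: (homo_leq (r := fun x y => y <= x)) => [x|y x z h1 h2|n] //=.
    exact: le_trans h2 h1.
  have h := ln_succ_ge R (ltn0Sn n); rewrite /u HS.
  by move: (lnn n.+2) (lnn n.+1) (n.+2%:R^-1) h => *; lra.
have lu n : l n.+1 <= u n.+1.
  by rewrite /l /u lerD2l lerN2 ler_lnn.
have lub m n : (0 < n)%N -> l m <= u n.
  case: n => // n _; apply: (le_trans (lS m (maxn m n).+1 _)).
    by rewrite leqW // leq_maxl.
  apply: (le_trans (lu _)); apply: (uS n); exact: leq_maxr.
have l_sup : has_sup (range l).
  by split; [exists (l 0); exists 0 | exists (u 1) => _ [m _ <-]; exact: lub].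
have l0 : l 0 = 0 by rewrite /l /harmonic_sum big_geq // ln1 subr0.
have u1 : u 1 = 1 by rewrite /u /harmonic_sum big_nat1 ln1 subr0 invr1.
exists (sup (range l)).
  apply/andP; split.
    by rewrite -l0; apply: ub_le_sup; [case: l_sup | exists 0].
  by rewrite -u1; apply: ge_sup; [case: l_sup | move=> _ [m _ <-]; exact: lub].
move=> n n0; have h1 : sup (range l) <= u n.
  by apply: ge_sup; [case: l_sup | move=> _ [m _ <-]; exact: lub].
have h2 : l n <= sup (range l) by apply: ub_le_sup; [case: l_sup | exists n].
have h3 := ln_succ_le R n0; rewrite /l /u in h1 h2.
by move: (sup _) (lnn n.+1) (lnn n) (n%:R^-1) h1 h2 h3 => *; apply/andP; split; lra.
Qed.

(** Write ln(N/n) = ln(N/k) + ln(k/n) and expand ln(k/n) as the sum of [L e] over e dividing k/n.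
    Möbius inversion kills the first part unless k = 1, and leaves e = k in the second. *)
Lemma sum_moebius_ln (k N : nat) : (0 < k <= N)%N ->
  \sum_(1 <= n < N.+1 | (n %| k)%N) (moebius n)%:~R * (lnn N - lnn n) =
  (k == 1%N)%:R * lnn N + L k.
Proof.
move=> /andP[k0 kN]; have N0 : (0 < N)%N := leq_trans k0 kN.
have divl a b : (0 < a)%N -> (a %| k)%N && (b %| k %/ a)%N = (a * b %| k)%N.
  move=> a0; case: (boolP (a %| k)%N) => [ak|ak] /=; last first.
    by apply/esym/negP => h; move/negP: ak; apply; apply: dvdn_trans h; exact: dvdn_mulr.
  by rewrite dvdn_divRL // mulnC.
have mobR n : (0 < n <= N)%N ->
    \sum_(1 <= d < N.+1 | (d %| n)%N) (moebius d)%:~R = (n == 1%N)%:R :> R.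
  by move=> nN; rewrite -rmorph_sum /= sum_moebius //; case: (n == 1%N).
rewrite big_mkcond /=.
transitivity (\sum_(1 <= n < N.+1) ((if (n %| k)%N then (moebius n)%:~R else 0) * (lnn N - lnn k)
    + \sum_(1 <= e < N.+1) (if (n * e %| k)%N then (moebius n)%:~R * L e else 0))).
  apply: eq_big_nat => n /andP[n0 _]; case: ifP => nk; last first.
    rewrite mul0r add0r big1 // => e _; case: ifP => // h.
    by rewrite (dvdn_trans (dvdn_mulr e (dvdnn n)) h) in nk.
  have kn0 : (0 < k %/ n)%N by rewrite divn_gt0 // dvdn_leq.
  have -> : lnn N - lnn n = lnn N - lnn k + lnn (k %/ n).
    by rewrite -[in lnn k](divnK nk) lnnM //; ring.
  rewrite mulrDr; congr (_ + _).
  rewrite -(@sum_mangoldt R _ N); last by rewrite kn0 (leq_trans (leq_div _ _)).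
  rewrite mulr_sumr -big_mkcond /=; apply: eq_bigl => e.
  by rewrite -divl // nk.
rewrite big_split /= -mulr_suml -big_mkcond mobR ?k0 // exchange_big_nat /=; congr (_ + _).
  by case: eqP => [->|_]; rewrite ?ln1 ?subr0 // !mul0r.
rewrite (bigD1_seq k) ?iota_uniq ?mem_index_iota ?k0 //= addrC big1_seq ?add0r.
  rewrite big_ltn // mul1n dvdnn mul1r big1_seq ?addr0 // => n /andP[_].
  rewrite mem_index_iota => /andP[n1 _]; case: ifP => // h.
  have := dvdn_leq k0 h; rewrite leqNgt -{1}[k]mul1n ltn_mul2r k0 n1.
  by [].
move=> e /andP[ek]; rewrite mem_index_iota => /andP[e0 eN].
case: (boolP (e %| k)%N) => [dek|dek]; last first.
  rewrite big1 // => n _; case: ifP => // h; move/negP: dek; case.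
  by apply: dvdn_trans h; exact: dvdn_mull.
have ke0 : (0 < k %/ e)%N by rewrite divn_gt0 // dvdn_leq.
transitivity (\sum_(1 <= n < N.+1 | (n %| k %/ e)%N) (moebius n)%:~R * L e).
  rewrite [RHS]big_mkcond; apply: eq_big_nat => n /andP[n0 _].
  by rewrite mulnC -divl // dek.
rewrite -mulr_suml mobR ?ke0 ?(leq_trans (leq_div _ _)) //.
case: eqP => [h|_]; last by rewrite mul0r.
by move: ek; rewrite -[k](divnK dek) h mul1n eqxx.
Qed.

(** The Tatuzawa-Iseki identity: group the pairs by k = n * m and apply [sum_moebius_ln]. It yields
    Selberg's formula for an F whose inner sums are small. *)
Lemma tatuzawa_iseki (N : nat) (F : nat -> R) : (0 < N)%N ->
  \sum_(1 <= n < N.+1) (moebius n)%:~R * (lnn N - lnn n) *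
    (\sum_(1 <= m < (N %/ n).+1) F (n * m)%N) =
  lnn N * F 1%N + \sum_(1 <= k < N.+1) L k * F k.
Proof.
move=> N0.
transitivity (\sum_(1 <= n < N.+1) \sum_(1 <= m < (N %/ n).+1)
    (moebius n)%:~R * (lnn N - lnn n) * F (n * m)%N).
  by apply: eq_bigr => n _; rewrite mulr_sumr.
rewrite (sum_hyperbola _ (fun n k => (moebius n)%:~R * (lnn N - lnn n) * F k)).
transitivity (\sum_(1 <= k < N.+1) ((k == 1%N)%:R * lnn N + L k) * F k).
  by apply: eq_big_nat => k kN; rewrite -mulr_suml sum_moebius_ln.
under eq_bigr do rewrite mulrDl.
rewrite big_split /=; congr (_ + _).
rewrite big_ltn // eqxx mul1r big1_seq ?addr0 // => k /andP[_].
by rewrite mem_index_iota => /andP[k1 _]; rewrite gtn_eqF // !mul0r.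
Qed.

Lemma sum_inv_sqrt N : \sum_(1 <= k < N.+1) (Num.sqrt k%:R)^-1 <= 2 * Num.sqrt N%:R :> R.
Proof.
elim: N => [|N IH]; first by rewrite big_geq // sqrtr0 mulr0.
rewrite big_nat_recr //=; apply: (le_trans (lerD IH (lexx _))).
set a := Num.sqrt N%:R; set b := Num.sqrt N.+1%:R.
have a0 : 0 <= a := sqrtr_ge0 _.
have b0 : 0 < b by rewrite sqrtr_gt0 ltr0n.
have aa : a ^+ 2 = N%:R by rewrite sqr_sqrtr.
have bb : b ^+ 2 = N%:R + 1 by rewrite sqr_sqrtr // natr1.
rewrite -(ler_pM2r b0) mulrDl mulVf ?gt_eqF //.
by nra.
Qed.

(** A product of two logarithms of y is thereby O(sqrt y), which is all that the error terms
    need. *)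
Lemma ln_le_quartic (y : R) : 1 <= y ->
  0 <= ln y <= 4 * (Num.sqrt (Num.sqrt y) - 1) /\ 1 <= Num.sqrt (Num.sqrt y).
Proof.
move=> y1; set t := Num.sqrt (Num.sqrt y).
have t1 : 1 <= t by rewrite /t -{1}[1]sqrtr1 ler_sqrt // -{1}[1]sqrtr1 ler_sqrt //; lra.
have tE : y = t ^+ 4.
  by rewrite (exprM t 2 2) !sqr_sqrtr ?sqrtr_ge0 //; lra.
split => //; rewrite ln_ge0 //= tE lnXn; last by lra.
have := @ln_le_subr1 R t (lt_le_trans ltr01 t1); lra.
Qed.

Lemma selberg : exists2 K : R, 0 < K & forall N, (0 < N)%N ->
  `|psi N * lnn N + \sum_(1 <= k < N.+1) L k * psi (N %/ k) - 2 * N%:R * lnn N|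
    <= K * N%:R.
Proof.
have [g /andP[g0 g1] gP] := harmonic_gamma.
exists 100 => // N N0; have NR : (0 : R) < N%:R by rewrite ltr0n.
(* The constant g + 1, with g Euler's constant, cancels the linear terms: q ln q - q - y (ln q + g)
   + (g + 1) q is only O(1 + ln y) for q the floor of y. *)
pose F k : R := psi (N %/ k) - N%:R / k%:R + (g + 1).
have inner n : (0 < n <= N)%N ->
    `|(lnn N - lnn n) * \sum_(1 <= m < (N %/ n).+1) F (n * m)%N| <=
    28 * (Num.sqrt N%:R / Num.sqrt n%:R).
  move=> /andP[n0 nN]; set q := (N %/ n)%N.
  have nR : (0 : R) < n%:R by rewrite ltr0n.
  have q0 : (0 < q)%N by rewrite divn_gt0.
  have qR : (1 : R) <= q%:R by rewrite ler1n.
  pose y : R := N%:R / n%:R.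
  have qy : q%:R <= y by rewrite ler_pdivlMr // -natrM ler_nat leq_divM.
  have yq : y < q%:R + 1.
    by rewrite ltr_pdivrMr // natr1 -natrM ltr_nat ltn_ceil.
  have -> : \sum_(1 <= m < q.+1) F (n * m)%N =
      lnn q`! - y * harmonic_sum q + (g + 1) * q%:R.
    rewrite lnn_fact_psi /F big_split /= sumr_const_nat subn1 /= mulr_natr.
    congr (_ + _); rewrite big_split /=; congr (_ + _); first by apply: eq_bigr => m _; rewrite divnMA.
    rewrite mulr_sumr -sumrN; apply: eq_bigr => m _.
    by rewrite natrM invfM mulrA.
  have -> : lnn N - lnn n = ln y by rewrite ln_div ?posrE.
  have h1 := lnn_fact_ge R q; have h2 := lnn_fact_le R q0.
  have /andP[h3 h4] := gP q q0.
  have qV : q%:R * q%:R^-1 = 1 :> R by rewrite divff // gt_eqF //; lra.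
  have V0 : 0 < q%:R^-1 :> R by rewrite invr_gt0; lra.
  have h5 : lnn q <= ln y by rewrite ler_ln ?posrE //; lra.
  have lq := lnn_ge0 R q.
  have y1 : 1 <= y by lra.
  have [/andP[ly ly4] t1] := ln_le_quartic y1.
  have hyp : 1 + y * q%:R^-1 <= 3.
    have : y * q%:R^-1 <= (q%:R + 1) * q%:R^-1 by rewrite ler_wpM2r ?ltW.
    have : q%:R^-1 <= 1 :> R by rewrite invf_le1 //; lra.
    by lra.
  have bnd : `|lnn q`! - y * harmonic_sum q + (g + 1) * q%:R| <= 3 + ln y.
    pose s := harmonic_sum q - lnn q - g.
    have -> : harmonic_sum q = lnn q + g + s by rewrite /s; ring.
    pose f := y - q%:R; have yE : y = q%:R + f by rewrite /f; ring.
    have s0 : 0 <= s by []; have s1 : s <= q%:R^-1 by [].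
    have f0 : 0 <= f by rewrite /f; lra.
    have f1 : f <= 1 by rewrite /f; lra.
    have ys0 : 0 <= y * s by rewrite mulr_ge0 //; lra.
    have ys1 : y * s <= 2 by apply: le_trans (ler_wpM2l _ s1) _; lra.
    have fl0 : 0 <= f * lnn q by rewrite mulr_ge0.
    have fl1 : f * lnn q <= lnn q by rewrite ler_piMl.
    have fg0 : 0 <= f * g by rewrite mulr_ge0.
    have fg1 : f * g <= 1 by rewrite mulr_ile1.
    have -> : lnn q`! - y * (lnn q + g + s) + (g + 1) * q%:R =
      (lnn q`! - (q%:R * lnn q - q%:R)) - f * lnn q - f * g - y * s.
      by rewrite [in y * (lnn q + _ + _)]yE [in y * s]yE; ring.
    by rewrite ler_norml; apply/andP; split; lra.
  rewrite normrM (ger0_norm ly).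
  apply: le_trans (ler_wpM2l ly bnd) _.
  have -> : Num.sqrt N%:R / Num.sqrt n%:R = Num.sqrt (Num.sqrt y) ^+ 2 :> R.
    by rewrite sqr_sqrtr ?sqrtr_ge0 // /y sqrtrM ?ler0n // sqrtrV ?ler0n.
  by move: (Num.sqrt (Num.sqrt y)) t1 ly4 => t t1 ly4; nra.
have main : `|lnn N * F 1%N + \sum_(1 <= k < N.+1) L k * F k| <= 56 * N%:R.
  rewrite -tatuzawa_iseki //.
  apply: (le_trans (ler_norm_sum _ _ _)).
  apply: (@le_trans _ _ (\sum_(1 <= n < N.+1) 28 * Num.sqrt N%:R * (Num.sqrt n%:R)^-1)).
    apply: ler_sum_nat => n /andP[n0 nN]; rewrite -!mulrA normrM.
    apply: (@le_trans _ _ (1 * (28 * (Num.sqrt N%:R / Num.sqrt n%:R)))); last by rewrite mul1r.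
    apply: ler_pM; rewrite ?normr_ge0 //; last by apply: inner; rewrite n0.
    by rewrite -intr_norm -[leRHS]/(1%:~R) ler_int moebius_norm.
  rewrite -mulr_sumr; have := sum_inv_sqrt N; have sq := sqrtr_ge0 (N%:R : R).
  have : Num.sqrt N%:R ^+ 2 = N%:R :> R by rewrite sqr_sqrtr ?ler0n.
  move: (\sum_(_ <= _ < _) _) (Num.sqrt _) sq => S r r0 <- Sr.
  by rewrite expr2; nra.
(* One N ln N comes from the term F(1) ln N, the other from Mertens' estimate for N *
   [mangoldt_sum R N]; together they make up the main term 2 N ln N. *)
have FE : \sum_(1 <= k < N.+1) L k * F k = \sum_(1 <= k < N.+1) L k * psi (N %/ k) -
    N%:R * mangoldt_sum R N + (g + 1) * psi N.
  rewrite /F /mangoldt_sum mulr_sumr mulr_sumr -sumrB -big_split /=.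
  by apply: eq_bigr => k _; ring.
rewrite FE /F divn1 divr1 in main.
have p0 := psi_ge0 R N; have p1 := psi_le R N.
have /andP[m1 m2] := mertens R N0.
have l0 := lnn_ge0 R N; have l1 : lnn N <= N%:R - 1 by apply: ln_le_subr1.
have m3 : N%:R * (lnn N - 1) <= N%:R * mangoldt_sum R N by rewrite ler_wpM2l // ltW.
have m4 : N%:R * mangoldt_sum R N <= N%:R * (lnn N + 7) by rewrite ler_wpM2l // ltW.
have gl0 : 0 <= g * lnn N by rewrite mulr_ge0.
have gl1 : g * lnn N <= lnn N by rewrite ler_piMl.
have gp0 : 0 <= g * psi N by rewrite mulr_ge0.
have gp1 : g * psi N <= psi N by rewrite ler_piMl.
move: main; rewrite !ler_norml => /andP[a1 a2]; apply/andP; split; nra.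
Qed.

End Selberg.

(** * From Selberg's formula to primes in short intervals *)

Section PrimeGaps.
Variable R : realType.
Local Notation L := (@mangoldt R).
Local Notation lnn n := (ln (n%:R : R)).
Local Notation psi := (psi R).
Local Notation msum := (mangoldt_sum R).

Lemma divn_floor (n k : nat) : (0 < k)%N ->
  (n %/ k)%:R <= (n%:R / k%:R : R) < (n %/ k)%:R + 1.
Proof.
move=> k0; have kR : (0 : R) < k%:R by rewrite ltr0n.
by rewrite ler_pdivlMr // ltr_pdivrMr // natr1 -!natrM ler_nat ltr_nat leq_divM ltn_ceil.
Qed.

Lemma lnn_unbounded (C : R) : exists2 Y, (0 < Y)%N & forall a, (Y <= a)%N -> C <= lnn a.
Proof.
exists (Num.bound (expR C)) => [|a Ya].
  by rewrite -(ltr0n R); apply: lt_trans (expR_gt0 C) (archi_boundP (expR_ge0 _)).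
have h : expR C < a%:R.
  by apply: lt_le_trans (archi_boundP (expR_ge0 _)) _; rewrite ler_nat.
by rewrite -[C]expRK ler_ln ?posrE ?expR_gt0 ?(lt_trans (expR_gt0 C)) ?ltW.
Qed.

Lemma natr_unbounded (C : R) : exists2 Y, (0 < Y)%N & forall a, (Y <= a)%N -> C <= a%:R.
Proof.
have [Y Y0 YP] := lnn_unbounded C; exists Y => // a Ya; apply: (le_trans (YP _ Ya)).
by apply: le_trans (ln_le_subr1 _) _; rewrite ?ltr0n ?(leq_trans Y0) //; lra.
Qed.

Lemma psi_short_le (eps : R) : 0 < eps -> exists2 Y, (0 < Y)%N &
  forall a b, (Y <= a)%N -> (a <= b <= 2 * a)%N ->
    psi b - psi a <= 2 * (b%:R - a%:R) + eps * a%:R.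
Proof.
move=> e0; have [K K0 KP] := selberg R.
have [Y Y0 YP] := lnn_unbounded ((3 * K + 4) / eps + 1).
exists Y => // a b Ya /andP[ab ba].
have a0 : (0 < a)%N := leq_trans Y0 Ya; have b0 := leq_trans a0 ab.
have aR : (0 : R) < a%:R by rewrite ltr0n.
have abR : a%:R <= b%:R :> R by rewrite ler_nat.
have baR : b%:R <= 2 * a%:R :> R by rewrite -natrM ler_nat.
have := KP a a0; rewrite ler_norml => /andP[sa _].
have := KP b b0; rewrite ler_norml => /andP[_ sb].
have la := YP a Ya.
have q0 : 0 < (3 * K + 4) / eps by rewrite divr_gt0 //; lra.
have lab : lnn a <= lnn b by rewrite ler_lnn.
have lab1 : lnn b - lnn a <= b%:R / a%:R - 1.
  by rewrite -ln_div ?posrE ?ltr0n // ln_le_subr1 // divr_gt0 // ltr0n.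
have lab2 : lnn b - lnn a <= 1.
  apply: (le_trans lab1); have : b%:R / a%:R <= 2 :> R by rewrite ler_pdivrMr //.
  by lra.
have sums : \sum_(1 <= k < a.+1) L k * psi (a %/ k) <=
            \sum_(1 <= k < b.+1) L k * psi (b %/ k).
  rewrite [leRHS](@big_cat_nat _ _ _ a.+1) //=; apply: ler_wpDr.
    by apply: sumr_ge0 => k _; rewrite mulr_ge0 ?mangoldt_ge0 ?psi_ge0.
  apply: ler_sum => k _; rewrite ler_wpM2l ?mangoldt_ge0 // le_psi //.
  exact: leq_div2r.
have pb : psi b * lnn a <= psi b * lnn b by rewrite ler_wpM2l ?psi_ge0.
have bl : b%:R * (lnn b - lnn a) <= 2 * a%:R by apply: le_trans (ler_wpM2l _ lab2) _; lra.
have aK : K * (a%:R + b%:R) <= K * (3 * a%:R) by rewrite ler_wpM2l; lra.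
have main : (psi b - psi a) * lnn a <= 2 * (b%:R - a%:R) * lnn a + (3 * K + 4) * a%:R.
  by lra.
have l0 : 0 < lnn a by lra.
rewrite -(ler_pM2r l0); apply: (le_trans main); rewrite [leRHS]mulrDl lerD2l.
rewrite [leRHS]mulrAC ler_wpM2r //.
by rewrite -ler_pdivrMl // mulrC; lra.
Qed.

(** The shortfall of [psi] on (N/k, (N + h)/k] from the maximal rate 2 of [psi_short_le]. *)
Definition deficiency (N h k : nat) : R :=
  2 * (h%:R / k%:R) - (psi ((N + h) %/ k) - psi (N %/ k)).

(** In the difference of Selberg's formula at N + h and at N, a negligible first term forces the
    sums over [L k * psi] to supply all of 2 h ln N, which by Mertens is 2 h [msum N] up to O(N). *)
Lemma sum_deficiency_le (K1 : R) : exists K2 : R, forall N h, (0 < N)%N -> (h <= N)%N ->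
  (psi (N + h) - psi N) * lnn (N + h) <= K1 * N%:R ->
  \sum_(1 <= k < N.+1) L k * deficiency N h k <= K2 * N%:R.
Proof.
have [K K0 KP] := selberg R; exists (3 * K + K1 + 21) => N h N0 hN gap.
have NR : (0 : R) < N%:R by rewrite ltr0n.
have hR : h%:R <= N%:R :> R by rewrite ler_nat.
have h0 : 0 <= h%:R :> R by [].
have N'0 : (0 < N + h)%N by rewrite addn_gt0 N0.
have := KP N N0; rewrite ler_norml => /andP[_ sa].
have := KP _ N'0; rewrite ler_norml => /andP[sb _].
have lab : lnn N <= lnn (N + h) by rewrite ler_lnn // leq_addr.
have lab2 : lnn (N + h) - lnn N <= 1.
  rewrite -ln_div ?posrE ?ltr0n //.
  apply: le_trans (ln_le_subr1 _) _; first by rewrite divr_gt0 // ltr0n.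
  by rewrite natrD mulrDl divff ?gt_eqF // -addrA addrC -addrA addNr addr0 ler_pdivrMr // mul1r.
(* For k > N the quotient (N + h)/k is below 2, where [psi] vanishes. *)
have tail : \sum_(1 <= k < (N + h).+1) L k * psi ((N + h) %/ k) =
    \sum_(1 <= k < N.+1) L k * psi ((N + h) %/ k).
  rewrite (@big_cat_nat _ _ _ N.+1) //=; last by rewrite ltnS leq_addr.
  rewrite [X in _ + X]big1_seq ?addr0 // => k /andP[_].
  rewrite mem_index_iota => /andP[Nk kN].
  have k0 : (0 < k)%N := leq_trans (ltn0Sn N) Nk.
  have : ((N + h) %/ k < 2)%N by rewrite ltn_divLR //; lia.
  case: ((N + h) %/ k)%N => [|[|m]] // _; first by rewrite psi0 mulr0.
  by rewrite psiS psi0 add0r /mangoldt /= mulr0.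
have p0 := psi_ge0 R N; have p1 := psi_le R N.
have pl : psi N * (lnn (N + h) - lnn N) <= 7 * N%:R.
  by apply: le_trans (ler_wpM2l p0 lab2) _; rewrite mulr1.
have DE : \sum_(1 <= k < N.+1) L k * deficiency N h k = 2 * h%:R * msum N -
   (\sum_(1 <= k < N.+1) L k * psi ((N + h) %/ k) - \sum_(1 <= k < N.+1) L k * psi (N %/ k)).
  rewrite -sumrB mulr_sumr -sumrB; apply: eq_bigr => k _; rewrite /deficiency; ring.
have /andP[_ m1] := mertens R N0.
have hm : 2 * h%:R * msum N <= 2 * h%:R * (lnn N + 7) by rewrite ler_wpM2l // mulr_ge0.
have hl : (N%:R + h%:R) * lnn N <= (N%:R + h%:R) * lnn (N + h).
  by rewrite ler_wpM2l // addr_ge0.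
rewrite DE; rewrite tail !natrD in sb; rewrite -natrD in sb.
have Kh : K * h%:R <= K * N%:R by rewrite ler_wpM2l // ltW.
rewrite [(N + h)%:R]natrD in sb gap hl lab lab2 pl *.
nra.
Qed.

(** For k > N/Y the point N/k is too small for [psi_short_le]; those k carry only a bounded mass. *)
Lemma sum_tail_mangoldt (Y : nat) : (0 < Y)%N -> forall N, (Y <= N)%N ->
  \sum_((N %/ Y).+1 <= k < N.+1) L k / k%:R <= 9 + lnn (2 * Y).
Proof.
move=> Y0 N YN; have N0 : (0 < N)%N := leq_trans Y0 YN.
have q0 : (0 < N %/ Y)%N by rewrite divn_gt0.
have -> : \sum_((N %/ Y).+1 <= k < N.+1) L k / k%:R = msum N - msum (N %/ Y).
  rewrite /mangoldt_sum (@big_cat_nat _ _ _ (N %/ Y).+1 1 N.+1) //=; last by rewrite ltnS leq_div.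
  by rewrite addrAC subrr add0r.
have /andP[_ m1] := mertens R N0; have /andP[m2 _] := mertens R q0.
have : lnn N <= lnn (2 * Y * (N %/ Y)).
  rewrite ler_lnn //; have := ltn_ceil N Y0; have := leq_pmulr Y q0; lia.
by rewrite lnnM ?muln_gt0 //; lra.
Qed.

Definition bad (delta : R) (N h k : nat) : bool :=
  delta * (N%:R / k%:R) < deficiency N h k.

(* In a prime gap the nonnegative slack in Selberg's formula is almost used up
   by the deficiencies, so few k can have a large one. *)
Lemma bad_sum_le (K1 delta eta : R) : 0 < delta -> 0 < eta ->
  exists N0, forall N h, (N0 <= N)%N -> (h * 10 <= N)%N ->
  (psi (N + h) - psi N) * lnn (N + h) <= K1 * N%:R ->
  \sum_(1 <= k < N.+1 | bad delta N h k) L k / k%:R <= eta * lnn N.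
Proof.
move=> d0 e0; have [K2 K2P] := sum_deficiency_le K1.
(* The allowed error 2 e ln N is half of delta * eta * ln N; the choice of [N1] below fits the
   constant [C] into the other half. *)
pose e := delta * eta / 4; have ep : 0 < e by rewrite /e divr_gt0 ?mulr_gt0.
have [Y1 Y10 Y1P] := psi_short_le ep; have [Y2 Y20 Y2P] := natr_unbounded (2 / e).
have [Y [YY1 YY2 Y4]] : exists Y, [/\ (Y1 <= Y)%N, (Y2 <= Y)%N & (4 <= Y)%N].
  by exists (maxn (maxn Y1 Y2) 4); rewrite !leq_max !leqnn !orbT.
have Y0 : (0 < Y)%N by exact: leq_trans Y4.
pose C := K2 + 2 * e * 7 + 14 * (9 + lnn (2 * Y)).
have [N1 N10 N1P] := lnn_unbounded (2 * C / (delta * eta)).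
exists (maxn Y N1) => N h NN0 hN gap.
have YN : (Y <= N)%N by apply: leq_trans NN0; exact: leq_maxl.
have N0 : (0 < N)%N := leq_trans Y0 YN.
have NR : (0 : R) < N%:R by rewrite ltr0n.
have hN1 : (h <= N)%N by lia.
have hNR : 10 * h%:R <= N%:R :> R by rewrite -natrM ler_nat mulnC.
have sumd := K2P N h N0 hN1 gap.
have lo k : (0 < k)%N -> (k <= N %/ Y)%N -> - (2 * e * (N%:R / k%:R)) <= deficiency N h k.
  move=> k0 kY; have kR : (0 : R) < k%:R by rewrite ltr0n.
  have yY : (Y <= N %/ k)%N by move: kY; rewrite !leq_divRL // mulnC.
  have /andP[f1 f2] := divn_floor N k0.
  have /andP[f3 f4] := divn_floor (N + h) k0.
  rewrite natrD mulrDl in f3 f4.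
  have hk : 10 * (h%:R / k%:R) <= N%:R / k%:R :> R.
    by rewrite mulrA ler_wpM2r // invr_ge0 ltW.
  have hk0 : 0 <= h%:R / k%:R :> R by rewrite divr_ge0.
  have yR : (4 : R) <= (N %/ k)%:R by rewrite (ler_nat R 4) (leq_trans _ yY).
  have := Y1P (N %/ k)%N ((N + h) %/ k)%N.
  have -> : (Y1 <= N %/ k)%N by exact: leq_trans yY.
  have -> : (N %/ k <= (N + h) %/ k <= 2 * (N %/ k))%N.
    rewrite leq_div2r ?leq_addr //= -(ler_nat R) natrM; lra.
  move=> /(_ isT isT) up.
  have e2 : 2 <= e * (N %/ k)%:R.
    rewrite mulrC -ler_pdivrMr //; apply: Y2P; exact: leq_trans yY.
  have e3 : e * (N %/ k)%:R <= e * (N%:R / k%:R) by rewrite ler_pM2l.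
  rewrite /deficiency; move: (N%:R / k%:R) (h%:R / k%:R) f1 f2 f3 f4 hk hk0 e3 => w z *.
  by lra.
have lo2 k : (0 < k)%N -> (k <= N)%N -> - (14 * (N%:R / k%:R)) <= deficiency N h k.
  move=> k0 kN; have kR : (0 : R) < k%:R by rewrite ltr0n.
  have /andP[f3 f4] := divn_floor (N + h) k0.
  have f5 : (N + h)%:R / k%:R <= 2 * (N%:R / k%:R) :> R.
    rewrite mulrA ler_wpM2r ?invr_ge0 ?ler0n // -natrM ler_nat mul2n -addnn.
    by rewrite leq_add2l.
  have := psi_le R ((N + h) %/ k); have := psi_ge0 R (N %/ k).
  have hk0 : 0 <= h%:R / k%:R :> R by rewrite divr_ge0.
  by rewrite /deficiency; lra.
(* Adding [w k] * N/k makes every term nonnegative, so the bad terms are bounded by the full sum.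
   The value 14 is the crude Chebyshev bound for the k beyond N/Y. *)
pose w k : R := if (k <= N %/ Y)%N then 2 * e else 14.
have wlo k : (0 < k <= N)%N -> - (w k * (N%:R / k%:R)) <= deficiency N h k.
  by move=> /andP[k0 kN]; rewrite /w; case: ifP => kY; [apply: lo | apply: lo2].
have w0 k : 0 <= w k by rewrite /w; case: ifP => _; lra.
have step : delta * N%:R * \sum_(1 <= k < N.+1 | bad delta N h k) L k / k%:R <=
    \sum_(1 <= k < N.+1) L k * (deficiency N h k + w k * (N%:R / k%:R)).
  rewrite mulr_sumr big_mkcond /=; apply: ler_sum_nat => k /andP[k0 kN].
  have kR : (0 : R) < k%:R by rewrite ltr0n.
  have wl : - (w k * (N%:R / k%:R)) <= deficiency N h k by apply: wlo; rewrite k0 -ltnS.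
  have wn : 0 <= w k * (N%:R / k%:R) by rewrite mulr_ge0 ?divr_ge0.
  case: ifP => [bk|_]; last by rewrite mulr_ge0 ?mangoldt_ge0 //; lra.
  have -> : delta * N%:R * (L k / k%:R) = L k * (delta * (N%:R / k%:R)) by ring.
  by rewrite ler_wpM2l ?mangoldt_ge0 //; move: bk; rewrite /bad; lra.
have wsum : \sum_(1 <= k < N.+1) L k * (w k * (N%:R / k%:R)) <=
    N%:R * (2 * e * msum N + 14 * (9 + lnn (2 * Y))).
  have -> : \sum_(1 <= k < N.+1) L k * (w k * (N%:R / k%:R)) =
     N%:R * \sum_(1 <= k < N.+1) w k * (L k / k%:R).
    by rewrite mulr_sumr; apply: eq_bigr => k _; ring.
  rewrite ler_pM2l //.
  apply: (@le_trans _ _ (2 * e * msum N + 14 * \sum_((N %/ Y).+1 <= k < N.+1) L k / k%:R)).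
    have t0 k : 0 <= L k / k%:R by rewrite divr_ge0 ?mangoldt_ge0.
    have qN : ((N %/ Y).+1 <= N.+1)%N by rewrite ltnS leq_div.
    rewrite /mangoldt_sum !(@big_cat_nat _ _ _ (N %/ Y).+1 1 N.+1) //= mulrDr -addrA.
    apply: lerD.
      rewrite mulr_sumr; apply: ler_sum_nat => k /andP[k0 kY].
      by rewrite /w -ltnS kY.
    rewrite -mulrDl mulr_sumr; apply: ler_sum_nat => k /andP[kY kN].
    rewrite /w leqNgt kY /= ler_wpM2r //; lra.
  by rewrite lerD2l ler_wpM2l // sum_tail_mangoldt.
have /andP[_ m1] := mertens R N0.
have em : 2 * e * msum N <= 2 * e * (lnn N + 7) by rewrite ler_wpM2l //; lra.
have tot : delta * N%:R * \sum_(1 <= k < N.+1 | bad delta N h k) L k / k%:R <=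
    N%:R * (2 * e * lnn N + C).
  apply: (le_trans step); under eq_bigr do rewrite mulrDr.
  rewrite big_split /=; apply: (le_trans (lerD sumd wsum)).
  by rewrite [K2 * _]mulrC -mulrDr ler_pM2l // /C; lra.
have CN : C <= delta * eta / 2 * lnn N.
  have := N1P N; rewrite (leq_trans _ NN0) ?leq_maxr // => /(_ isT).
  rewrite ler_pdivrMr ?mulr_gt0 //; lra.
have {}tot : delta * \sum_(1 <= k < N.+1 | bad delta N h k) L k / k%:R <= 2 * e * lnn N + C.
  by rewrite -(ler_pM2l NR) mulrCA mulrA.
rewrite -(ler_pM2l d0); apply: (le_trans tot).
by rewrite /e; lra.
Qed.

(** If [psi] has nearly maximal growth on the whole interval, it has it on every subinterval (a, b],
    since [psi_short_le] bounds the growth on the two complementary pieces from above. *)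
Lemma full_of_good (kappa : R) : 0 < kappa ->
  exists2 delta : R, 0 < delta & exists Y, forall N h k, (h * 10 <= N)%N -> (0 < k)%N ->
  ~~ bad delta N h k -> (Y <= N %/ k)%N ->
  forall a b, (N %/ k <= a)%N -> (a <= b)%N -> (b <= (N + h) %/ k)%N ->
  2 * (b%:R - a%:R) - kappa * (N %/ k)%:R <= psi b - psi a.
Proof.
move=> k0; pose e := kappa / 16; have e0 : 0 < e by rewrite divr_gt0.
have [Y1 Y10 Y1P] := psi_short_le e0; have [Y2 Y20 Y2P] := natr_unbounded (2 / e).
exists (kappa / 4); first by rewrite divr_gt0.
exists (maxn (maxn Y1 Y2) 4) => N h k hN kpos good.
rewrite !geq_max -andbA => /and3P[yY1 yY2 y4] a b ya ab by'.
have kR : (0 : R) < k%:R by rewrite ltr0n.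
have /andP[f1 f2] := divn_floor N kpos.
have /andP[f3 f4] := divn_floor (N + h) kpos.
rewrite natrD mulrDl in f3 f4.
have hNR : 10 * h%:R <= N%:R :> R by rewrite -natrM ler_nat mulnC.
have hk : 10 * (h%:R / k%:R) <= N%:R / k%:R :> R.
  by rewrite mulrA ler_wpM2r // invr_ge0 ltW.
have hk0 : 0 <= h%:R / k%:R :> R by rewrite divr_ge0.
have yR : (4 : R) <= (N %/ k)%:R by rewrite (ler_nat R 4).
move: good; rewrite /bad /deficiency -leNgt => good.
set y := (N %/ k)%N in yY1 yY2 y4 ya f1 f2 good yR *.
set y' := ((N + h) %/ k)%N in by' f3 f4 good *.
have yaR : y%:R <= a%:R :> R by rewrite ler_nat.
have abR : a%:R <= b%:R :> R by rewrite ler_nat.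
have byR : b%:R <= y'%:R :> R by rewrite ler_nat.
have y'2 : y'%:R <= 2 * y%:R :> R by lra.
have e2 : 2 <= e * y%:R by rewrite mulrC -ler_pdivrMr //; exact: Y2P.
have U1 : psi a - psi y <= 2 * (a%:R - y%:R) + e * y%:R.
  by apply: Y1P => //; rewrite ya -(ler_nat R) natrM; lra.
have U2 : psi y' - psi b <= 2 * (y'%:R - b%:R) + e * b%:R.
  apply: Y1P; first exact: leq_trans (leq_trans ya ab).
  by rewrite by' -(ler_nat R) natrM; lra.
have eb : e * b%:R <= e * (2 * y%:R) by rewrite ler_pM2l //; lra.
have dw : kappa / 4 * (N%:R / k%:R) <= kappa / 4 * (2 * y%:R).
  by rewrite ler_wpM2l //; lra.
have ek : e * y%:R = kappa * y%:R / 16 by rewrite /e; ring.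
move: (N%:R / k%:R) (h%:R / k%:R) f1 f2 f3 f4 hk hk0 good dw => w z *.
by lra.
Qed.

Lemma sum_fibres_le (P : pred nat) (f : nat -> nat) (w : nat -> R) (N a b : nat) :
  (forall k, 0 <= w k) ->
  \sum_(a <= j < b) \sum_(1 <= k < N.+1 | P k && (f k == j)) w k <=
  \sum_(1 <= k < N.+1 | P k) w k.
Proof.
move=> w0; rewrite (exchange_big_dep_nat P) /=; last by move=> j k _ _ _ /andP[].
apply: ler_sum => k Pk; rewrite Pk /=.
under eq_bigl do rewrite eq_sym.
by rewrite big_nat1_eq; case: ifP.
Qed.

(** Pigeonhole over J windows [K^j, K^(j+1)), with ln N <= 4 J ln K: the bad mass of k and of N/k,
    summed over the windows, is at most J * eta. Both are needed because [good_step] alternates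
    between u and some v close to N/u. *)
Lemma low_bad_window (K1 delta eta : R) (K Y : nat) : 0 < delta -> 0 < eta -> (1 < K)%N ->
  exists N0, forall N h, (N0 <= N)%N -> (h * 10 <= N)%N ->
  (psi (N + h) - psi N) * lnn (N + h) <= K1 * N%:R ->
  exists j, [/\ (Y <= K ^ j)%N, (K ^ j.+1 * Y <= N)%N,
   \sum_(1 <= k < N.+1 | bad delta N h k && (trunc_log K k == j)) L k / k%:R <= eta &
   \sum_(1 <= k < N.+1 | bad delta N h k && (trunc_log K (N %/ k) == j)) L k / k%:R <= eta].
Proof.
move=> d0 e0 K2; have lK : 0 < lnn K by rewrite ln_gt0 // ltr1n.
have K0 : (0 < K)%N := ltnW K2.
have e1 : 0 < eta / (8 * lnn K) by rewrite divr_gt0 // mulr_gt0.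
have [N0 N0P] := bad_sum_le K1 d0 e1.
exists (maxn N0 (K ^ (4 * Y + 4))) => N h; rewrite geq_max => /andP[NN0 NK] hN gap.
have N1 : (0 < N)%N by apply: leq_trans NK; rewrite expn_gt0 K0.
have tot := N0P N h NN0 hN gap.
set T := trunc_log K N; pose J := (T %/ 2)%N.
have TY : (4 * Y + 4 <= T)%N by exact: trunc_log_max.
have KT : (K ^ T <= N)%N by exact: trunc_logP.
have NT : (N < K ^ T.+1)%N by exact: trunc_log_ltn.
have J0 : (0 < J)%N by rewrite /J; lia.
have lN : lnn N <= 4 * J%:R * lnn K.
  apply: (@le_trans _ _ (lnn (K ^ T.+1))); first by rewrite ler_lnn // ltnW.
  have -> : lnn (K ^ T.+1) = T.+1%:R * lnn K by rewrite natrX lnXn ?ltr0n // mulr_natl.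
  rewrite ler_wpM2r ?(ltW lK) // -natrM ler_nat /J.
  by lia.
pose s j := \sum_(1 <= k < N.+1 | bad delta N h k && (trunc_log K k == j)) L k / k%:R.
pose s' j := \sum_(1 <= k < N.+1 | bad delta N h k && (trunc_log K (N %/ k) == j)) L k / k%:R.
have w0 k : 0 <= L k / k%:R by rewrite divr_ge0 ?mangoldt_ge0.
have s0 j : 0 <= s j by apply: sumr_ge0 => k _.
have s'0 j : 0 <= s' j by apply: sumr_ge0 => k _.
have [j [Yj jJ sj]] : exists j, [/\ (Y <= j)%N, (j < Y + J)%N & s j + s' j <= eta].
  apply: contrapT => H.
  have big j : (Y <= j < Y + J)%N -> eta < s j + s' j.
    move=> /andP[Yj jJ]; rewrite ltNge; apply/negP => h1; apply: H.
    by exists j.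
  have lb : J%:R * eta < \sum_(Y <= j < Y + J) (s j + s' j).
    have -> : J%:R * eta = \sum_(Y <= j < Y + J) eta.
      by rewrite sumr_const_nat addKn mulr_natl.
    apply: ltr_sum_nat => //; by rewrite -[X in (X < _)%N]addn0 ltn_add2l.
  have ub1 := sum_fibres_le (bad delta N h) (trunc_log K) N Y (Y + J) w0.
  have ub2 := sum_fibres_le (bad delta N h) (fun k => trunc_log K (N %/ k)) N Y (Y + J) w0.
  move: lb; rewrite big_split /= ltNge => /negP; apply.
  apply: (le_trans (lerD ub1 ub2)); apply: (le_trans (lerD tot tot)).
  have E : eta / (8 * lnn K) * lnn N <= eta / (8 * lnn K) * (4 * J%:R * lnn K).
    by rewrite ler_wpM2l // ltW.
  apply: (le_trans (lerD E E)).
  have -> : eta / (8 * lnn K) * (4 * J%:R * lnn K) = J%:R * eta / 2.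
    by field; rewrite gt_eqF.
  by lra.
exists j; split.
- by apply: (leq_trans Yj); rewrite ltnW // ltn_expl.
- apply: leq_trans KT; apply: (@leq_trans (K ^ (Y + J) * K ^ Y)).
    by apply: leq_mul; [rewrite leq_exp2l | rewrite ltnW // ltn_expl].
  by rewrite -expnD leq_exp2l // /J; lia.
- by have := s'0 j; rewrite -/(s j); lra.
- by have := s0 j; rewrite -/(s' j); lra.
Qed.

Lemma msumB (a b : nat) : (a <= b)%N ->
  msum b - msum a = \sum_(a.+1 <= k < b.+1) L k / k%:R.
Proof.
by move=> ab; rewrite /mangoldt_sum (@big_cat_nat _ _ _ a.+1 1 b.+1) //= addrAC subrr add0r.
Qed.

Lemma psiB_msumB (a b : nat) : (0 < b)%N -> (a <= b)%N ->
  (psi b - psi a) / b%:R <= msum b - msum a.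
Proof.
move=> b0 ab; rewrite msumB // psiB // mulr_suml; apply: ler_sum_nat => k /andP[ak kb].
rewrite ler_wpM2l ?mangoldt_ge0 // lef_pV2 ?posrE ?ltr0n ?ler_nat //.
exact: leq_trans ak.
Qed.

(** Were all of (a, b] bad, its whole Mertens mass would lie in the fibre of f over j, whose bad
    mass is at most eta. *)
Lemma exists_good_msum (delta eta : R) (N h a b : nat) (f : nat -> nat) (j : nat) :
  \sum_(1 <= k < N.+1 | bad delta N h k && (f k == j)) L k / k%:R <= eta ->
  (forall v, (a < v <= b)%N -> f v = j) -> (a <= b <= N)%N ->
  eta < msum b - msum a ->
  exists2 v, (a < v <= b)%N & ~~ bad delta N h v.
Proof.
move=> low fj /andP[ab bN] full; apply: contrapT => H.
have allbad v : (a < v <= b)%N -> bad delta N h v.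
  by move=> vab; apply: contrapT => /negP h1; apply: H; exists v.
have w0 k : 0 <= L k / k%:R by rewrite divr_ge0 ?mangoldt_ge0.
move: full; rewrite ltNge => /negP; apply; rewrite msumB //; apply: le_trans low.
rewrite [leRHS]big_mkcond /= [leRHS](@big_cat_nat _ _ _ a.+1) //=; last first.
  by rewrite ltnS (leq_trans ab).
rewrite -[leLHS]add0r; apply: lerD; first by apply: sumr_ge0 => k _; case: ifP.
rewrite [leRHS](@big_cat_nat _ _ _ b.+1) //= -[leLHS]addr0; apply: lerD; last first.
  by apply: sumr_ge0 => k _; case: ifP.
by apply: ler_sum_nat => k akb; rewrite allbad // fj // eqxx.
Qed.

Lemma exists_good (delta eta : R) (N h a b : nat) (f : nat -> nat) (j : nat) :
  \sum_(1 <= k < N.+1 | bad delta N h k && (f k == j)) L k / k%:R <= eta ->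
  (forall v, (a < v <= b)%N -> f v = j) -> (a <= b <= N)%N -> (0 < b)%N ->
  eta * b%:R < psi b - psi a ->
  exists2 v, (a < v <= b)%N & ~~ bad delta N h v.
Proof.
move=> low fj abN b0 full; apply: (exists_good_msum low fj) => //.
have /andP[ab _] := abN; by apply: lt_le_trans (psiB_msumB b0 ab); rewrite ltr_pdivlMr // ltr0n.
Qed.

Lemma divn_floor_inv (n c s : nat) : (0 < c)%N -> (0 < s)%N ->
  (n %/ (c * s))%:R <= (n%:R * s%:R^-1 / c%:R : R) < (n %/ (c * s))%:R + 1.
Proof.
move=> c0 s0; have := @divn_floor n (c * s); rewrite muln_gt0 c0 s0 => /(_ isT).
by rewrite natrM invfM mulrA mulrAC.
Qed.

(* If u is good then (N/u, (1+c)N/u] is as dense as possible, hence contains a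
   good v just above N/u; the dense interval (N/v, (1+c)N/v] in turn covers the
   beginning of (u, (1+c)u], and yields the next good number. *)
Lemma good_step (s : nat) : (10 <= s)%N ->
  exists delta eta : R, exists Y, [/\ 0 < delta, 0 < eta < 1 & forall N K j u,
  (1 < K)%N -> (Y <= K ^ j)%N -> (K ^ j.+1 * Y <= N)%N ->
  \sum_(1 <= k < N.+1 | bad delta N (N %/ s) k && (trunc_log K k == j)) L k / k%:R <= eta ->
  \sum_(1 <= k < N.+1 | bad delta N (N %/ s) k && (trunc_log K (N %/ k) == j)) L k / k%:R <= eta ->
  (2 * K ^ j <= u)%N -> (4 * u <= K ^ j.+1)%N -> ~~ bad delta N (N %/ s) u ->
  exists2 u', (u < u')%N && (u' <= K ^ j.+1)%N &
    ~~ bad delta N (N %/ s) u' /\ 17 / 10 * (lnn u' - lnn u) <= msum u' - msum u].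
Proof.
move=> s10; have s0 : (0 < s)%N by exact: leq_trans s10.
have sR : (0 : R) < s%:R by rewrite ltr0n.
pose g : R := s%:R^-1; have g0 : 0 < g by rewrite invr_gt0.
have g1 : g <= 1 / 10.
  by rewrite /g div1r lef_pV2 ?posrE // (ler_nat R 10).
have kap0 : 0 < g / 30 by rewrite divr_gt0.
have [delta d0 [Y0 Y0P]] := full_of_good kap0.
exists delta, (g / 100), (maxn Y0 (100 * s)); split=> //.
  by apply/andP; split; lra.
move=> N K j u K2; rewrite geq_max => /andP[YK sK] KN low1 low2 uK Ku good.
set h := (N %/ s)%N in low1 low2 good *.
have Kj0 : (0 < K ^ j)%N by rewrite expn_gt0 (ltnW K2).
have uQ : (u <= K ^ j.+1)%N by apply: leq_trans Ku; rewrite leq_pmull.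
have uP : (K ^ j <= u)%N by apply: leq_trans uK; rewrite leq_pmull.
have u0 : (1 < u)%N by apply: leq_trans uK; rewrite -[X in (X <= _)%N]muln1 leq_mul2l Kj0.
have u00 : (0 < u)%N by exact: ltnW.
have uR : (0 : R) < u%:R by rewrite ltr0n.
have hN : (h * 10 <= N)%N by apply: leq_trans (leq_divM N s); rewrite leq_mul2l s10 orbT.
set y := (N %/ u)%N; set y' := ((N + h) %/ u)%N.
have yY : (maxn Y0 (100 * s) <= y)%N.
  rewrite leq_divRL // mulnC; apply: leq_trans KN; by rewrite leq_mul2r uQ orbT.
move: yY; rewrite geq_max => /andP[yY0 ys].
have gs : g * s%:R = 1 by rewrite mulVf // gt_eqF.
have big (n : nat) : (100 * s <= n)%N -> 100 <= n%:R * g.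
  by move=> sn; rewrite ler_pdivlMr // -natrM ler_nat.
have yg := big y ys.
have ug : 100 <= u%:R * g by apply: big; apply: leq_trans uP.
have /andP[f1 f2] := divn_floor N u00; rewrite -/y in f1 f2.
have /andP[f3 f4] := divn_floor (N + h) u00; rewrite -/y' natrD mulrDl in f3 f4.
have /andP[f5 f6] := divn_floor N s0; rewrite -/h -/g in f5 f6.
set w : R := N%:R / u%:R in f1 f2 f3 f4.
have NE : N%:R = w * u%:R by rewrite /w divfK // gt_eqF.
have u1V : u%:R^-1 <= 1 :> R by rewrite invf_le1 // ler1n.
have hu : w * g - 1 <= h%:R / u%:R.
  have : (N%:R * g - 1) / u%:R <= h%:R / u%:R by rewrite ler_wpM2r ?invr_ge0 //; lra.
  by rewrite NE mulrBl mul1r mulrAC mulfK ?gt_eqF //; lra.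
(* The search for v stays within a factor 1 + g/20 of N/u, so that N/v is at least (1 - g/20) u and
   the dense interval of v still reaches well beyond u. *)
pose b := (y + y %/ (20 * s))%N.
have /andP[b1 b2] := @divn_floor_inv y 20 s isT s0; rewrite -/g in b1 b2.
have bR : b%:R = y%:R + (y %/ (20 * s))%:R :> R by rewrite natrD.
have ygw : y%:R * g <= w * g by rewrite ler_wpM2r // ltW.
have by' : (b <= y')%N by rewrite -ltnS -(ltr_nat R) -natr1 bR; lra.
have yb : (y <= b)%N by rewrite leq_addr.
have b2y : (b <= 2 * y)%N by rewrite mul2n -addnn leq_add2l leq_div.
have b2yR : b%:R <= 2 * y%:R :> R by rewrite -natrM ler_nat.
have F1 := Y0P N h u hN u00 good yY0 y b (leqnn _) yb by'.
have uyN : (u * y <= N)%N by rewrite mulnC leq_divM.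
have [v /andP[yv vb] vgood] : exists2 v, (y < v <= b)%N & ~~ bad delta N h v.
  apply: (exists_good low2).
  - move=> v /andP[yv vb]; apply: trunc_log_eq => //; apply/andP; split.
      rewrite leq_divRL ?(leq_ltn_trans _ yv) //.
      apply: leq_trans uyN; apply: (@leq_trans (K ^ j * (2 * y))).
        by rewrite leq_mul2l (leq_trans vb b2y) orbT.
      by rewrite mulnA leq_mul2r [(_ * 2)%N]mulnC uK orbT.
    rewrite ltn_divLR ?(leq_ltn_trans _ yv) //.
    apply: (@leq_trans (y.+1 * u)); first exact: ltn_ceil.
    by rewrite mulnC leq_mul.
  - rewrite yb; apply: (leq_trans b2y); apply: leq_trans uyN.
    by rewrite leq_mul2r u0 orbT.
  - by apply: leq_trans yb; apply: leq_trans ys; rewrite muln_gt0.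
  have : g / 100 * b%:R <= g / 100 * (2 * y%:R) by rewrite ler_wpM2l //; lra.
  by lra.
have v0 : (0 < v)%N by exact: leq_ltn_trans yv.
have vR : (0 : R) < v%:R by rewrite ltr0n.
set z := (N %/ v)%N.
have zu : (z < u)%N.
  rewrite ltn_divLR //; apply: (@leq_trans (y.+1 * u)); first exact: ltn_ceil.
  by rewrite mulnC leq_mul2l yv orbT.
have zK : (K ^ j <= z)%N.
  rewrite leq_divRL //; apply: leq_trans uyN; apply: (@leq_trans (K ^ j * (2 * y))).
    by rewrite leq_mul2l (leq_trans vb b2y) orbT.
  by rewrite mulnA leq_mul2r [(_ * 2)%N]mulnC uK orbT.
have /andP[_ z2] := divn_floor (N + h) v0; rewrite natrD mulrDl in z2.
have vw : v%:R <= w * (1 + g / 20).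
  apply: (@le_trans _ _ b%:R); first by rewrite ler_nat.
  by rewrite bR; clear -b1 f1 ygw; lra.
have Nv : u%:R * (1 - g / 20) <= N%:R / v%:R.
  rewrite ler_pdivlMr // NE.
  apply: (@le_trans _ _ (u%:R * (1 - g / 20) * (w * (1 + g / 20)))).
    by rewrite ler_wpM2l // mulr_ge0 //; clear -g1; lra.
  have -> : u%:R * (1 - g / 20) * (w * (1 + g / 20)) = w * u%:R * (1 - (g / 20) ^+ 2) by ring.
  rewrite ler_piMr //; first by rewrite -NE.
  by have := sqr_ge0 (g / 20); lra.
have hv : N%:R / v%:R * g - 1 <= h%:R / v%:R.
  have : (N%:R * g - 1) / v%:R <= h%:R / v%:R.
    by rewrite ler_wpM2r ?invr_ge0 //; clear -f6; lra.
  have : v%:R^-1 <= 1 :> R by rewrite invf_le1 // ler1n.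
  by rewrite mulrBl mul1r mulrAC; clear; lra.
have Nvg : u%:R * (1 - g / 20) * g <= N%:R / v%:R * g by rewrite ler_wpM2r // ltW.
have ugg : u%:R * g * g <= u%:R * g * (1 / 10) by rewrite ler_wpM2l // mulr_ge0 // ltW.
(* The next good number is sought in (c1, c2]: past c1 the advance dominates the error of
   [full_of_good], and up to c2 the dense interval of v applies. *)
pose c1 := (u + u %/ (4 * s))%N; pose c2 := (u + u %/ (2 * s))%N.
have /andP[c11 c12] := @divn_floor_inv u 4 s isT s0; rewrite -/g in c11 c12.
have /andP[c21 c22] := @divn_floor_inv u 2 s isT s0; rewrite -/g in c21 c22.
have c1R : c1%:R = u%:R + (u %/ (4 * s))%:R :> R by rewrite natrD.
have c2R : c2%:R = u%:R + (u %/ (2 * s))%:R :> R by rewrite natrD.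
have c2z : (c2 <= (N + h) %/ v)%N.
  by rewrite -ltnS -(ltr_nat R) -natr1 c2R; clear -c21 z2 Nv hv Nvg ugg ug; lra.
have c12n : (c1 <= c2)%N by rewrite leq_add2l leq_div2l // ?muln_gt0 ?s0 // leq_mul2r orbT.
have uc1 : (u <= c1)%N by rewrite leq_addr.
have c2u : (c2 <= 2 * u)%N by rewrite mul2n -addnn leq_add2l leq_div.
have c2uR : c2%:R <= 2 * u%:R :> R by rewrite -natrM ler_nat.
have zY : (Y0 <= z)%N by exact: leq_trans zK.
have F2 a c := Y0P N h v hN v0 vgood zY a c.
have zuR : z%:R <= u%:R :> R by rewrite ler_nat ltnW.
have gz : g / 30 * z%:R <= g / 30 * u%:R by rewrite ler_wpM2l // ltW.
have Nge : (K ^ j.+1 <= N)%N.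
  apply: leq_trans KN; rewrite leq_pmulr // leq_max orbC muln_gt0 s0 //.
have c2Q : (c2 < K ^ j.+1)%N by apply: leq_ltn_trans c2u _; apply: leq_trans Ku; rewrite ltn_mul2r u00.
have [u' /andP[c1u' u'c2] u'good] : exists2 v, (c1 < v <= c2)%N & ~~ bad delta N h v.
  apply: (exists_good low1).
  - move=> t /andP[t1 t2]; apply: trunc_log_eq => //; apply/andP; split.
      by apply: leq_trans (ltnW t1); exact: leq_trans uc1.
    exact: leq_ltn_trans t2 c2Q.
  - by rewrite c12n /= (leq_trans (ltnW c2Q)).
  - by apply: leq_trans c12n; exact: leq_trans uc1.
  have := F2 c1 c2 (leq_trans (ltnW zu) uc1) c12n c2z.
  have : g / 100 * c2%:R <= g / 100 * (2 * u%:R) by rewrite ler_wpM2l //; clear -g0; lra.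
  by clear -ug gz c1R c2R c11 c22; lra.
have uu1 : (u < u')%N by exact: leq_ltn_trans c1u'.
exists u'; first by rewrite uu1 (leq_trans u'c2) // ltnW.
split=> //; have uu' : (u <= u')%N by exact: ltnW.
have u'0 : (0 < u')%N by exact: leq_ltn_trans uu1.
have u'R : (0 : R) < u'%:R by rewrite ltr0n.
apply: le_trans (psiB_msumB u'0 uu').
have F3 := F2 u u' (ltnW zu) uu' (leq_trans u'c2 c2z).
have lnu : lnn u' - lnn u <= (u'%:R - u%:R) / u%:R.
  rewrite -ln_div ?posrE //; apply: le_trans (ln_le_subr1 _) _; first by rewrite divr_gt0.
  by rewrite mulrBl divff // gt_eqF.
apply: (@le_trans _ _ (17 / 10 * ((u'%:R - u%:R) / u%:R))); first by rewrite ler_wpM2l //; clear; lra.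
(* With d = u' - u >= u g / 4, the error g z / 30 is at most 2 d / 15, and 2 - 2/15 exceeds 17/10 *
   21/20, where 21/20 bounds u'/u. *)
have d1 : u%:R * g / 4 <= u'%:R - u%:R.
  have : c1.+1%:R <= u'%:R :> R by rewrite ler_nat.
  by rewrite -natr1 c1R; clear -c12; lra.
have d2 : u'%:R <= u%:R * (21 / 20) :> R.
  have : u'%:R <= c2%:R :> R by rewrite ler_nat.
  have : u%:R * g <= u%:R * (1 / 10) by rewrite ler_wpM2l // ltW.
  by rewrite c2R; clear -c21; lra.
set d := u'%:R - u%:R in d1 F3 *.
have d0' : 0 <= d by apply: le_trans d1; rewrite !mulr_ge0 // ?invr_ge0 // ltW.
rewrite ler_pdivlMr //.
have -> : 17 / 10 * (d / u%:R) * u'%:R = 17 / 10 * d * (u'%:R / u%:R) by ring.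
have r : u'%:R / u%:R <= 21 / 20 :> R by rewrite ler_pdivrMr // mulrC.
have : 17 / 10 * d * (u'%:R / u%:R) <= 17 / 10 * d * (21 / 20).
  by rewrite ler_wpM2l // mulr_ge0 //; clear; lra.
by rewrite -/z in F3; clear -d1 d0' F3 gz; lra.
Qed.

(** Iterate [good_step] up to some m > K^(j+1) / 4. Growth of [msum] at rate 17/10 against Mertens'
    rate 1, whose error is 8, gives ln m - ln u <= 80/7; ln 4 <= 2 covers the rest. *)
Lemma good_chain (s : nat) : (10 <= s)%N ->
  exists delta eta : R, exists Y, [/\ 0 < delta, 0 < eta < 1 & forall N K j u,
  (1 < K)%N -> (Y <= K ^ j)%N -> (K ^ j.+1 * Y <= N)%N ->
  \sum_(1 <= k < N.+1 | bad delta N (N %/ s) k && (trunc_log K k == j)) L k / k%:R <= eta ->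
  \sum_(1 <= k < N.+1 | bad delta N (N %/ s) k && (trunc_log K (N %/ k) == j)) L k / k%:R <= eta ->
  (2 * K ^ j <= u)%N -> (u <= K ^ j.+1)%N -> ~~ bad delta N (N %/ s) u ->
  lnn (K ^ j.+1) - lnn u <= 14].
Proof.
move=> s10; have [delta [eta [Y [d0 e01 stepP]]]] := good_step s10.
exists delta, eta, Y; split => // N K j u K2 YK KN low1 low2 uK uQ good.
have Kj0 : (0 < K ^ j)%N by rewrite expn_gt0 (ltnW K2).
have [m um [mQ mQ4 mlow]] : exists2 m, (u <= m)%N & [/\ (m <= K ^ j.+1)%N,
    (K ^ j.+1 < 4 * m)%N & 17 / 10 * (lnn m - lnn u) <= msum m - msum u].
  have [n] := ubnP (K ^ j.+1 - u)%N.
  elim: n u uK uQ good => // n IH u uK uQ good nu.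
  case: (leqP (4 * u) (K ^ j.+1)) => [Ku|Ku]; last first.
    by exists u => //; split => //; rewrite !subrr mulr0.
  have [u' /andP[uu' u'Q] [good' low']] := stepP N K j u K2 YK KN low1 low2 uK Ku good.
  have [||m u'm [mQ mQ4 mlow]] := IH u' _ u'Q good'.
  - exact: leq_trans uK (ltnW uu').
  - apply: leq_trans (ltn_sub2l _ uu') _; first exact: leq_trans uu' u'Q.
    by rewrite -ltnS.
  exists m; first exact: leq_trans (ltnW uu') u'm.
  by split => //; lra.
have u0 : (0 < u)%N by apply: leq_trans uK; rewrite muln_gt0.
have m0 : (0 < m)%N by exact: leq_trans um.
have /andP[_ h1] := mertens R m0; have /andP[h2 _] := mertens R u0.
have h3 : lnn (K ^ j.+1) <= lnn (4 * m) by rewrite ler_lnn ?expn_gt0 ?(ltnW K2) // ltnW.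
have h4 : lnn 4 <= 2.
  rewrite (_ : 4%N = 2 * 2)%N // lnnM //.
  by have : lnn 2 <= 2 - 1 by [exact: ln_le_subr1]; lra.
by rewrite lnnM // in h3; lra.
Qed.

(** Only proper prime powers contribute. Two powers of one prime differ by a factor at least 2, so
    N' <= 2N leaves at most one per prime, and the prime is at most sqrt N'. This gives sqrt N' (ln
    N')^2 <= 16 N'. *)
Lemma psi_prime_free (N N' : nat) : (0 < N)%N -> (N <= N' <= 2 * N)%N ->
  (forall p, prime p -> (N < p <= N')%N -> False) ->
  (psi N' - psi N) * lnn N' <= 32 * N%:R.
Proof.
move=> N0 /andP[NN' N'2] nop; rewrite psiB //.
have N'0 : (0 < N')%N by exact: leq_trans NN'.
pose S := [seq k <- index_iota N.+1 N'.+1 | L k != 0].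
have SP k : k \in S -> exists p i, [/\ prime p, (1 < i)%N, k = (p ^ i)%N & (N < k <= N')%N].
  rewrite mem_filter mem_index_iota ltnS => /andP[/mangoldt_neq0[p [i [pp i0 kE]]] kN].
  exists p, i; split => //; case: i i0 kE => [|[|i]] // _ kE.
  by exfalso; apply: (nop p pp); rewrite expn1 in kE; rewrite -kE.
have -> : \sum_(N.+1 <= k < N'.+1) L k = \sum_(k <- S) L k.
  rewrite big_filter [RHS]big_mkcond; apply: eq_bigr => k _.
  by case: eqP.
pose r := Num.truncn (Num.sqrt N'%:R : R).
have sizeS : (size S <= r)%N.
  rewrite -(size_map pdiv) -(size_iota 1 r); apply: uniq_leq_size.
    rewrite map_inj_in_uniq ?filter_uniq ?iota_uniq // => a b /SP[p [i [pp i1 aE aN]]].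
    move=> /SP[q [i' [pq i'1 bE bN]]].
    case: i i1 aE => // i i1 aE; case: i' i'1 bE => // i' i'1 bE.
    rewrite {1}aE {1}bE !pdiv_pfactor // => pq'; subst q.
    have lt (x y c d : nat) : (x < y)%N -> c = (p ^ x)%N -> d = (p ^ y)%N ->
        (N < c)%N -> (d <= N')%N -> False.
      move=> xy cE dE Nc dN'; have : (2 * c <= d)%N.
        rewrite cE dE; apply: (@leq_trans (p ^ x.+1)); last by rewrite leq_exp2l ?prime_gt1.
        by rewrite expnS leq_mul2r prime_gt1 // orbT.
      move=> cd; have := leq_trans (leq_trans cd dN') N'2.
      by rewrite leq_mul2l /= leqNgt Nc.
    move/andP: aN => [aN1 aN2]; move/andP: bN => [bN1 bN2].
    have [ii|ii|ii] := ltngtP i i'; last by rewrite aE bE ii.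
      by exfalso; apply: (lt i.+1 i'.+1 a b).
    by exfalso; apply: (lt i'.+1 i.+1 b a).
  move=> _ /mapP[k /SP[p [i [pp i1 kE /andP[_ kN']]]] ->].
  case: i i1 kE => // i i1 kE; rewrite kE pdiv_pfactor // mem_iota prime_gt0 //=.
  rewrite add1n ltnS truncn_ge_nat ?sqrtr_ge0 //.
  rewrite -(ger0_norm (ler0n R p)) -sqrtr_sqr ler_sqrt ?ler0n // -natrX ler_nat.
  by apply: leq_trans kN'; rewrite kE (leq_exp2l _ _ (prime_gt1 pp)).
have lN' := lnn_ge0 R N'.
have sumS : \sum_(k <- S) L k <= Num.sqrt N'%:R * lnn N'.
  apply: (@le_trans _ _ (\sum_(k <- S) lnn N')).
    rewrite big_seq [leRHS]big_seq; apply: ler_sum => k /SP[_ [_ [_ _ _ /andP[Nk kN']]]].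
    have k0 : (0 < k)%N by exact: leq_ltn_trans Nk.
    by apply: (le_trans (mangoldt_le R k0)); rewrite ler_lnn.
  rewrite big_const_seq count_predT iter_addr_0 -[_ *+ size S]mulr_natl ler_wpM2r //.
  apply: (@le_trans _ _ r%:R); first by rewrite ler_nat.
  by rewrite truncn_le sqrtr_ge0.
have N'1 : (1 : R) <= N'%:R by rewrite ler1n.
have [/andP[_ l4] t1] := ln_le_quartic N'1.
have t0 : 0 <= Num.sqrt (Num.sqrt N'%:R) :> R := sqrtr_ge0 _.
have sE : Num.sqrt N'%:R = Num.sqrt (Num.sqrt N'%:R) ^+ 2 :> R.
  by rewrite sqr_sqrtr ?sqrtr_ge0.
have NE : N'%:R = Num.sqrt (Num.sqrt N'%:R) ^+ 4 :> R.
  by rewrite (exprM _ 2 2) !sqr_sqrtr ?sqrtr_ge0.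
have N'2R : N'%:R <= 2 * N%:R :> R by rewrite -natrM ler_nat.
apply: (le_trans (ler_wpM2r lN' sumS)); rewrite sE.
apply: (@le_trans _ _ (16 * N'%:R)); last by lra.
rewrite [in leRHS]NE; move: (Num.sqrt (Num.sqrt _)) t1 t0 l4 => t t1 t0 l4.
rewrite -mulrA; apply: (@le_trans _ _ (t ^+ 2 * (4 * t * (4 * t)))).
  by rewrite ler_wpM2l ?exprn_ge0 // ler_pM //; lra.
by rewrite le_eqVlt; apply/orP; left; apply/eqP; ring.
Qed.

Lemma prime_in_short_interval (s : nat) : (10 <= s)%N ->
  exists N0, forall N, (N0 <= N)%N -> exists2 p, prime p & (N < p <= N + N %/ s)%N.
Proof.
move=> s10; have s0 : (0 < s)%N by exact: leq_trans s10.
have [delta [eta [Y [d0 /andP[e0 e1] chainP]]]] := good_chain s10.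
(* With ln B >= 12, the mass of (2 K^j, B K^j] is at least 12 - ln 2 - 8 > eta, so it contains a
   good u. Then ln K >= 15 + ln B leaves a distance of at least 15 up to K^(j+1), against the bound
   14 of [good_chain]. *)
have [B B0 BP] := lnn_unbounded 12; have [K0 K00 K0P] := lnn_unbounded (15 + lnn B).
pose K := maxn (maxn B K0) 2.
have [KB KK0 K2] : [/\ (B <= K)%N, (K0 <= K)%N & (1 < K)%N].
  by rewrite !leq_max !leqnn !orbT.
have [N0 N0P] := low_bad_window 32 (maxn Y 1) d0 e0 K2.
exists (maxn N0 1) => N; rewrite geq_max => /andP[NN0 N1].
apply: contrapT => H.
set h := (N %/ s)%N in H.
have hN : (h * 10 <= N)%N by apply: leq_trans (leq_divM N s); rewrite leq_mul2l s10 orbT.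
have gap : (psi (N + h) - psi N) * lnn (N + h) <= 32 * N%:R.
  apply: psi_prime_free => //.
    by rewrite leq_addr mul2n -addnn leq_add2l leq_div.
  by move=> p pp pN; apply: H; exists p.
have [j [Yj KN low1 low2]] := N0P N h NN0 hN gap.
have YKj : (Y <= K ^ j)%N by apply: leq_trans Yj; exact: leq_maxl.
have KNY : (K ^ j.+1 * Y <= N)%N by apply: leq_trans KN; rewrite leq_mul2l leq_maxl orbT.
have Kj0 : (0 < K ^ j)%N by rewrite expn_gt0 (ltnW K2).
have KjN : (K ^ j.+1 <= N)%N by apply: leq_trans KN; rewrite leq_pmulr // leq_maxr.
have lK := K0P K KK0; have lB := BP B (leqnn B).
have l2 : lnn 2 <= 1 by apply: le_trans (ln_le_subr1 _) _; lra.
have B2 : (2 <= B)%N.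
  by rewrite leqNgt; apply/negP => B1; move: lB; have -> : B = 1%N by [lia]; rewrite ln1; lra.
have BK : (B < K)%N.
  rewrite ltnNge; apply/negP => KB'; have := ler_lnn R (ltnW K2) KB'.
  by lra.
have [u /andP[uK uB] ugood] :
    exists2 u, (2 * K ^ j < u <= B * K ^ j)%N & ~~ bad delta N h u.
  apply: (exists_good_msum low1).
  - move=> v /andP[v1 v2]; apply: trunc_log_eq => //; apply/andP; split.
      by apply: leq_trans (ltnW v1); rewrite leq_pmull.
    by apply: leq_ltn_trans v2 _; rewrite expnS ltn_mul2r Kj0.
  - rewrite leq_mul2r B2 orbT /= (leq_trans _ KjN) // expnS leq_mul2r KB orbT //.
  have b0 : (0 < B * K ^ j)%N by rewrite muln_gt0 B0.
  have /andP[h1 _] := mertens R b0; have a0 : (0 < 2 * K ^ j)%N by rewrite muln_gt0.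
  have /andP[_ h2] := mertens R a0.
  by rewrite !lnnM // in h1 h2; lra.
have := chainP N K j u K2 YKj KNY low1 low2 (ltnW uK) _ ugood.
have uQ : (u <= K ^ j.+1)%N by apply: (leq_trans uB); rewrite expnS leq_mul2r KB orbT.
move=> /(_ uQ).
have u0 : (0 < u)%N by exact: leq_ltn_trans uK.
have : lnn u <= lnn (B * K ^ j) by rewrite ler_lnn.
rewrite expnS !lnnM //; last by exact: ltnW.
by lra.
Qed.

End PrimeGaps.

(** * The Frankl-Wilson bound *)

Section MonomialCount.

Definition monomials (n k : nat) : {set {ffun 'I_n -> 'I_k.+1}} :=
  [set e : {ffun 'I_n -> 'I_k.+1} | \sum_i (e i : nat) == k]%SET.

(** Rankin's trick: each such monomial contributes t^k to the expansion of the n-th power of a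
    truncated geometric series. *)
Lemma card_monomials_le (R : realType) (n k : nat) (t : R) : 0 < t < 1 ->
  #|monomials n k|%:R <= t ^- k * (1 - t) ^- n.
Proof.
move=> /andP[t0 t1]; rewrite mulrC ler_pdivlMr ?exprn_gt0 //.
apply: (@le_trans _ _ (\sum_(e : {ffun 'I_n -> 'I_k.+1}) \prod_i t ^+ (e i))).
  rewrite mulr_natl -sumr_const big_mkcond; apply: ler_sum => e _.
  case: ifP => [|_]; last by rewrite prodr_ge0 // => i _; rewrite exprn_ge0 // ltW.
  by rewrite inE => /eqP eE; rewrite prodrXr eE.
rewrite -(bigA_distr_bigA (fun (i : 'I_n) (l : 'I_k.+1) => t ^+ l)) /=.
rewrite prodr_const card_ord -exprVn lerXn2r ?nnegrE ?invr_ge0 ?subr_ge0 ?(ltW t1) //.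
  by rewrite sumr_ge0 // => l _; rewrite exprn_ge0 // ltW.
have u0 : 0 < 1 - t by rewrite subr_gt0.
rewrite -[_^-1]mul1r ler_pdivlMr // -[leRHS]subr0 mulrC.
have -> : (1 - t) * \sum_(l < k.+1) t ^+ l = 1 - t ^+ k.+1.
  by rewrite -[LHS]opprK -mulNr opprB -subrX1 opprB.
by rewrite lerB // exprn_ge0 // ltW.
Qed.

(** The multinomial theorem, with the coefficient counted as the number of maps from the k factors
    to the indices of type e. Each term separates u from w, which is what bounds a matrix rank. *)
Lemma pow_dot_monomials (F : comNzRingType) (n k : nat) :
  exists N : {ffun 'I_n -> 'I_k.+1} -> F, forall u w : 'I_n -> F,
  (\sum_i u i * w i) ^+ k =
  \sum_(e in monomials n k) N e * (\prod_i u i ^+ e i) * (\prod_i w i ^+ e i).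
Proof.
pose ty (f : {ffun 'I_k -> 'I_n}) : {ffun 'I_n -> 'I_k.+1} :=
  [ffun i => inord #|[pred j | f j == i]|].
have tyE f i : ty f i = #|[pred j | f j == i]| :> nat.
  by rewrite ffunE inordK // ltnS (leq_trans (max_card _)) // card_ord.
have tyM (f : {ffun 'I_k -> 'I_n}) (v : 'I_n -> F) : \prod_j v (f j) = \prod_i v i ^+ ty f i.
  rewrite (partition_big f xpredT) //=; apply: eq_bigr => i _.
  rewrite tyE -prodr_const; apply: eq_bigr => j /= /eqP fj.
  by rewrite fj.
exists (fun e => #|[pred f | ty f == e]|%:R) => {}u {}w.
rewrite -[k in LHS]card_ord -prodr_const bigA_distr_bigA /=.
rewrite (partition_big ty (mem (monomials n k))) /=; last first.
  move=> f _; rewrite inE; apply/eqP; rewrite -[RHS]card_ord -sum1_card.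
  rewrite (partition_big f xpredT) //=; apply: eq_bigr => i _.
  by rewrite tyE sum1_card.
apply: eq_bigr => e _.
transitivity (\sum_(f | ty f == e) (\prod_i u i ^+ e i) * (\prod_i w i ^+ e i)).
  by apply: eq_bigr => f /eqP <-; rewrite big_split /= !tyM.
by rewrite sumr_const -[RHS]mulrA mulr_natl.
Qed.

(* By Fermat's little theorem the identity matrix is 1 - (u_a . w_b)^(p-1). *)
Lemma frankl_wilson (p n : nat) (T : finType) (u w : T -> 'I_n -> 'F_p) : prime p ->
  (forall a, \sum_i u a i * w a i = 0) ->
  (forall a b, a != b -> \sum_i u a i * w b i != 0) ->
  (#|T| <= 1 + #|monomials n p.-1|)%N.
Proof.
move=> pp diag off.
have [N NP] := pow_dot_monomials 'F_p n p.-1.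
set E := monomials n p.-1.
pose A := \matrix_(a < #|T|, l < #|E|)
  (N (enum_val l) * \prod_i u (enum_val a) i ^+ enum_val l i) : 'M['F_p]_(_, _).
pose B := \matrix_(l < #|E|, b < #|T|) (\prod_i w (enum_val b) i ^+ enum_val l i)
  : 'M['F_p]_(_, _).
have p1 : (0 < p.-1)%N by rewrite -subn1 subn_gt0 prime_gt1.
(* The all-ones matrix has rank at most one and the product [A *m B] factors through the
   monomials. *)
have ME : 1%:M = (const_mx 1 : 'cV_#|T|) *m (const_mx 1 : 'rV_#|T|) - A *m B.
  apply/matrixP => a b; rewrite !mxE.
  rewrite big_ord_recl big_ord0 addr0 !mxE mulr1.
  have -> : \sum_j A a j * B j b = (\sum_i u (enum_val a) i * w (enum_val b) i) ^+ p.-1.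
    rewrite NP [RHS]big_enum_val /=; apply: eq_bigr => l _; rewrite !mxE.
    by congr (_ * _).
  case: eqP => [<-|/eqP ab]; first by rewrite diag expr0n -[p.-1 == _]negbK -lt0n p1 subr0.
  have /off nz : enum_val a != enum_val b by rewrite (inj_eq enum_val_inj).
  have fermat (x : 'F_p) : x != 0 -> x ^+ p.-1 = 1.
    move=> x0; apply: (mulfI x0); rewrite mulr1 -exprS prednK ?prime_gt0 //.
    by have := finfield.expf_card x; rewrite card_Fp.
  by rewrite fermat // subrr.
rewrite -[leqLHS](mxrank1 'F_p) ME.
apply: (leq_trans (mxrank_add _ _)); apply: leq_add.
  by apply: (leq_trans (mxrankM_maxl _ _)); rewrite rank_leq_col.
by rewrite mxrank_opp; apply: (leq_trans (mxrankM_maxl _ _)); rewrite rank_leq_col.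
Qed.

End MonomialCount.

(** * Chromatic lower bound from a family of integer points *)

Section LatticeFamilies.
Variable R : realType.

Definition scaled_distances (p m : nat) : set R :=
  [set Num.sqrt (2 * p * j.+1)%:R | j in `I_m].

Lemma scaled_distancesP (p m : nat) : (0 < p)%N -> distance_sets R m (scaled_distances p m).
Proof.
move=> p0; split.
  by move=> _ [j _ <-] /=; rewrite sqrtr_gt0 ltr0n !muln_gt0 p0.
apply: inj_card_eq => i j _ _ /= /(congr1 (fun x => x ^+ 2)).
rewrite !sqr_sqrtr // => /eqP; rewrite eqr_nat => /eqP /eqP.
by rewrite eqn_pmul2l ?muln_gt0 ?p0 // => /eqP [].
Qed.

Lemma intr_Fp_eq0 (p : nat) (z : int) : prime p -> ((z%:~R : 'F_p) == 0) = (p %| z)%Z.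
Proof. by move=> pp; rewrite (dvdz_pcharf (pchar_Fp pp)). Qed.

Definition int_point (n : nat) (x : 'rV[int]_n) : 'rV[R]_n := \row_i (x ord0 i)%:~R.

Lemma int_point_dist (n : nat) (x y : 'rV[int]_n) :
  euclidean_norm (int_point x - int_point y) =
  Num.sqrt (\sum_i (x ord0 i - y ord0 i) ^+ 2)%:~R.
Proof.
rewrite /euclidean_norm rmorph_sum /=; congr Num.sqrt; apply: eq_bigr => i _.
by rewrite !mxE -rmorphB -rmorphXn.
Qed.

(** Every colour class avoids the m distances, so the Frankl-Wilson bound limits its size, and the
    number of colours is at least the quotient. *)
Lemma chi_lattice_family (n m p : nat) (T : finType) (x : T -> 'rV[int]_n) (c : int) :
  prime p -> injective x ->
  (forall a, ((2 * p)%:Z %| \sum_i x a ord0 i ^+ 2 - c)%Z) ->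
  (forall a b, \sum_i (x a ord0 i - x b ord0 i) ^+ 2 < (2 * p * m.+1)%:Z) ->
  ((#|T|%:R / (1 + #|monomials n.+1 p.-1|)%:R)%:E <= m_distance_chromatic_number R n m)%E.
Proof.
move=> pp xinj xc xd; have p0 := prime_gt0 pp.
apply: (@le_trans _ _ (chi n (scaled_distances p m))); last first.
  by apply: ereal_sup_ubound; exists (scaled_distances p m) => //; exact: scaled_distancesP.
apply: le_ereal_inf_tmp => _ [k /= [col colP] <-].
rewrite lee_fin ler_pdivrMr ?ltr0n // -natrM ler_nat.
pose cls (j : 'I_k) := [set a | col (int_point (x a)) == j]%SET.
suff clsB j : (#|cls j| <= 1 + #|monomials n.+1 p.-1|)%N.
  rewrite -sum1_card (partition_big (fun a => col (int_point (x a))) xpredT) //=.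
  rewrite -[X in (X * _)%N]card_ord -sum_nat_const; apply: leq_sum => j _.
  by apply: leq_trans (clsB j); rewrite -sum1_card; apply: eq_leq; apply: eq_bigl => a; rewrite inE.
pose dot a b : int := \sum_i x a ord0 i * x b ord0 i.
pose T' := {a | a \in cls j}.
(* The extra coordinate, c in u and 1 in w, turns c - x.y into a pure dot product, so that monomials
   of exact degree p - 1 in n + 1 variables suffice. *)
pose u (a : T') (i : 'I_n.+1) : 'F_p :=
  oapp (fun i => (- x (val a) ord0 i)%:~R) c%:~R (unlift ord0 i).
pose w (a : T') (i : 'I_n.+1) : 'F_p :=
  oapp (fun i => (x (val a) ord0 i)%:~R) 1 (unlift ord0 i).
have uw a b : \sum_i u a i * w b i = (c - dot (val a) (val b))%:~R.
  rewrite big_ord_recl /u /w unlift_none /= mulr1 rmorphB /=; congr (_ + _).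
  rewrite /dot rmorph_sum -sumrN; apply: eq_bigr => i _ /=.
  by rewrite liftK /= -rmorphM mulNr rmorphN.
(* The first two terms are multiples of 2p, so p dividing c - x.y makes the squared distance 2pq;
   distinctness and the diameter bound give 0 < q <= m. *)
have DE a b : \sum_i (x a ord0 i - x b ord0 i) ^+ 2 =
    (\sum_i x a ord0 i ^+ 2 - c) + (\sum_i x b ord0 i ^+ 2 - c) + 2 * (c - dot a b).
  rewrite mulrBr /dot mulr_sumr.
  transitivity (\sum_i x a ord0 i ^+ 2 + \sum_i x b ord0 i ^+ 2 - \sum_i 2 * (x a ord0 i * x b ord0 i)).
    by rewrite -big_split -sumrB /=; apply: eq_bigr => i _; ring.
  by ring.
rewrite -card_sig; apply: (frankl_wilson pp (u := u) (w := w)).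
  move=> a; apply/eqP; rewrite uw intr_Fp_eq0 // -opprB rpredN.
  have -> : dot (val a) (val a) - c = \sum_i x (val a) ord0 i ^+ 2 - c.
    by congr (_ - _); apply: eq_bigr => i _; rewrite expr2.
  apply: dvdz_trans (xc _); rewrite PoszM; exact: dvdz_mull.
move=> a b ab; rewrite uw intr_Fp_eq0 //; apply/negP => pd.
have xab : x (val a) != x (val b).
  by apply: contra ab => /eqP/xinj/val_inj ->.
set D := \sum_i (x (val a) ord0 i - x (val b) ord0 i) ^+ 2.
have D0 : 0 < D.
  rewrite lt_neqAle sumr_ge0 ?andbT => [|i _]; last exact: sqr_ge0.
  apply: contra xab; rewrite eq_sym psumr_eq0 => [|i _]; last exact: sqr_ge0.
  move=> /allP h; apply/eqP/rowP => i; apply/eqP.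
  by rewrite -subr_eq0 -sqrf_eq0; apply: h; rewrite mem_index_enum.
have pD : ((2 * p)%:Z %| D)%Z.
  rewrite /D DE rpredD //; first by rewrite rpredD ?xc.
  by rewrite PoszM dvdz_mul.
have /dvdzP[q qE] := pD.
have p2 : 0 < (2 * p)%:Z by rewrite ltz_nat muln_gt0 p0.
have q0 : 0 < q by move: D0; rewrite qE pmulr_lgt0.
have qm : q < m.+1%:Z.
  have := xd (val a) (val b); rewrite -/D qE (mulnC (2 * p)%N) [ltRHS]PoszM.
  by rewrite ltr_pM2r.
case: q qE q0 qm => [[//|i]|//] qE _; rewrite ltz_nat ltnS => im.
apply: (colP (int_point (x (val a))) (int_point (x (val b)))).
  rewrite /distance_graph int_point_dist -/D qE; exists i => //.
  by congr Num.sqrt; rewrite -PoszM mulnC.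
have := valP a; have := valP b; rewrite !inE => /eqP -> /eqP ->.
by [].
Qed.

End LatticeFamilies.

(** * Lattice points in a ball *)

Section GaussianSums.
Variable R : realType.
Local Notation gint := (@gauss_integral_proof.integral0_gauss R).

Lemma gauss_integrable (a b : R) :
  lebesgue_measure.-integrable `[a, b] (EFin \o @gauss_fun R).
Proof.
apply: continuous_compact_integrable; first exact: segment_compact.
by apply: continuous_subspaceT; exact: continuous_gauss_fun.
Qed.

Lemma gint_increment (a b : R) : 0 <= a -> a <= b ->
  (b - a) * expR (- b ^+ 2) <= gint b - gint a <= (b - a) * expR (- a ^+ 2).
Proof.
move=> a0 ab; rewrite /gauss_integral_proof.integral0_gauss.
rewrite Rintegral_itvB ?bnd_simp //; last exact: gauss_integrable.
have mI : measurable `]a, b] by [].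
have sub : `]a, b] `<=` `[a, b]%classic by move=> x /=; rewrite !in_itv /= => /andP[/ltW -> ->].
have I1 : lebesgue_measure.-integrable `]a, b] (EFin \o @gauss_fun R).
  by apply: integrableS (gauss_integrable a b).
have muE : fine (lebesgue_measure (`]a, b]%classic : set R)) = b - a.
  rewrite lebesgue_measure_itv /= lte_fin; case: ltP => [_|ba]; first by rewrite -EFinB.
  by apply/eqP; rewrite eq_sym subr_eq0 eq_le ba ab.
have Ic (r : R) : lebesgue_measure.-integrable `]a, b] (EFin \o (fun _ => r)).
  have J : lebesgue_measure.-integrable `[a, b] (EFin \o (fun _ => r)).
    apply: continuous_compact_integrable; first exact: segment_compact.
    by apply: continuous_subspaceT => x; exact: cvg_cst.
  by apply: integrableS J.
have cst (r : R) : (b - a) * r = \int[lebesgue_measure]_(x in `]a, b]) r.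
  by rewrite Rintegral_cst // muE mulrC.
rewrite !cst; apply/andP; split; apply: le_Rintegral => //= x;
  rewrite in_itv /= /gauss_fun ler_expR lerN2 => /andP[ax xb].
  by rewrite ler_pXn2r ?nnegrE //; lra.
by rewrite ler_pXn2r ?nnegrE //; lra.
Qed.

Lemma gint_limit (tau : R) : 0 < tau -> exists2 S : R, 0 < S &
  forall x, S <= x -> `|2 * gint x - Num.sqrt pi| <= tau.
Proof.
move=> t0; have sp : 0 < Num.sqrt (pi : R) by rewrite sqrtr_gt0 pi_gt0.
pose e := tau * Num.sqrt pi / 4; have e0 : 0 < e by rewrite divr_gt0 ?mulr_gt0.
have /cvgrPdist_lt/(_ e e0) := @gauss_integral_proof.cvg_integral0_gauss_sqr R.
move=> [S [_ SP]]; exists (`|S| + 1); first by rewrite ltr_wpDl.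
move=> x Sx; have {SP} : `|pi / 4 - gint x ^+ 2| < e.
  by apply: SP; have := ler_norm S; lra.
have g0 := @gauss_integral_proof.integral0_gauss_ge0 R x.
have pE : pi = Num.sqrt pi ^+ 2 :> R by rewrite sqr_sqrtr ?pi_ge0.
have -> : pi / 4 - gint x ^+ 2 = - ((2 * gint x - Num.sqrt pi) * ((2 * gint x + Num.sqrt pi) / 4)).
  by rewrite [X in X / 4]pE; move: (Num.sqrt pi) (gint x) => s y; field.
rewrite normrN normrM [X in _ * X]ger0_norm; last by rewrite divr_ge0 // addr_ge0 ?mulr_ge0 // ltW.
move=> h; rewrite leNgt; apply/negP => tl; move: h; rewrite ltNge => /negP; apply.
rewrite /e -mulrA ler_pM //; first exact: ltW.
  exact: ltW.
by rewrite ler_wpM2r //; lra.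
Qed.

(** The Gaussian weight summed over -Q <= k < Q. The two halves are, after scaling, an upper and a
    lower Riemann sum of the half-line integral. *)
Definition gauss_sum (b : R) (M Q : nat) : R :=
  \sum_(k < Q) expR (- b * (k%:R / M%:R) ^+ 2) +
  \sum_(k < Q) expR (- b * (k.+1%:R / M%:R) ^+ 2).

(** With mesh d = sqrt b / M, the scaled halves enclose the integral up to Q d and differ by at most
    d; K makes the mesh fine and the range long. *)
Lemma gauss_sum_approx (b tau : R) : 0 < b -> 0 < tau ->
  exists2 K, (0 < K)%N & forall M Q, (K <= M)%N -> (K * M <= Q)%N ->
    `|gauss_sum b M Q / M%:R - Num.sqrt (pi / b)| <= tau.
Proof.
move=> b0 t0; have sb : 0 < Num.sqrt b by rewrite sqrtr_gt0.
pose t1 := tau * Num.sqrt b / 2; have t10 : 0 < t1 by rewrite divr_gt0 ?mulr_gt0.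
have [S S0 SP] := gint_limit t10.
have [K1 K10 K1P] := natr_unbounded (S / Num.sqrt b).
have [K2 K20 K2P] := natr_unbounded (Num.sqrt b / t1).
exists (maxn K1 K2); first by rewrite leq_max K10.
move=> M Q; rewrite geq_max => /andP[KM1 KM2] KQ.
have M0 : (0 < M)%N by exact: leq_trans KM1.
have MR : (0 : R) < M%:R by rewrite ltr0n.
pose d := Num.sqrt b / M%:R; have d0 : 0 < d by rewrite divr_gt0.
have dt : d <= t1.
  rewrite /d ler_pdivrMr // mulrC -ler_pdivrMr //; exact: K2P.
have E (x : R) : - b * (x / M%:R) ^+ 2 = - (x * d) ^+ 2.
  rewrite /d -{1}(sqr_sqrtr (ltW b0)) mulNr -exprMn; congr (- (_ ^+ 2)); ring.
have QS : S <= Q%:R * d.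
  have : K1%:R * M%:R <= Q%:R :> R.
    by rewrite -natrM ler_nat (leq_trans _ KQ) // leq_mul2r leq_maxl orbT.
  move=> h; apply: (@le_trans _ _ (K1%:R * M%:R * d)); last by rewrite ler_wpM2r // ltW.
  have -> : K1%:R * M%:R * d = K1%:R * Num.sqrt b by rewrite /d; field; rewrite gt_eqF.
  by rewrite -ler_pdivrMr //; exact: K1P.
have inc k : d * expR (- (k.+1%:R * d) ^+ 2) <= gint (k.+1%:R * d) - gint (k%:R * d) <=
    d * expR (- (k%:R * d) ^+ 2).
  have h : 0 <= k%:R * d by rewrite mulr_ge0 // ltW.
  have := @gint_increment (k%:R * d) (k.+1%:R * d) h.
  have -> : k.+1%:R * d - k%:R * d = d by rewrite -natr1; ring.
  by apply; rewrite ler_wpM2r ?ler_nat // ltW.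
have g0 : gint (0 * d) = 0.
  rewrite mul0r; apply/eqP; rewrite eq_le gauss_integral_proof.integral0_gauss_ge0 andbT.
  rewrite /gauss_integral_proof.integral0_gauss set_itv1 Rintegral_set1 //.
have tele : gint (Q%:R * d) = \sum_(k < Q) (gint (k.+1%:R * d) - gint (k%:R * d)).
  rewrite -(big_mkord xpredT (fun k => gint (k.+1%:R * d) - gint (k%:R * d))).
  by rewrite telescope_sumr // g0 subr0.
set A := \sum_(k < Q) expR (- b * (k%:R / M%:R) ^+ 2).
set B := \sum_(k < Q) expR (- b * (k.+1%:R / M%:R) ^+ 2).
have gA : gint (Q%:R * d) <= d * A.
  rewrite tele /A mulr_sumr; apply: ler_sum => k _; rewrite E.
  by have /andP[] := inc k.
have gB : d * B <= gint (Q%:R * d).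
  rewrite tele /B mulr_sumr; apply: ler_sum => k _; rewrite E.
  by have /andP[] := inc k.
have AB : A <= 1 + B.
  rewrite /A /B; case: (Q) => [|q]; first by rewrite !big_ord0; lra.
  rewrite big_ord_recl [X in _ <= _ + X]big_ord_recr /= mul0r expr0n mulr0 expR0 lerD2l.
  by rewrite lerDl expR_ge0.
have dAB : d * A <= d + d * B by rewrite -{2}[d]mulr1 -mulrDr ler_pM2l.
have := SP _ QS; rewrite ler_norml => /andP[s1 s2].
have sE : Num.sqrt (pi / b) * Num.sqrt b = Num.sqrt pi :> R.
  by rewrite sqrtrM ?pi_ge0 // sqrtrV ?(ltW b0) // divfK ?gt_eqF.
have zE : gauss_sum b M Q / M%:R * Num.sqrt b = d * A + d * B.
  by rewrite /gauss_sum -/A -/B /d; ring.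
have tE : t1 + t1 = tau * Num.sqrt b by rewrite /t1; field.
rewrite -(ler_pM2r sb) -[X in _ * X <= _](gtr0_norm sb) -normrM mulrBl zE sE.
by rewrite ler_norml; apply/andP; split; lra.
Qed.

End GaussianSums.

(** * Counting lattice points by exponential tilting *)

Section LatticeCount.
Variable R : realType.

Lemma exists_large_fibre (Y C : finType) (A : {set Y}) (f : Y -> C) : (0 < #|A|)%N ->
  exists c, (#|A| <= #|[set y in A | f y == c]%SET| * #|C|)%N.
Proof.
move=> A0; apply: contrapT => /forallNP H.
have : (#|A| * #|C| < #|A| * #|C|)%N; last by rewrite ltnn.
have C0 : (0 < #|C|)%N.
  by case/card_gt0P: A0 => y _; apply/card_gt0P; exists (f y).
have fib : #|A| = (\sum_c #|[set y in A | f y == c]%SET|)%N.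
  rewrite -sum1_card (partition_big f xpredT) //=; apply: eq_bigr => c _.
  by rewrite -sum1_card; apply: eq_bigl => y; rewrite inE.
rewrite {1}fib big_distrl /= mulnC -sum_nat_const.
have lt c : (#|[set y in A | f y == c]%SET| * #|C| < #|A|)%N by rewrite ltnNge; apply/negP/H.
have /card_gt0P[c0 _] := C0.
rewrite (bigD1 c0) //= [ltnRHS](bigD1 c0) //= -addSn leq_add //.
by apply: leq_sum => c _; exact: ltnW.
Qed.

Definition tilted_sum (I : finType) (g : I -> R) (b : R) : R := \sum_i expR (- b * g i).

(* Exponential tilting: e^(-beta G(y)) is dominated by its two Chernoff bounds
   unless n v1 <= G(y) <= n v2. *)
Lemma chernoff_count (I : finType) (g : I -> R) (n : nat) (beta lambda v1 v2 : R) :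
  0 <= beta -> 0 <= lambda ->
  expR (n%:R * (beta * v1)) * (tilted_sum g beta ^+ n
     - (tilted_sum g (beta - lambda) * expR (- (lambda * v2))) ^+ n
     - (tilted_sum g (beta + lambda) * expR (lambda * v1)) ^+ n) <=
  #|[set y : {ffun 'I_n -> I} | \sum_i g (y i) <= n%:R * v2]%SET|%:R.
Proof.
move=> b0 l0; pose G (y : {ffun 'I_n -> I}) := \sum_i g (y i).
have ZE b : tilted_sum g b ^+ n = \sum_(y : {ffun 'I_n -> I}) expR (- b * G y).
  rewrite /tilted_sum -[n in LHS]card_ord -prodr_const bigA_distr_bigA /=.
  by apply: eq_bigr => y _; rewrite /G mulr_sumr expR_sum.
rewrite !exprMn !ZE -!expRM_natl.
set S := [set y | _]%SET.
rewrite -ler_pdivlMl ?expR_gt0 // -expRN.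
rewrite !mulr_suml lerBlDr lerBlDr.
apply: (@le_trans _ _ (\sum_(y : {ffun 'I_n -> I})
  ((if y \in S then expR (- (n%:R * (beta * v1))) else 0) +
   expR (- (beta - lambda) * G y) * expR (n%:R * - (lambda * v2)) +
   expR (- (beta + lambda) * G y) * expR (n%:R * (lambda * v1))))).
  apply: ler_sum => y _; rewrite -!expRD inE -/(G y).
  have [Gv2|Gv2] := leP (G y) (n%:R * v2).
    have [Gv1|Gv1] := leP (n%:R * v1) (G y).
      apply: (@le_trans _ _ (expR (- (n%:R * (beta * v1))))).
        by rewrite ler_expR mulNr lerN2 mulrCA ler_wpM2l.
      by rewrite -addrA lerDl addr_ge0 ?expR_ge0.
    apply: (@le_trans _ _ (expR (- (beta + lambda) * G y + n%:R * (lambda * v1)))).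
      rewrite ler_expR mulrCA; have : lambda * G y <= lambda * (n%:R * v1) by rewrite ler_wpM2l // ltW.
      by lra.
    by rewrite lerDr addr_ge0 ?expR_ge0.
  apply: (@le_trans _ _ (expR (- (beta - lambda) * G y + n%:R * - (lambda * v2)))).
    rewrite ler_expR mulrN mulrCA.
    have : lambda * (n%:R * v2) <= lambda * G y by rewrite ler_wpM2l // ltW.
    by lra.
  by rewrite add0r lerDl expR_ge0.
rewrite !big_split /= -big_mkcond sumr_const /= -[X in X + _ + _]mulr_natr.
by rewrite addrAC.
Qed.

Lemma expr_eventually_le (r e : R) : 0 <= r < 1 -> 0 < e ->
  exists N, forall n, (N <= n)%N -> r ^+ n <= e.
Proof.
move=> /andP[r0 r1] e0.
have /cvgrPdist_le/(_ e e0)[N _ NP] : (GRing.exp r : R^nat) @ \oo --> 0.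
  by apply: cvg_expr; rewrite ger0_norm.
exists N => n Nn; have := NP n Nn.
by rewrite /= sub0r normrN ger0_norm // exprn_ge0.
Qed.

Definition grid_value (Q : nat) (i : bool * 'I_Q) : int :=
  if i.1 then Posz i.2 else Negz i.2.

Definition grid_square (M Q : nat) (i : bool * 'I_Q) : R :=
  ((grid_value i)%:~R / M%:R) ^+ 2.

Lemma grid_value_inj Q : injective (@grid_value Q).
Proof.
move=> [[] i] [[] j] //; rewrite /grid_value /= => -[ij]; by rewrite (val_inj ij).
Qed.

Lemma tilted_sum_grid (M Q : nat) (b : R) :
  tilted_sum (@grid_square M Q) b = gauss_sum b M Q.
Proof.
rewrite /tilted_sum -(pair_bigA _ (fun s k => expR (- b * grid_square M (s, k)))) /=.
rewrite big_bool /gauss_sum; congr (_ + _); apply: eq_bigr => k _.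
rewrite /grid_square /grid_value /= NegzE rmorphN; congr (expR (_ * _)).
by rewrite mulNr sqrrN.
Qed.

(** The value v = 1/(2 beta) is the mean of the square under the Gaussian weight, so the terms of
    first order in u = lambda/beta cancel. The term 2 u^2 left over is absorbed by lambda * eps, and
    both Chernoff terms become exponentially small. *)
Lemma sqrt_ratio_tilt (beta lambda eps : R) : 0 < beta -> 0 < lambda -> lambda <= beta / 2 ->
  2 * (lambda / beta) ^+ 2 <= lambda * eps ->
  let v := (2 * beta)^-1 in
  Num.sqrt (pi / (beta - lambda)) * expR (- (lambda * (v + eps))) <=
    Num.sqrt (pi / beta) * expR (- (lambda * eps / 2)) /\
  Num.sqrt (pi / (beta + lambda)) * expR (lambda * (v - eps)) <=
    Num.sqrt (pi / beta) * expR (- (lambda * eps / 2)).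
Proof.
move=> b0 l0 lb leps v; pose u := lambda / beta.
have u0 : 0 < u by rewrite divr_gt0.
have u2 : u <= 1 / 2 by rewrite /u ler_pdivrMr //; lra.
have lE : lambda = u * beta by rewrite /u divfK // gt_eqF.
have lv : lambda * v = u / 2 by rewrite /v lE invfM; field; rewrite gt_eqF.
have sqrtexp (x : R) : expR x = Num.sqrt (expR (2 * x)).
  by rewrite (expRM_natl 2) sqrtr_sqr ger0_norm // expR_ge0.
have pi0 := @pi_gt0 R.
have cmp (x y a b : R) : 0 < x -> 0 < y -> x^-1 * expR (2 * a) <= y^-1 * expR (2 * b) ->
    Num.sqrt (pi / x) * expR a <= Num.sqrt (pi / y) * expR b.
  move=> x0 y0 h; rewrite (sqrtexp a) (sqrtexp b) -!sqrtrM; last 2 first.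
    by rewrite divr_ge0 ?ltW.
    by rewrite divr_ge0 ?ltW.
  by rewrite ler_wsqrtr // -!mulrA ler_pM2l.
rewrite -/u in leps; split; apply: cmp => //; try by [lra].
  have -> : (beta - lambda)^-1 = beta^-1 * (1 - u)^-1.
    by rewrite -invfM lE; congr (_^-1); ring.
  rewrite -mulrA ler_pM2l ?invr_gt0 // mulrC.
  apply: (@le_trans _ _ (expR (2 * - (lambda * (v + eps))) * expR (u + 2 * u ^+ 2))).
    rewrite ler_wpM2l ?expR_ge0 //; apply: le_trans (expR_ge1Dx _).
    rewrite -[_^-1]mul1r ler_pdivrMr; last by lra.
    have : 0 <= u ^+ 2 * (1 - 2 * u) by rewrite mulr_ge0 ?sqr_ge0 //; lra.
    by lra.
  by rewrite -expRD ler_expR; lra.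
have -> : (beta + lambda)^-1 = beta^-1 * (1 + u)^-1.
  by rewrite -invfM lE; congr (_^-1); ring.
rewrite -mulrA ler_pM2l ?invr_gt0 // mulrC.
apply: (@le_trans _ _ (expR (2 * (lambda * (v - eps))) * expR (- u + 2 * u ^+ 2))).
  rewrite ler_wpM2l ?expR_ge0 //; apply: le_trans (expR_ge1Dx _).
  rewrite -[_^-1]mul1r ler_pdivrMr; last by lra.
  have : 0 <= u ^+ 2 by exact: sqr_ge0.
  have : 0 <= u ^+ 3 by rewrite exprn_ge0 // ltW.
  by lra.
by rewrite -expRD ler_expR; lra.
Qed.

(** The threshold sqrt(2 pi v) e^(1/2) is the limit of the n-th root of the volume of the ball of
    squared radius n v; M^n is the density of the grid. *)
Lemma grid_count (v L rho : R) : 0 < v -> 0 < L ->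
  L < Num.sqrt (2 * pi * v) * expR (1 / 2) -> v < rho ->
  exists M Q N, (0 < M)%N /\ forall n, (N <= n)%N -> (L * M%:R) ^+ n <=
    #|[set y : {ffun 'I_n -> bool * 'I_Q} | \sum_i grid_square M (y i) <= n%:R * rho]%SET|%:R.
Proof.
move=> v0 L0 LE vrho; pose beta := (2 * v)^-1; have b0 : 0 < beta by rewrite invr_gt0 mulr_gt0.
have vE : (2 * beta)^-1 = v by rewrite /beta invfM invrK; field.
have bv : beta * v = 1 / 2 by rewrite /beta invfM; field; rewrite gt_eqF.
have pib : pi / beta = 2 * pi * v by rewrite /beta invrK; ring.
pose Z0 := Num.sqrt (pi / beta).
have Z00 : 0 < Z0 by rewrite sqrtr_gt0 divr_gt0 ?pi_gt0.
pose E := Z0 * expR (1 / 2); rewrite -pib -/Z0 -/E in LE.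
have E0 : 0 < E by rewrite mulr_gt0 ?expR_gt0.
(* The first bound keeps v + eps below rho; the second limits the loss from e^(- beta eps) to half
   of the gap E - L. *)
pose eps := Num.min (rho - v) (v * ((E - L) / E)).
have e0 : 0 < eps by rewrite lt_min subr_gt0 vrho mulr_gt0 ?divr_gt0 ?subr_gt0.
have e1 : eps <= rho - v by rewrite ge_min lexx.
have e2 : eps <= v * ((E - L) / E) by rewrite ge_min lexx orbT.
pose lambda := Num.min (beta / 2) (beta ^+ 2 * eps / 2).
have l0 : 0 < lambda by rewrite lt_min !divr_gt0 ?mulr_gt0 ?exprn_gt0.
have l1 : lambda <= beta / 2 by rewrite ge_min lexx.
have l2 : lambda <= beta ^+ 2 * eps / 2 by rewrite ge_min lexx orbT.
have l3 : 2 * (lambda / beta) ^+ 2 <= lambda * eps.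
  rewrite expr_div_n [(lambda ^+ 2)]expr2 mulrA ler_pdivrMr ?exprn_gt0 //.
  have := ler_wpM2l (ltW l0) l2; lra.
have [tm tp] := sqrt_ratio_tilt b0 l0 l1 l3; rewrite vE -/Z0 in tm tp.
set r0 := expR (- (lambda * eps / 2)) in tm tp.
have r00 : 0 < r0 by exact: expR_gt0.
have r01 : r0 < 1 by rewrite expR_lt1 oppr_lt0 divr_gt0 ?mulr_gt0.
pose W := expR (lambda * v); have W0 : 0 < W by exact: expR_gt0.
(* The Riemann sum error must leave both Chernoff ratios below [r1] = (1 + r0)/2, and cost the main
   term at most a quarter of the gap E - L. *)
pose tau := Num.min (Z0 * (1 - r0) / (2 * (W + 1))) ((E - L) / (4 * expR (1 / 2))).
have t0 : 0 < tau.
  rewrite lt_min !divr_gt0 ?mulr_gt0 ?subr_gt0 ?expR_gt0 //; lra.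
have t1 : tau * (2 * (W + 1)) <= Z0 * (1 - r0).
  by rewrite -ler_pdivlMr ?ge_min ?lexx // mulr_gt0 //; lra.
have t2 : tau * (4 * expR (1 / 2)) <= E - L.
  by rewrite -ler_pdivlMr ?ge_min ?lexx ?orbT // mulr_gt0 // expR_gt0.
have [K1 K10 K1P] := gauss_sum_approx b0 t0.
have bl0 : 0 < beta - lambda by lra.
have [K2 K20 K2P] := gauss_sum_approx bl0 t0.
have bl1 : 0 < beta + lambda by lra.
have [K3 K30 K3P] := gauss_sum_approx bl1 t0.
(* The grid Z/M is cut off at Q/M = M, so one parameter controls mesh and range. *)
pose M := maxn (maxn K1 K2) K3; pose Q := (M * M)%N.
have [M1 [M2 M3]] : (K1 <= M)%N /\ (K2 <= M)%N /\ (K3 <= M)%N by rewrite !leq_max !leqnn !orbT.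
have M0 : (0 < M)%N by exact: leq_trans M1.
have MR : (0 : R) < M%:R by rewrite ltr0n.
have KQ K : (K <= M)%N -> (K * M <= Q)%N by move=> KM; rewrite leq_mul2r KM orbT.
have := K1P M Q M1 (KQ _ M1); rewrite ler_norml -/Z0 => /andP[z1 _].
have := K2P M Q M2 (KQ _ M2); rewrite ler_norml => /andP[_ z2].
have := K3P M Q M3 (KQ _ M3); rewrite ler_norml => /andP[_ z3].
set z0 := gauss_sum beta M Q / M%:R in z1.
set zm := gauss_sum (beta - lambda) M Q / M%:R in z2.
set zp := gauss_sum (beta + lambda) M Q / M%:R in z3.
pose r1 := (1 + r0) / 2.
have z00 : Z0 - tau <= z0 by lra.
have Zt : r0 * Z0 + tau * W <= r1 * (Z0 - tau).
  have : r1 * tau <= 1 * tau by rewrite ler_wpM2r //; rewrite /r1; lra.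
  by rewrite /r1 in t1 *; lra.
have tW : 0 <= tau * W by rewrite mulr_ge0 // ltW.
have Zt0 : 0 < Z0 - tau.
  have : 0 < r1 * (Z0 - tau) by apply: lt_le_trans Zt; rewrite ltr_wpDr // mulr_gt0.
  by rewrite pmulr_rgt0 // /r1; lra.
have r10 : 0 < r1 by rewrite /r1; lra.
have r1z : r1 * (Z0 - tau) <= r1 * z0 by rewrite ler_pM2l.
have W1 : 1 <= W by rewrite -expR0 ler_expR mulr_ge0 // ltW.
have bm : zm * expR (- (lambda * (v + eps))) <= r1 * z0.
  have em : expR (- (lambda * (v + eps))) <= 1.
    by rewrite expR_le1 oppr_le0 mulr_ge0 ?addr_ge0 // ltW.
  have h1 : zm * expR (- (lambda * (v + eps))) <=
     (Num.sqrt (pi / (beta - lambda)) + tau) * expR (- (lambda * (v + eps))).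
    by rewrite ler_wpM2r ?expR_ge0 //; lra.
  have h2 : tau * expR (- (lambda * (v + eps))) <= tau * W by rewrite ler_pM2l //; lra.
  by lra.
have bp : zp * expR (lambda * (v - eps)) <= r1 * z0.
  have ep : expR (lambda * (v - eps)) <= W.
    by rewrite ler_expR ler_pM2l //; lra.
  have h1 : zp * expR (lambda * (v - eps)) <=
     (Num.sqrt (pi / (beta + lambda)) + tau) * expR (lambda * (v - eps)).
    by rewrite ler_wpM2r ?expR_ge0 //; lra.
  have h2 : tau * expR (lambda * (v - eps)) <= tau * W by rewrite ler_pM2l.
  by lra.
pose X := expR (beta * (v - eps)) * z0.
have LX : L < X.
  have x1 : expR (beta * (v - eps)) * (Z0 - tau) <= X by rewrite ler_pM2l // expR_gt0.
  have be0 : 0 < beta * eps by rewrite mulr_gt0.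
  have x2 : expR (beta * (v - eps)) <= expR (1 / 2) by rewrite ler_expR mulrBr bv; lra.
  have x3 : expR (beta * (v - eps)) * tau <= expR (1 / 2) * tau by rewrite ler_pM2r.
  have x4 : E * (1 - beta * eps) <= expR (beta * (v - eps)) * Z0.
    have -> : expR (beta * (v - eps)) = expR (1 / 2) * expR (- (beta * eps)).
      by rewrite -expRD mulrBr bv.
    have h : Z0 * expR (1 / 2) * (1 - beta * eps) <= Z0 * expR (1 / 2) * expR (- (beta * eps)).
      by rewrite ler_pM2l //; exact: expR_ge1Dx.
    by rewrite /E; lra.
  have x5 : beta * eps * (2 * E) <= E - L.
    rewrite -ler_pdivlMr ?mulr_gt0 //; apply: (le_trans (ler_wpM2l (ltW b0) e2)).
    by rewrite mulrA bv le_eqVlt; apply/orP; left; apply/eqP; field; rewrite gt_eqF.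
  by clear -x1 x3 x4 x5 t2 LE; lra.
have X0 : 0 < X by exact: lt_trans LX.
have r1b : 0 <= r1 < 1 by apply/andP; split; rewrite /r1; lra.
(* Each Chernoff term takes at most a quarter of the main term; the remaining factor 1/2 is absorbed
   by (L/X)^n <= 1/2. *)
have [N1 N1P] := @expr_eventually_le r1 (1 / 4) r1b ltac:(lra).
have LXb : 0 <= L / X < 1 by rewrite divr_ge0 ?ltW // ltr_pdivrMr // mul1r.
have [N2 N2P] := @expr_eventually_le (L / X) (1 / 2) LXb ltac:(lra).
exists M, Q, (maxn N1 N2); split => // n; rewrite geq_max => /andP[n1 n2].
have cc := chernoff_count (@grid_square M Q) n (v - eps) (v + eps) (ltW b0) (ltW l0).
rewrite !tilted_sum_grid in cc.
have zE (b : R) : gauss_sum b M Q = gauss_sum b M Q / M%:R * M%:R.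
  by rewrite divfK ?(gt_eqF MR).
rewrite (zE beta) (zE (beta - lambda)) (zE (beta + lambda)) -/z0 -/zm -/zp in cc.
have z0p : 0 < z0 by lra.
have g0 (b : R) : 0 <= gauss_sum b M Q / M%:R.
  by rewrite divr_ge0 // addr_ge0 // sumr_ge0 // => k _; rewrite expR_ge0.
have z0n : 0 <= (z0 * M%:R) ^+ n by rewrite exprn_ge0 // mulr_ge0 // ltW.
have small (x : R) : 0 <= x -> x <= r1 * z0 -> (x * M%:R) ^+ n <= 1 / 4 * (z0 * M%:R) ^+ n.
  move=> x0 xr; apply: (@le_trans _ _ ((r1 * z0 * M%:R) ^+ n)).
    have m1 : 0 <= x * M%:R by rewrite mulr_ge0.
    have m2 : x * M%:R <= r1 * z0 * M%:R by rewrite ler_wpM2r // ltW.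
    by rewrite lerXn2r // nnegrE // (le_trans m1).
  rewrite -mulrA exprMn ler_wpM2r //; exact: N1P.
have sm := small _ (mulr_ge0 (g0 (beta - lambda)) (expR_ge0 _)) bm.
have sp := small _ (mulr_ge0 (g0 (beta + lambda)) (expR_ge0 _)) bp.
apply: (@le_trans _ _ #|[set y : {ffun 'I_n -> bool * 'I_Q} |
    \sum_i grid_square M (y i) <= n%:R * (v + eps)]%SET|%:R); last first.
  rewrite ler_nat; apply: subset_leq_card; apply/fintype.subsetP => y; rewrite !inE => h.
  by apply: (le_trans h); rewrite ler_wpM2l //; lra.
apply: le_trans cc; rewrite expRM_natl.
apply: (@le_trans _ _ (expR (beta * (v - eps)) ^+ n * (1 / 2 * (z0 * M%:R) ^+ n))); last first.
  rewrite ler_wpM2l ?exprn_ge0 ?expR_ge0 //.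
  rewrite [_ * M%:R * expR (- _)]mulrAC [_ * M%:R * expR _]mulrAC.
  move: sm sp; rewrite -/zm -/zp; set A := (zm * _ * _) ^+ n; set B := (zp * _ * _) ^+ n.
  set C := (_ ^+ n); clear; lra.
have -> : expR (beta * (v - eps)) ^+ n * (1 / 2 * (z0 * M%:R) ^+ n) = 1 / 2 * (X * M%:R) ^+ n.
  by rewrite mulrCA -exprMn mulrA.
have := N2P n n2; rewrite expr_div_n ler_pdivrMr ?exprn_gt0 // => LXn.
by rewrite (exprMn _ L) (exprMn _ X) mulrA ler_wpM2r // exprn_ge0.
Qed.

(** Pigeonhole on the residues modulo M, which costs the factor M^n of [grid_count], and on the
    squared norm modulo 2p. With equal residues, differences of the integer quotients are
    differences of grid points, whence the diameter bound from (s - t)^2 <= 2 s^2 + 2 t^2. The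
    threshold N is independent of p, so p may vary with n. *)
Lemma lattice_count (v L rho : R) : 0 < v -> 0 < L ->
  L < Num.sqrt (2 * pi * v) * expR (1 / 2) -> v < rho ->
  exists N, forall n p, (N <= n)%N -> (0 < p)%N ->
  exists (T : finType) (x : T -> 'rV[int]_n) (c : int),
  [/\ injective x, forall a, ((2 * p)%:Z %| \sum_i x a ord0 i ^+ 2 - c)%Z,
     forall a b, (\sum_i (x a ord0 i - x b ord0 i) ^+ 2)%:~R <= 4 * n%:R * rho :> R &
     L ^+ n <= (2 * p * #|T|)%:R].
Proof.
move=> v0 L0 LE vrho; have [M [Q [N [M0 NP]]]] := grid_count v0 L0 LE vrho.
exists N => n p Nn p0; have {NP} := NP n Nn; set A := [set y | _]%SET => cA.
have MR : (0 : R) < M%:R by rewrite ltr0n.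
have A0 : (0 < #|A|)%N.
  by rewrite -(ltr0n R); apply: lt_le_trans cA; rewrite exprn_gt0 // mulr_gt0.
have AP y : y \in A -> \sum_i grid_square M (y i) <= n%:R * rho by rewrite inE.
case: M M0 A AP cA A0 MR => // M _ A AP cA A0 MR.
case: p p0 => // p _.
pose X (y : {ffun 'I_n -> bool * 'I_Q}) : 'rV[int]_n := \row_i (grid_value (y i) %/ M.+1)%Z.
pose f (y : {ffun 'I_n -> bool * 'I_Q}) : {ffun 'I_n -> 'I_M.+1} * 'I_(2 * p.+1).-1.+1 :=
  ([ffun i => inord `|(grid_value (y i) %% M.+1)%Z|%N],
   inord `|((\sum_i X y ord0 i ^+ 2)%R %% (2 * p.+1)%:Z)%Z|%N).
have [c cP] := exists_large_fibre f A0.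
pose T := {y | y \in [set y in A | f y == c]%SET}.
have inB (k : nat) (z : int) : (inord `|(z %% k.+1)%Z|%N : 'I_k.+1) = `|(z %% k.+1)%Z|%N :> nat.
  by rewrite inordK // -ltz_nat gez0_abs ?modz_ge0 // ltz_pmod.
have TP (a : T) : (val a \in A) /\ f (val a) = c.
  by have := valP a; rewrite inE => /andP[h /eqP].
have mE (a b : T) i : (grid_value (val a i) %% M.+1 = grid_value (val b i) %% M.+1)%Z.
  have [_ fa] := TP a; have [_ fb] := TP b.
  have : f (val a) = f (val b) by exact: etrans fa (esym fb).
  move=> /(congr1 fst) /= /ffunP /(_ i); rewrite !ffunE.
  by move=> /(congr1 val) /=; rewrite !inB => /(congr1 Posz); rewrite !gez0_abs ?modz_ge0.
have XE (y : {ffun 'I_n -> bool * 'I_Q}) i :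
    grid_value (y i) = X y ord0 i * M.+1 + (grid_value (y i) %% M.+1)%Z.
  by rewrite mxE -divz_eq.
exists T, (fun a => X (val a)), (c.2 : nat)%:Z; split.
- move=> a b /rowP ab; apply/val_inj/ffunP => i; apply: (@grid_value_inj Q).
  by rewrite (XE (val a)) (XE (val b)) ab (mE a b).
- move=> a; have [_ fa] := TP a.
  have -> : (c.2 : nat)%:Z = ((\sum_i X (val a) ord0 i ^+ 2)%R %% (2 * p.+1)%:Z)%Z.
    have <- : (f (val a)).2 = c.2 by rewrite fa.
    by rewrite /f /= inB gez0_abs // modz_ge0.
  by rewrite -eqz_mod_dvd modz_mod.
- move=> a b; have [aA _] := TP a; have [bA _] := TP b.
  move: (AP _ aA) (AP _ bA) => {}aA {}bA.
  have -> : 4 * n%:R * rho = 2 * (n%:R * rho) + 2 * (n%:R * rho) by ring.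
  apply: le_trans (lerD (ler_wpM2l _ aA) (ler_wpM2l _ bA)); rewrite // rmorph_sum.
  rewrite !mulr_sumr -big_split; apply: ler_sum => i _.
  have key : (X (val a) ord0 i - X (val b) ord0 i)%:~R =
      (grid_value (val a i))%:~R / M.+1%:R - (grid_value (val b i))%:~R / M.+1%:R :> R.
    rewrite -mulrBl -rmorphB (XE (val a)) (XE (val b)) (mE a b) opprD addrACA subrr addr0 -mulrBl.
    by rewrite rmorphM /= mulfK // gt_eqF.
  rewrite rmorphXn /= key /grid_square; set s := _ / _; set t := _ / _.
  by have := sqr_ge0 (s + t); lra.
rewrite -(ler_pM2r (exprn_gt0 n MR)) -exprMn; apply: (le_trans cA).
rewrite -natrX -natrM ler_nat; apply: (leq_trans cP).
rewrite card_prod card_ffun !card_ord card_sig mulnCA mulnA mulnC mulnA.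
have -> : #|[pred y in [set y in A | f y == c]%SET]| = #|[set y in A | f y == c]%SET|.
  by apply: eq_card => y; rewrite inE.
by rewrite [leqLHS]mulnAC; exact: leqnn.
Qed.

End LatticeCount.

(** * The asymptotic lower bound *)

Section Assembly.
Variable R : realType.

(** Split r into two equal factors e^(-l/2): one power bounds n by 2/l, the other tends to 0. *)
Lemma linear_expr_eventually_le (r e : R) : 0 < r < 1 -> 0 < e ->
  exists N, forall n, (N <= n)%N -> n%:R * r ^+ n <= e.
Proof.
move=> /andP[r0 r1] e0; pose l := - ln r.
have l0 : 0 < l by rewrite oppr_gt0 ln_lt0 // r0.
have l20 : 0 < l / 2 by rewrite divr_gt0.
have rE : r = expR (- (l / 2)) * expR (- (l / 2)).
  by rewrite -expRD (_ : - (l / 2) + - (l / 2) = ln r) ?lnK ?posrE // /l; lra.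
have q1 : 0 <= expR (- (l / 2)) < 1 by rewrite expR_ge0 expR_lt1 oppr_lt0.
have el0 : 0 < e * (l / 2) by rewrite mulr_gt0.
have [N NP] := expr_eventually_le q1 el0.
exists N => n Nn; rewrite {1}rE exprMn mulrA.
have h : n%:R * expR (- (l / 2)) ^+ n <= (l / 2)^-1.
  rewrite -expRM_natl mulrN expRN ler_pdivrMr ?expR_gt0 // mulrC -ler_pdivrMr ?invr_gt0 // invrK.
  by apply: le_trans (expR_ge1Dx _); lra.
apply: (le_trans (ler_wpM2r _ h)); first by rewrite exprn_ge0 // expR_ge0.
by rewrite mulrC ler_pdivrMr //; exact: NP.
Qed.

Lemma m_distance_lower_bound (m : nat) (x D : R) : 0 < x -> 0 < D ->
  D < Num.sqrt (pi / 2) * Gamma_profile x * Num.sqrt (m%:R + 1) ->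
  exists N, forall n, (N <= n)%N -> ((D ^+ n)%:E <= m_distance_chromatic_number R n m)%E.
Proof.
move=> x0 D0 DG; set G := _ * _ * _ in DG.
have G0 : 0 < G by exact: lt_trans DG.
pose t := expR (- x); have t0 : 0 < t by exact: expR_gt0.
have t1 : t < 1 by rewrite expR_lt1 oppr_lt0.
(* The prime will lie just above alpha * n; since alpha * x = 1/2, the monomial factor e^(x p) is
   about e^(n/2) and cancels the e^(1/2) in [W]. *)
pose alpha := (2 * x)^-1; have al0 : 0 < alpha by rewrite invr_gt0 mulr_gt0.
have m1 : 0 < m%:R + 1 :> R by rewrite ltr_wpDl.
(* Chosen so that the squared diameter 4 n rho = 2 alpha n (m + 1) is below 2 p (m + 1) as soon as p
   > alpha * n. *)
pose rho := (m%:R + 1) * alpha / 2; have rho0 : 0 < rho by rewrite divr_gt0 ?mulr_gt0.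
pose W := Num.sqrt (2 * pi * rho) * expR (1 / 2).
have W0 : 0 < W by rewrite mulr_gt0 ?expR_gt0 // sqrtr_gt0 !mulr_gt0 ?pi_gt0.
have WG : W * expR (- (1 / 2)) * (1 - t) = G.
  rewrite /W -mulrA -mulrA [X in _ * X]mulrA -expRD subrr expR0 mul1r.
  rewrite /G /Gamma_profile -/t.
  have -> : 2 * pi * rho = pi / 2 * (m%:R + 1) * x^-1.
    by rewrite /rho /alpha invfM; field; rewrite gt_eqF.
  rewrite !sqrtrM ?mulr_ge0 ?divr_ge0 ?pi_ge0 ?(ltW m1) // (sqrtrV (ltW x0)).
  by ring.
(* D/G = 1 - 4a lies below (1 - a)^3. The three factors 1 - a pay for shrinking rho to v, for the
   strict inequality on [L], and for the overshoot of the prime. *)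
pose a := (1 - D / G) / 4; have DG1 : D / G < 1 by rewrite ltr_pdivrMr // mul1r.
have DG0 : 0 < D / G by rewrite divr_gt0.
have a0 : 0 < a by rewrite /a; lra.
have a1 : a < 1 / 4 by rewrite /a; lra.
pose th := 1 - a; have th0 : 0 < th by rewrite /th; lra.
have th1 : th < 1 by rewrite /th; lra.
have th3 : D / G < th ^+ 3.
  have : 0 <= a ^+ 2 * (3 - a) by rewrite mulr_ge0 ?sqr_ge0 //; lra.
  have -> : D / G = 1 - 4 * a by rewrite /a; field; rewrite gt_eqF.
  by rewrite /th => h; nra.
have [s0 _ s0P] := natr_unbounded (1 / (2 * a)).
pose s := maxn s0 10.
have s10 : (10 <= s)%N by exact: leq_maxr.
have sR : (0 : R) < s%:R by rewrite ltr0n (leq_trans _ s10).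
have sa : 1 / (2 * a) <= s%:R by apply: s0P; exact: leq_maxl.
have es : th <= expR (- (2 * s%:R)^-1).
  apply: le_trans (expR_ge1Dx _); rewrite /th lerD2l lerN2.
  by rewrite -[_^-1]div1r ler_pdivrMr ?mulr_gt0 // mulrCA -ler_pdivrMl // mulrC -ler_pdivrMr //;
     move: sa; rewrite ler_pdivrMr ?mulr_gt0 // ler_pdivrMr // ; lra.
have [N1 N1P] := prime_in_short_interval R s10.
pose v := rho * th ^+ 2; have v0 : 0 < v by rewrite mulr_gt0 ?exprn_gt0.
have th2 : th ^+ 2 < 1 by rewrite expr_lt1 // ltW.
have vrho : v < rho by rewrite /v gtr_pMr.
pose L := th ^+ 2 * W; have L0 : 0 < L by rewrite mulr_gt0 ?exprn_gt0.
have LW : L < Num.sqrt (2 * pi * v) * expR (1 / 2).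
  have -> : Num.sqrt (2 * pi * v) * expR (1 / 2) = th * W.
    rewrite /v mulrA sqrtrM; last by rewrite !mulr_ge0 ?pi_ge0 // ltW.
    by rewrite sqrtr_sqr (gtr0_norm th0) /W; ring.
  by rewrite /L expr2 -mulrA gtr_pMl // mulr_gt0.
have [N2 N2P] := lattice_count v0 L0 LW vrho.
pose Y := L * expR (- (1 / 2)) * expR (- (2 * s%:R)^-1) * (1 - t).
have DY : D < Y.
  have : D < th ^+ 3 * G by rewrite -ltr_pdivrMr.
  move=> h; apply: (lt_le_trans h).
  have -> : th ^+ 3 * G = L * expR (- (1 / 2)) * th * (1 - t) by rewrite -WG /L; ring.
  by rewrite /Y ler_pM2r ?subr_gt0 // ler_pM2l // mulr_gt0 // expR_gt0.
have Y0 : 0 < Y by exact: lt_trans DY.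
have DYb : 0 < D / Y < 1 by rewrite divr_gt0 // ltr_pdivrMr // mul1r.
(* The pigeonhole modulo 2p and the doubling of the monomial count leave a factor 4p <= 8 alpha n;
   the power (D/Y)^n has to absorb it. *)
have k0 : 0 < (1 - t) / (8 * alpha) by rewrite divr_gt0 ?subr_gt0 // mulr_gt0.
have [N3 N3P] := linear_expr_eventually_le DYb k0.
have [N4 N40 N4P] := natr_unbounded ((N1%:R + 1) / alpha).
exists (maxn (maxn N2 N3) N4) => n; rewrite !geq_max -andbA => /and3P[n2 n3 n4].
have nR : (0 : R) < n%:R by rewrite ltr0n (leq_trans N40).
have an0 : 0 <= alpha * n%:R by rewrite mulr_ge0 // ltW.
pose N := Num.truncn (alpha * n%:R).
have /andP[Na Na1] := truncn_itv an0; rewrite -/N in Na Na1.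
have N1N : (N1 <= N)%N.
  rewrite truncn_ge_nat //; have := N4P n n4; rewrite ler_pdivrMr // mulrC; lra.
have [p pp /andP[Np pN]] := N1P N N1N.
have p0 := prime_gt0 pp; have pR : (0 : R) < p%:R by rewrite ltr0n.
have anp : alpha * n%:R < p%:R by apply: lt_le_trans Na1 _; rewrite ler_nat.
have pan : p%:R <= alpha * n%:R * (1 + s%:R^-1).
  apply: (@le_trans _ _ (N + N %/ s)%:R); first by rewrite ler_nat.
  have s0' : (0 < s)%N by exact: leq_trans s10.
  have /andP[h _] := divn_floor R N s0'.
  rewrite natrD mulrDr mulr1; apply: lerD => //; apply: (le_trans h).
  by rewrite ler_wpM2r // invr_ge0 ltW.
have s1 : s%:R^-1 <= 1 :> R by rewrite invf_le1 // ler1n (leq_trans _ s10).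
have p2an : p%:R <= 2 * (alpha * n%:R).
  apply: (le_trans pan); rewrite mulrC ler_wpM2r //; lra.
have [T [xT [c [xinj xc xd cT]]]] := N2P n p n2 p0.
have xd' a' b' : \sum_i (xT a' ord0 i - xT b' ord0 i) ^+ 2 < (2 * p * m.+1)%:Z.
  rewrite -(ltr_int R); apply: (le_lt_trans (xd a' b')).
  have -> : ((2 * p * m.+1)%:Z)%:~R = 2 * p%:R * (m%:R + 1) :> R.
    by rewrite -[LHS]/((2 * p * m.+1)%:R) !natrM natr1.
  have -> : 4 * n%:R * rho = 2 * (alpha * n%:R) * (m%:R + 1) by rewrite /rho; field.
  by rewrite ltr_pM2r // ltr_pM2l.
apply: le_trans (chi_lattice_family R pp xinj xc xd').
rewrite lee_fin.
have mon : (1 + #|monomials n.+1 p.-1|)%:R <= 2 * (t ^- p * (1 - t) ^- n.+1) :> R.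
  rewrite natrD mulr_natl mulr2n; apply: lerD.
    rewrite -[1%:R](mulr1 1) ler_pM // -exprVn exprn_ege1 // invf_ge1 ?ltW //; clear -t0 t1; lra.
  apply: (le_trans (card_monomials_le _ _ (t := t) _)); first by rewrite t0.
  have u1 : 0 < (1 - t) ^- n.+1 by rewrite invr_gt0 exprn_gt0 // subr_gt0.
  rewrite (ler_pM2r u1) lef_pV2 ?posrE ?exprn_gt0 //.
  by rewrite -[in leLHS](prednK p0) exprS ler_piMl ?exprn_ge0 ?(ltW t0) ?(ltW t1).
have tp : (expR (- (1 / 2)) * expR (- (2 * s%:R)^-1)) ^+ n <= t ^+ p.
  rewrite -expRD -!expRM_natl ler_expR mulrN lerNr.
  apply: (@le_trans _ _ (alpha * n%:R * (1 + s%:R^-1) * x)); first by rewrite ler_wpM2r // ltW.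
  rewrite /alpha le_eqVlt; apply/orP; left; apply/eqP; rewrite !invfM; field.
  by rewrite !gt_eqF.
rewrite ler_pdivlMr ?ltr0n //.
apply: (@le_trans _ _ (D ^+ n * (2 * (t ^- p * (1 - t) ^- n.+1)))).
  by rewrite ler_wpM2l // exprn_ge0 // ltW.
have u0 : 0 < 1 - t by rewrite subr_gt0.
rewrite -(ler_pM2l (mulr_gt0 (ltr0n R 2) pR)).
rewrite !natrM in cT; apply: le_trans cT.
have -> : 2 * p%:R * (D ^+ n * (2 * (t ^- p * (1 - t) ^- n.+1))) =
   4 * p%:R * D ^+ n / (t ^+ p * (1 - t) ^+ n.+1) by field; rewrite !gt_eqF ?exprn_gt0.
rewrite ler_pdivrMr ?mulr_gt0 ?exprn_gt0 //.
apply: (@le_trans _ _ (L ^+ n * ((expR (- (1 / 2)) * expR (- (2 * s%:R)^-1)) ^+ n * (1 - t) ^+ n.+1)));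
    last first.
  by rewrite ler_wpM2l ?exprn_ge0 ?(ltW L0) // ler_wpM2r // exprn_ge0 // ltW.
have -> : L ^+ n * ((expR (- (1 / 2)) * expR (- (2 * s%:R)^-1)) ^+ n * (1 - t) ^+ n.+1) = (1 - t) * Y ^+ n.
  by rewrite exprS /Y !exprMn; ring.
have := N3P n n3; rewrite expr_div_n mulrA ler_pdivrMr ?exprn_gt0 // mulrAC ler_pdivlMr ?mulr_gt0 // => h.
apply: le_trans h.
have : p%:R * D ^+ n <= 2 * (alpha * n%:R) * D ^+ n by rewrite ler_wpM2r // exprn_ge0 // ltW.
by lra.
Qed.

End Assembly.

(** * From exponential rates below the limit to the o(1) form *)

Lemma m_distance_asymptotics (R : realType) (m : nat) (G : R) : 0 < G ->
  (forall D : R, 0 < D -> D < G -> exists N, forall n, (N <= n)%N ->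
    ((D ^+ n)%:E <= m_distance_chromatic_number R n m)%E) ->
  exists2 eps : nat -> R, eps @ \oo --> (0 : R) &
    forall n : nat, (1 <= n)%N ->
      (((G + eps n) ^+ n)%:E <= m_distance_chromatic_number R n m)%E.
Proof.
move=> G0 low; pose c n : R := fine (m_distance_chromatic_number R n m).
have cE n : m_distance_chromatic_number R n m = (c n)%:E.
  have [A _ [e fA]] := m_distance_chromatic_number_max R n m.
  by rewrite /c e fineK.
pose r n : R := Num.max 0 (c n) `^ n%:R^-1.
have r0 n : 0 <= r n by exact: powR_ge0.
have c0 n : 0 <= c n.
  rewrite -lee_fin -cE; have [A _ [-> _]] := m_distance_chromatic_number_max R n m.
  by apply: le_ereal_inf_tmp => _ [k _ <-]; rewrite lee_fin.
have rn n : (1 <= n)%N -> r n ^+ n = c n.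
  move=> n1; rewrite /r (max_idPr (c0 n)) -powR_mulrn ?powR_ge0 // -powRrM mulVf ?powRr1 //.
  by rewrite pnatr_eq0 -lt0n.
(* The n-th root may exceed G without any upper control, so the positive part of the error is cut
   off; the negative part tends to 0 by hypothesis. *)
exists (fun n => Num.min 0 (r n - G)); last first.
  move=> n n1; rewrite cE lee_fin -rn //; have rG := r0 n.
  have [h|h] := leP 0 (r n - G).
    by rewrite addr0 lerXn2r ?nnegrE ?(ltW G0) //; lra.
  by rewrite addrC subrK.
apply/cvgrPdist_le => e e0.
pose d := Num.min e (G / 2); have d0 : 0 < d by rewrite lt_min e0 divr_gt0.
have de : d <= e by rewrite ge_min lexx.
have dG : d <= G / 2 by rewrite ge_min lexx orbT.
have [N NP] := low (G - d) ltac:(lra) ltac:(lra).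
exists (maxn N 1) => // n /=; rewrite geq_max => /andP[Nn n1].
have h : G - d <= r n.
  have := NP n Nn; rewrite cE lee_fin -rn // ler_pXn2r ?nnegrE //.
  by rewrite subr_ge0; lra.
rewrite sub0r normrN ler_norml; apply/andP; split.
  by rewrite le_min oppr_le0 (ltW e0); lra.
by rewrite ge_min (ltW e0).
Qed.

(** * The value of the constant *)

Section AlternatingTaylor.
Variable R : realType.

Fixpoint taylor_term (k : nat) (x : R) : R :=
  if k is j.+1 then taylor_term j x * (x / j.+1%:R) else 1.

Fixpoint expN_taylor (n : nat) (x : R) : R :=
  if n is k.+1 then expN_taylor k x + (-1) ^+ k * taylor_term k x else 0.

Fixpoint cos_taylor (n : nat) (x : R) : R :=
  if n is k.+1 then cos_taylor k x + (-1) ^+ k * taylor_term k.*2 x else 0.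

Fixpoint sin_taylor (n : nat) (x : R) : R :=
  if n is k.+1 then sin_taylor k x + (-1) ^+ k * taylor_term k.*2.+1 x else 0.

Lemma ge0_of_derive (f df : R -> R) :
  (forall x : R, is_derive x (1 : R) f (df x)) -> f 0 = 0 -> (forall x, 0 <= x -> 0 <= df x) ->
  forall x, 0 <= x -> 0 <= f x.
Proof.
move=> fd f0 df0 x x0.
have [|c] := @MVT_segment R f df 0 x x0 (fun y _ => fd y).
  apply: continuous_subspaceT => y.
  by apply: differentiable_continuous; apply/derivable1_diffP; case: (fd y).
rewrite in_itv /= => /andP[c0 _].
by rewrite f0 !subr0 => ->; rewrite mulr_ge0 // df0.
Qed.

Lemma is_derive_taylor_term (k : nat) (x : R) :
  is_derive x (1 : R) (taylor_term k.+1) (taylor_term k x).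
Proof.
elim: k x => [|k IH] x.
  have -> : taylor_term 1 = (fun y : R => y) by apply/funext => y /=; rewrite mul1r divr1.
  exact: is_derive_id.
have := IH x => dk.
have dx : is_derive x (1 : R) (fun y : R => y / k.+2%:R) (k.+2%:R^-1).
  have -> : (fun y : R => y / k.+2%:R) = (fun y : R => k.+2%:R^-1 *: y).
    by apply/funext => y; rewrite mulrC.
  apply: is_derive_eq; by rewrite /GRing.scale /= mulr1.
apply: (is_derive_eq (is_deriveM dk dx)); rewrite /GRing.scale /=.
have p0 : (0 : R) < k.+1%:R by rewrite ltr0n.
rewrite -[k.+2%:R]natr1; field.
by rewrite !gt_eqF // addr_gt0.
Qed.

Lemma taylor_term0 (k : nat) : taylor_term k 0 = (k == 0%N)%:R.
Proof. by case: k => //= k; rewrite mul0r mulr0. Qed.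

Lemma expN_taylor0 (n : nat) : expN_taylor n.+1 0 = 1.
Proof.
elim: n => [|n IH]; first by rewrite /= add0r mulr1.
by rewrite -[LHS]/(expN_taylor n.+1 0 + _ * taylor_term n.+1 0) IH taylor_term0 mulr0 addr0.
Qed.

Lemma cos_taylor0 (n : nat) : cos_taylor n.+1 0 = 1.
Proof.
elim: n => [|n IH]; first by rewrite /= add0r mulr1.
by rewrite -[LHS]/(cos_taylor n.+1 0 + _ * taylor_term n.+1.*2 0) IH taylor_term0 mulr0 addr0.
Qed.

Lemma sin_taylor0 (n : nat) : sin_taylor n 0 = 0.
Proof. by elim: n => [|n IH] //=; rewrite IH mul0r !mulr0 addr0. Qed.

Lemma is_derive_addZ (f g : R -> R) (df dg c x : R) :
  is_derive x (1 : R) f df -> is_derive x (1 : R) g dg ->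
  is_derive x (1 : R) (fun y => f y + c * g y) (df + c * dg).
Proof.
move=> fd gd; have gZ := is_deriveZ c gd.
exact: (is_deriveD fd gZ).
Qed.

Lemma is_derive_expN_taylor (n : nat) (x : R) :
  is_derive x (1 : R) (expN_taylor n.+1) (- expN_taylor n x).
Proof.
elim: n => [|n IH].
  by apply: (is_derive_eq (is_derive_cst (0 + 1 * 1 : R) x 1)); rewrite /= oppr0.
apply: (is_derive_eq (is_derive_addZ ((-1) ^+ n.+1) IH (is_derive_taylor_term n x))).
by rewrite exprS /=; ring.
Qed.

Lemma is_derive_sin_taylor (n : nat) (x : R) :
  is_derive x (1 : R) (sin_taylor n) (cos_taylor n x).
Proof.
elim: n => [|n IH]; first exact: (is_derive_cst (0 : R) x 1).
exact: (is_derive_addZ ((-1) ^+ n) IH (is_derive_taylor_term n.*2 x)).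
Qed.

Lemma is_derive_cos_taylor (n : nat) (x : R) :
  is_derive x (1 : R) (cos_taylor n.+1) (- sin_taylor n x).
Proof.
elim: n => [|n IH].
  by apply: (is_derive_eq (is_derive_cst (0 + 1 * 1 : R) x 1)); rewrite /= oppr0.
apply: (is_derive_eq (is_derive_addZ ((-1) ^+ n.+1) IH (is_derive_taylor_term n.*2.+1 x))).
by rewrite exprS /=; ring.
Qed.

Lemma is_derive_expRN (x : R) : is_derive x (1 : R) (fun y => expR (- y)) (- expR (- x)).
Proof.
apply: (is_derive_eq (is_derive1_comp (is_derive_expR (- x)) (is_deriveN (is_derive_id x 1)))).
by rewrite /GRing.scale /= mulrN1.
Qed.

(** The derivative of the signed remainder is the signed remainder of one order less, and it
    vanishes at 0. *)
Lemma expN_taylor_sign (n : nat) (x : R) : 0 <= x ->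
  0 <= (-1) ^+ n * (expR (- x) - expN_taylor n x).
Proof.
elim: n x => [|n IH] x x0; first by rewrite mul1r subr0 expR_ge0.
pose s : R := (-1) ^+ n.+1.
have fd (y : R) : is_derive y (1 : R) (fun y => 0 + s * (expR (- y) + (-1) * expN_taylor n.+1 y))
    (0 + s * (- expR (- y) + (-1) * (- expN_taylor n y))).
  exact: (is_derive_addZ s (is_derive_cst (0 : R) y 1)
     (is_derive_addZ (-1) (is_derive_expRN y) (is_derive_expN_taylor n y))).
suff : 0 <= 0 + s * (expR (- x) + (-1) * expN_taylor n.+1 x) by rewrite add0r mulN1r.
apply: (ge0_of_derive fd _ _ x0).
  by rewrite oppr0 expR0 expN_taylor0 mulN1r subrr mulr0 addr0.
move=> y /IH; rewrite /s exprS; set A := _ ^+ n; lra.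
Qed.

(** Remainders of cosine and sine are each other's derivatives up to sign; the alternation starts
    from cos <= 1. *)
Lemma cos_taylor_sign (n : nat) (x : R) : 0 <= x ->
  0 <= (-1) ^+ n.+1 * (cos x - cos_taylor n.+1 x).
Proof.
have stepS k : (forall x, 0 <= x -> 0 <= (-1) ^+ k * (cos x - cos_taylor k x)) ->
    forall x, 0 <= x -> 0 <= (-1) ^+ k * (sin x - sin_taylor k x).
  move=> IH {}x x0; pose s : R := (-1) ^+ k.
  have fd (y : R) : is_derive y (1 : R) (fun y => 0 + s * (sin y + (-1) * sin_taylor k y))
      (0 + s * (cos y + (-1) * cos_taylor k y)).
    exact: (is_derive_addZ s (is_derive_cst (0 : R) y 1)
       (is_derive_addZ (-1) (is_derive_sin y) (is_derive_sin_taylor k y))).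
  suff : 0 <= 0 + s * (sin x + (-1) * sin_taylor k x) by rewrite add0r mulN1r.
  apply: (ge0_of_derive fd _ _ x0).
    by rewrite sin0 sin_taylor0 mulr0 addr0 mulr0 addr0.
  by move=> y /IH; rewrite /s add0r mulN1r.
have stepC k : (forall x, 0 <= x -> 0 <= (-1) ^+ k * (sin x - sin_taylor k x)) ->
    forall x, 0 <= x -> 0 <= (-1) ^+ k.+1 * (cos x - cos_taylor k.+1 x).
  move=> IH {}x x0; pose s : R := (-1) ^+ k.+1.
  have fd (y : R) : is_derive y (1 : R) (fun y => 0 + s * (cos y + (-1) * cos_taylor k.+1 y))
      (0 + s * (- sin y + (-1) * - sin_taylor k y)).
    exact: (is_derive_addZ s (is_derive_cst (0 : R) y 1)
       (is_derive_addZ (-1) (is_derive_cos y) (is_derive_cos_taylor k y))).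
  suff : 0 <= 0 + s * (cos x + (-1) * cos_taylor k.+1 x) by rewrite add0r mulN1r.
  apply: (ge0_of_derive fd _ _ x0).
    by rewrite cos0 cos_taylor0 mulN1r subrr mulr0 addr0.
  move=> y /IH; rewrite /s exprS; set A := _ ^+ k; lra.
have C1 y : 0 <= y -> 0 <= (-1) ^+ 1 * (cos y - cos_taylor 1 y).
  by move=> _; rewrite expr1 /=; have := cos_le1 y; lra.
by elim: n x => [|n IH] //; apply: stepC; apply: stepS.
Qed.

(* Nested evaluation keeps the denominators small. *)
Fixpoint expN_horner (n k : nat) (x : R) : R :=
  if n is m.+1 then 1 - x / k.+1%:R * expN_horner m k.+1 x else 0.

Fixpoint cos_horner (n k : nat) (x : R) : R :=
  if n is m.+1 then 1 - x / k.+1%:R * (x / k.+2%:R) * cos_horner m k.+2 x else 0.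

Lemma expN_taylorE (n : nat) (x : R) : expN_taylor n x = expN_horner n 0 x.
Proof.
suff h k : expN_taylor (k + n) x = expN_taylor k x + (-1) ^+ k * taylor_term k x * expN_horner n k x.
  by rewrite -[n in LHS]add0n h /= add0r !mul1r.
elim: n k => [|n IH] k; first by rewrite addn0 mulr0 addr0.
by rewrite addnS -addSn IH /= exprS; ring.
Qed.

Lemma cos_taylorE (n : nat) (x : R) : cos_taylor n x = cos_horner n 0 x.
Proof.
suff h k : cos_taylor (k + n) x =
    cos_taylor k x + (-1) ^+ k * taylor_term k.*2 x * cos_horner n k.*2 x.
  by rewrite -[n in LHS]add0n h /= add0r !mul1r.
elim: n k => [|n IH] k; first by rewrite addn0 mulr0 addr0.
by rewrite addnS -addSn IH doubleS /= exprS; ring.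
Qed.

(** The zero pi/2 is located by a sign change of the cosine: an even number of terms bounds it from
    below at the left end, an odd number from above at the right end. *)
Lemma pihalf_bounds :
  (15 * 10 ^+ 9 + 707 * 10 ^+ 6 + 963 * 10 ^+ 3 + 267) / 10 ^+ 10 < (pi : R) / 2 <
  (15 * 10 ^+ 9 + 707 * 10 ^+ 6 + 963 * 10 ^+ 3 + 269) / 10 ^+ 10.
Proof.
have p1 := pihalf_ge1 R; have p2 := pihalf_lt2 R.
set a : R := (X in X < _ < _); set b : R := (X in _ < _ < X).
have a0 : 0 <= a by rewrite /a; lra.
have b0 : 0 <= b by rewrite /b; lra.
have ca := cos_taylor_sign 7 a0; have cb := cos_taylor_sign 8 b0.
have ta : 0 < cos_taylor 8 a by rewrite cos_taylorE /a; clear; rewrite /=; lra.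
have tb : cos_taylor 9 b < 0 by rewrite cos_taylorE /b; clear; rewrite /=; lra.
have sa : 0 < cos a.
  by move: (cos_taylor 8 a) ca ta => u; rewrite -signr_odd expr0; lra.
have sb : cos b < 0.
  by move: (cos_taylor 9 b) cb tb => u; rewrite -signr_odd expr1; lra.
apply/andP; split; rewrite ltNge; apply/negP => h.
  have [e|ne] := eqVneq (pi / 2) a; first by move: sa; rewrite -e cos_pihalf ltxx.
  have : cos a < cos (pi / 2).
    by rewrite ltr_cos ?in_itv /= ?lt_neqAle ?ne //; apply/andP; split; rewrite /a; lra.
  by rewrite cos_pihalf; lra.
have : 0 <= cos b by apply: cos_ge0_pihalf; rewrite h andbT; lra.
by lra.
Qed.

End AlternatingTaylor.

(** * The maximizer of the profile and the decimals of the constant *)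

Section ProfileMaximum.
Variable R : realType.

(** With M the maximum, M^2 y - (1 - e^(-y))^2 is nonnegative for y > 0 and vanishes at c, so its
    derivative is 0 there; this form avoids differentiating the square root. *)
Lemma profile_max_critical (c : R) : 0 < c ->
  (forall x, 0 < x -> Gamma_profile x <= Gamma_profile c) -> expR (- c) * (1 + 2 * c) = 1.
Proof.
move=> c0 cmax; set M := Gamma_profile c.
have sq (x : R) : 0 < x -> Gamma_profile x ^+ 2 * x = (1 - expR (- x)) ^+ 2.
  move=> x0; rewrite /Gamma_profile exprMn exprVn sqr_sqrtr ?(ltW x0) //.
  by rewrite divfK // gt_eqF.
have g0 (x : R) : 0 < x -> 0 < Gamma_profile x.
  move=> x0; rewrite divr_gt0 ?sqrtr_gt0 // subr_gt0 -expR0 ltr_expR; lra.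
have fd (x : R) : is_derive x (1 : R) (fun y => M ^+ 2 * y - (1 - expR (- y)) * (1 - expR (- y)))
    (M ^+ 2 - 2 * ((1 - expR (- x)) * expR (- x))).
  have d1 : is_derive x (1 : R) (fun y => M ^+ 2 * y) (M ^+ 2 *: 1).
    exact: is_deriveZ.
  have d2 : is_derive x (1 : R) (fun y => 1 - expR (- y)) (0 - - expR (- x)).
    exact: (is_deriveB (is_derive_cst (1 : R) x 1) (is_derive_expRN x)).
  apply: (is_derive_eq (is_deriveB d1 (is_deriveM d2 d2))).
  by rewrite /GRing.scale /=; ring.
have d0 : is_derive c (1 : R) (fun y => M ^+ 2 * y - (1 - expR (- y)) * (1 - expR (- y))) 0.
  apply: (@derive1_at_min R _ 0 (c + c)).
  - lra.
  - by move=> t _; case: (fd t).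
  - by rewrite in_itv /=; lra.
  move=> t; rewrite in_itv /= => /andP[t0 _].
  rewrite -!expr2 -(sq c c0) -(sq t t0) subrr -mulrBl mulr_ge0 ?(ltW t0) // subr_ge0.
  by rewrite lerXn2r ?nnegrE ?(ltW (g0 _ _)) // cmax.
have e1 : M ^+ 2 = 2 * ((1 - expR (- c)) * expR (- c)).
  have := derive_val (is_derive := d0); rewrite (derive_val (is_derive := fd c)) => h; lra.
have := sq c c0; rewrite -/M e1 expr2 => h.
have u0 : 0 < 1 - expR (- c) by rewrite subr_gt0 -expR0 ltr_expR; lra.
have /(mulfI (lt0r_neq0 u0)) h' : (1 - expR (- c)) * (2 * expR (- c) * c) =
    (1 - expR (- c)) * (1 - expR (- c)) by rewrite -h; ring.
lra.
Qed.

(** Convexity: (e^x - 1)/x is nondecreasing. As the critical equation says that this slope is 2,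
    comparing slopes with 2 locates c and excludes the spurious root 0. *)
Lemma expR_slope_le (x y : R) : 0 <= x <= y -> y * (expR x - 1) <= x * (expR y - 1).
Proof.
move=> /andP[x0 xy].
have e0 := expR_gt0 x.
have -> : expR y = expR x * expR (y - x) by rewrite -expRD addrC subrK.
have e1 : 1 + (y - x) <= expR (y - x) := expR_ge1Dx _.
have e2 : 1 - x <= expR (- x) := expR_ge1Dx _.
have e3 := expRxMexpNx_1 x.
have h1 : expR x * (x * (1 + (y - x))) <= expR x * (x * expR (y - x)).
  by rewrite ler_wpM2l ?(ltW e0) // ler_wpM2l.
have h2 : expR x * ((y - x) * (1 - x)) <= expR x * ((y - x) * expR (- x)).
  by rewrite ler_wpM2l ?(ltW e0) // ler_wpM2l // subr_ge0.
have h3 : expR x * ((y - x) * expR (- x)) = y - x.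
  by rewrite mulrCA e3 mulr1.
nra.
Qed.

Lemma critical_point_bounds (c : R) : 0 < c -> expR (- c) * (1 + 2 * c) = 1 ->
  (12 * 10 ^+ 9 + 564 * 10 ^+ 6 + 312 * 10 ^+ 3 + 86) / 10 ^+ 10 < c <
  (125 * 10 ^+ 9 + 643 * 10 ^+ 6 + 120 * 10 ^+ 3 + 863) / 10 ^+ 11.
Proof.
move=> c0 ce.
set a : R := (X in X < _ < _); set b : R := (X in _ < _ < X).
have a0 : 0 < a by rewrite /a; lra.
have b0 : 0 < b by rewrite /b; lra.
have ea := expN_taylor_sign 18 (ltW a0); have eb := expN_taylor_sign 19 (ltW b0).
have ta : 1 < expN_taylor 18 a * (1 + 2 * a) by rewrite expN_taylorE /a; clear; rewrite /=; lra.
have tb : expN_taylor 19 b * (1 + 2 * b) < 1 by rewrite expN_taylorE /b; clear; rewrite /=; lra.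
have expE (x : R) : expR x * (expR (- x) * (1 + 2 * x)) = 1 + 2 * x.
  by rewrite mulrA expRxMexpNx_1 mul1r.
have ec : expR c = 1 + 2 * c by rewrite -expE ce mulr1.
have sa : expR a < 1 + 2 * a.
  rewrite -expE ltr_pMr ?expR_gt0 //; apply: lt_le_trans ta _.
  rewrite ler_wpM2r //; first by clear -a0; lra.
  by move: ea; move: (expN_taylor 18 a) => u; rewrite -signr_odd expr0 mul1r subr_ge0.
have sb : 1 + 2 * b < expR b.
  rewrite -expE gtr_pMr ?expR_gt0 //; apply: le_lt_trans tb.
  rewrite ler_wpM2r //; first by clear -b0; lra.
  by move: eb; move: (expN_taylor 19 b) => u; rewrite -signr_odd expr1 mulN1r opprB subr_ge0.
move: (a) (b) a0 b0 sa sb => {ea eb ta tb} {}a {}b a0 b0 sa sb.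
apply/andP; split; rewrite ltNge; apply/negP => h.
  have := @expR_slope_le c a; rewrite h (ltW c0) ec => /(_ isT); nra.
have := @expR_slope_le b c; rewrite h (ltW b0) ec => /(_ isT); nra.
Qed.

Lemma Gamma_chi_sqr : exists2 c : R, 0 < c /\ expR (- c) * (1 + 2 * c) = 1 &
  0 < Gamma_chi R /\ Gamma_chi R ^+ 2 * (1 + 2 * c) ^+ 2 = pi / 2 * (4 * c).
Proof.
have [c c0 cE] := Gamma_profile_max R.
have pc : 0 < Gamma_profile c.
  by rewrite divr_gt0 ?sqrtr_gt0 // subr_gt0 -expR0 ltr_expR; lra.
have cmax (x : R) : 0 < x -> Gamma_profile x <= Gamma_profile c.
  move=> x0; rewrite cE; apply: ub_le_sup; last by exists x.
  have : 0 < sup [set Gamma_profile x | x in [set x : R | 0 < x]] by rewrite -cE.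
  (* The supremum of an unbounded set defaults to 0, which the positivity just proved excludes. *)
  have [//|nub] := pselect (has_ubound [set Gamma_profile x | x in [set x : R | 0 < x]]).
  by rewrite sup_out ?ltxx // => -[].
have ce := profile_max_critical c0 cmax.
have p0 : 0 < (pi : R) / 2 by rewrite divr_gt0 ?pi_gt0.
exists c => //; split; first by rewrite /Gamma_chi -cE mulr_gt0 ?sqrtr_gt0.
have d0 : 1 + 2 * c != 0 by rewrite gt_eqF //; lra.
have -> : Gamma_chi R ^+ 2 = pi / 2 * ((1 - expR (- c)) ^+ 2 / c).
  by rewrite /Gamma_chi -cE /Gamma_profile !exprMn exprVn !sqr_sqrtr ?(ltW p0) ?(ltW c0).
have -> : expR (- c) = (1 + 2 * c)^-1 by apply: (mulIf d0); rewrite ce mulVf.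
by move: (pi / 2) => u; field; rewrite d0 gt_eqF.
Qed.

Lemma Gamma_chi_bounds :
  Gamma_chi_truncated R <= Gamma_chi R < Gamma_chi_truncated R + 1 / 10 ^+ 10.
Proof.
have [c [c0 ce] [G0 Gsq]] := Gamma_chi_sqr.
have /andP[c1 c2] := critical_point_bounds c0 ce.
have /andP[p1 p2] := pihalf_bounds R.
move: (Gamma_chi R) (pi / 2) G0 Gsq p1 p2 => G p G0 Gsq p1 p2.
have q0 : 0 < (1 + 2 * c) ^+ 2 by rewrite exprn_gt0 //; clear -c0; lra.
(* The linear solver treats c^2 as an atom: this product bounds it above by a chord, and [sc] bounds
   it below by a tangent. *)
have cc : 0 < (c - (12 * 10 ^+ 9 + 564 * 10 ^+ 6 + 312 * 10 ^+ 3 + 86) / 10 ^+ 10) *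
  ((125 * 10 ^+ 9 + 643 * 10 ^+ 6 + 120 * 10 ^+ 3 + 863) / 10 ^+ 11 - c).
  by apply: mulr_gt0; rewrite subr_gt0.
have sc := sqr_ge0 (c - (12 * 10 ^+ 9 + 564 * 10 ^+ 6 + 312 * 10 ^+ 3 + 86) / 10 ^+ 10).
have [pc1 pc2] : (15 * 10 ^+ 9 + 707 * 10 ^+ 6 + 963 * 10 ^+ 3 + 267) / 10 ^+ 10 * c < p * c
    /\ p * c < (15 * 10 ^+ 9 + 707 * 10 ^+ 6 + 963 * 10 ^+ 3 + 269) / 10 ^+ 10 * c.
  by split; rewrite (ltr_pM2r c0).
have pcE : p * (4 * c) = 4 * (p * c) by rewrite mulrCA.
move: (p * c) pcE pc1 pc2 => w pcE pc1 pc2.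
rewrite pcE in Gsq.
have [T0 T1 T2] : [/\ 0 < Gamma_chi_truncated R,
    Gamma_chi_truncated R ^+ 2 * (1 + 2 * c) ^+ 2 < 4 * w &
    4 * w < (Gamma_chi_truncated R + 1 / 10 ^+ 10) ^+ 2 * (1 + 2 * c) ^+ 2].
  rewrite /Gamma_chi_truncated; clear p p1 p2 pcE Gsq q0 ce G0; split.
  - clear; lra.
  - clear pc2 sc; lra.
  - clear pc1 cc; lra.
have e0 : 0 < (1 / 10 ^+ 10 : R) by rewrite divr_gt0 // exprn_gt0.
move: (Gamma_chi_truncated R) (1 / 10 ^+ 10) e0 T0 T1 T2 => T e e0 T0.
rewrite -Gsq !(ltr_pM2r q0) => T1 T2.
by rewrite -(ler_pXn2r (n := 2)) ?nnegrE ?(ltW T0) ?(ltW G0) // (ltW T1)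
  -(ltr_pXn2r (n := 2)) ?nnegrE ?addr_ge0 ?(ltW T0) ?(ltW e0) ?(ltW G0).
Qed.

End ProfileMaximum.

Theorem theorem1p1 (R : realType) :
  (forall m : nat, (1 <= m)%N ->
    exists2 eps : nat -> R, eps @ \oo --> (0 : R) &
      forall n : nat, (1 <= n)%N ->
        (((Gamma_chi R * Num.sqrt (m%:R + 1) + eps n) ^+ n)%:E
           <= m_distance_chromatic_number R n m)%E)
  /\ Gamma_chi_truncated R <= Gamma_chi R
       < Gamma_chi_truncated R + 1 / 10 ^+ 10.
Proof.
split; last exact: Gamma_chi_bounds.
move=> m _; have [c [c0 _] [G0 _]] := Gamma_chi_sqr R.
have [x x0 xE] := Gamma_profile_max R.
apply: m_distance_asymptotics.
  by rewrite mulr_gt0 ?sqrtr_gt0 // natr1 ltr0Sn.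
by move=> D D0; rewrite /Gamma_chi -xE; apply: m_distance_lower_bound.
Qed.
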